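(* Let $d\ge 1$ be fixed and let $m_n\to\infty$ as $n\to\infty$. Let $X_n\in\mathbb{R}^{n\times d}$, $y_n\in\mathbb{R}^n$ be deterministic, $\lambda_n>0$, and let $H_n,g_n,A_n,\beta_n$, the sketch rows $s_{n,i}$, compressed rows $(z_{n,i},u_{n,i})$, influence vectors $\psi_{n,i}$, sketched estimator $\widehat\beta_{n,m_n}$ and bootstrap estimator $\widehat\beta^*_{n,m_n,1}$ be as defined in the context. Assume: (i) as $n\to\infty$, $\lambda_n\to\lambda_\infty\ge 0$, $H_n\to H$, $g_n\to g$ (finite limits), and there is $c_0>0$ with $\lambda_{\min}(H_n+\lambda_n I_d)\ge c_0$ for all sufficiently large $n$; (ii) for every $n$, $s_{n,1},\dots,s_{n,m_n}$ are i.i.d. with $\mathbb{E}(s_{n,1}s_{n,1}^\top)=I_n$; $$\sup_n \mathbb{E}\Big[\|z_{n,1}z_{n,1}^\top-H_n\|_{\mathrm F}^4+\|z_{n,1}u_{n,1}-g_n\|_2^4\Big]<\infty;$$ and there is a finite matrix $\Omega\in\mathbb{R}^{d\times d}$ such that $\Omega_n:=\mathbb{E}(\psi_{n,1}\psi_{n,1}^\top)\to\Omega$; (iii) $\operatorname{rank}(\Omega)\ge1$. Then $$\sqrt{m_n}\,(\widehat\beta_{n,m_n}-\beta_n)\rightsquigarrow N(0,\Omega)$$ (weak convergence), and $$\sqrt{m_n}\,(\widehat\beta^*_{n,m_n,1}-\widehat\beta_{n,m_n})\rightsquigarrow N(0,\Omega)\quad\text{conditionally on the sketch, in probability with respect to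 the law of the sketch.}$$
   Context: All limits are along one sequence $n\to\infty$ with $d$ fixed. Define $H_n:=\frac1n X_n^\top X_n$, $g_n:=\frac1n X_n^\top y_n$, $A_n:=(H_n+\lambda_n I_d)^{-1}$, $\beta_n:=A_ng_n$ (the minimizer over $\beta\in\mathbb{R}^d$ of $\frac1n\|X_n\beta-y_n\|_2^2+\lambda_n\|\beta\|_2^2$). For random sketch rows $s_{n,1},\dots,s_{n,m}\in\mathbb{R}^n$ define $z_{n,i}:=n^{-1/2}X_n^\top s_{n,i}\in\mathbb{R}^d$, $u_{n,i}:=n^{-1/2}y_n^\top s_{n,i}\in\mathbb{R}$, $\widehat H_{n,m}:=\frac1m\sum_{i=1}^m z_{n,i}z_{n,i}^\top$, $\widehat g_{n,m}:=\frac1m\sum_{i=1}^m z_{n,i}u_{n,i}$, and the sketched estimator $\widehat\beta_{n,m}:=(\widehat H_{n,m}+\lambda_nI_d)^{-1}\widehat g_{n,m}$. The influence vectors are $\psi_{n,i}:=A_n\{z_{n,i}(u_{n,i}-z_{n,i}^\top\beta_n)-\lambda_n\beta_n\}$, which have mean zero when the rows are isotropic. Bootstrap: conditionally on the sketch, draw a weight vector $w_1=(w_{1,1},\dots,w_{1,m})\sim\mathrm{Multinomial}(m;\frac1m,\dots,\frac1m)$ and set $\widehat H^*_{n,m,1}:=\frac1m\sum_i w_{1,i}z_{n,i}z_{n,i}^\top$, $\widehat g^*_{n,m,1}:=\frac1m\sum_i w_{1,i}z_{n,i}u_{n,i}$, $\widehat\beta^*_{n,m,1}:=(\widehat H^*_{n,m,1}+\lambda_nI_d)^{-1}\widehat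 g^*_{n,m,1}$. Let $\mathbb{E}^*$ denote conditional expectation given $\sigma(s_{n,1},\dots,s_{n,m_n})$. ''$Y_n^*\rightsquigarrow Y$ conditionally, in probability with respect to the law of the sketch'' means: $\mathbb{E}^*h(Y_n^* )\to\mathbb{E}h(Y)$ in probability for every bounded Lipschitz function $h$. $\|\cdot\|_{\mathrm F}$ is the Frobenius norm and $\lambda_{\min}$ the smallest eigenvalue. *)

(* Defs.v *)
From HB Require Import structures.
From mathcomp Require Import all_boot all_order all_algebra.
From mathcomp Require Import all_classical all_reals all_analysis.

Set Implicit Arguments.
Unset Strict Implicit.
Unset Printing Implicit Defensive.

Import Order.TTheory GRing.Theory Num.Theory.
Import numFieldNormedType.Exports.

Local Open Scope classical_set_scope.
Local Open Scope ring_scope.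

(* R^n as a column space with its Borel sigma-algebra; as a type it is
   convertible to 'cV[R]_n. *)
Notation borelV R n := (g_sigma_algebraType (@open 'cV[R]_n)).

(* On a column vector this is the Euclidean norm; the library norm `|M| on
   matrices is the entrywise maximum. *)
Definition frobenius (R : realType) (p q : nat) (M : 'M[R]_(p, q)) : R :=
  Num.sqrt (\sum_(i < p) \sum_(j < q) M i j ^+ 2).

(* Meant for matrices with a nonempty, bounded below set of eigenvalues, such as
   a real symmetric matrix of positive size, for which inf is attained. *)
Definition lambda_min (R : realType) (d : nat) (M : 'M[R]_d) : R :=
  inf [set a : R | eigenvalue M a].

Section Ridge.
Variables (R : realType) (n d : nat) (X : 'M[R]_(n, d)) (y : 'cV[R]_n).
Variable lambda : R.

Definition gramH : 'M[R]_d := n%:R^-1 *: (X^T *m X).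

Definition crossg : 'cV[R]_d := n%:R^-1 *: (X^T *m y).

Definition resolvA : 'M[R]_d := invmx (gramH + lambda%:M).

Definition ridge : 'cV[R]_d := resolvA *m crossg.

Definition zrow (v : 'cV[R]_n) : 'cV[R]_d :=
  (Num.sqrt n%:R)^-1 *: (X^T *m v).

Definition urow (v : 'cV[R]_n) : R :=
  (Num.sqrt n%:R)^-1 * (y^T *m v) 0 0.

Definition influence (v : 'cV[R]_n) : 'cV[R]_d :=
  resolvA *m ((urow v - ((zrow v)^T *m ridge) 0 0) *: zrow v - lambda *: ridge).

Variables (m : nat) (s : 'I_m -> 'cV[R]_n).

Definition sketchH : 'M[R]_d :=
  m%:R^-1 *: \sum_(i < m) (zrow (s i) *m (zrow (s i))^T).

Definition sketchg : 'cV[R]_d :=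
  m%:R^-1 *: \sum_(i < m) (urow (s i) *: zrow (s i)).

Definition sketched_ridge : 'cV[R]_d :=
  invmx (sketchH + lambda%:M) *m sketchg.

Variable w : {ffun 'I_m -> nat}.

Definition bootH : 'M[R]_d :=
  m%:R^-1 *: \sum_(i < m) ((w i)%:R *: (zrow (s i) *m (zrow (s i))^T)).

Definition bootg : 'cV[R]_d :=
  m%:R^-1 *: \sum_(i < m) ((w i)%:R *: (urow (s i) *: zrow (s i))).

Definition boot_ridge : 'cV[R]_d :=
  invmx (bootH + lambda%:M) *m bootg.

End Ridge.

(* Entrywise expectation. fine sends an infinite expectation to 0, so a value
   carries information only when the entries are integrable. *)
Definition mx_expectation (R : realType) (dT : measure_display)
    (T : measurableType dT) (P : probability T R) (p q : nat)
    (M : T -> 'M[R]_(p, q)) : 'M[R]_(p, q) :=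
  \matrix_(i, j) fine ('E_P[fun t => M t i j])%E.

Definition identically_distributed (R : realType) (dT dE : measure_display)
    (T : measurableType dT) (E : measurableType dE) (P : probability T R)
    (I : finType) (Y : I -> T -> E) : Prop :=
  forall (i j : I) (B : set E), measurable B -> P (Y i @^-1` B) = P (Y j @^-1` B).

Definition mutually_independent (R : realType) (dT dE : measure_display)
    (T : measurableType dT) (E : measurableType dE) (P : probability T R)
    (I : finType) (Y : I -> T -> E) : Prop :=
  forall (J : {set I}) (B : I -> set E), (forall i, measurable (B i)) ->
    P [set t | forall i, i \in J -> B i (Y i t)] =
    (\prod_(i in J) P (Y i @^-1` B i))%E.

(* Y is a version of the conditional expectation of Z given the
   sigma-algebra F. *)
Definition is_cond_expectation (R : realType) (dT : measure_display)
    (T : measurableType dT) (P : probability T R) (F : set (set T))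
    (Z Y : T -> R) : Prop :=
  [/\ P.-integrable setT (EFin \o Z),
      P.-integrable setT (EFin \o Y),
      (forall B : set R, measurable B -> F (Y @^-1` B)) &
      (forall A : set T, F A ->
         \int[P]_(t in A) (Y t)%:E = \int[P]_(t in A) (Z t)%:E)%E].

(* A chosen version; any two versions agree almost surely. *)
Definition cond_expectation (R : realType) (dT : measure_display)
    (T : measurableType dT) (P : probability T R) (F : set (set T))
    (Z : T -> R) : T -> R :=
  xget (cst 0) [set Y | is_cond_expectation P F Z Y].

Definition multinomial_pmf (R : realType) (m N : nat) (p : 'I_m -> R)
    (k : {ffun 'I_m -> nat}) : R :=
  if (\sum_(i < m) k i == N)%N
  then (N`!)%:R / (\prod_(i < m) (k i)`!)%:R * \prod_(i < m) p i ^+ k i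
  else 0.

(* The conditional law of w given F is Multinomial(N; p). *)
Definition cond_multinomial (R : realType) (dT : measure_display)
    (T : measurableType dT) (P : probability T R) (F : set (set T))
    (m N : nat) (p : 'I_m -> R) (w : T -> {ffun 'I_m -> nat}) : Prop :=
  forall k : {ffun 'I_m -> nat},
    is_cond_expectation P F (\1_[set t | w t = k])
      (cst (multinomial_pmf N p k)).

(* nu is the law of a vector with k independent N(0,1) coordinates. *)
Definition standard_normal (R : realType) (k : nat)
    (nu : probability (borelV R k) R) : Prop :=
  forall B : 'I_k -> set R, (forall i, measurable (B i)) ->
    nu [set x : 'cV[R]_k | forall i, B i (x i 0)] =
    (\prod_(i < k) normal_prob (0 : R) 1 (B i))%E.

(* mu = N(0, Omega), as the law of L Z with Z standard normal and
   L L^T = Omega; Omega may be singular. *)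
Definition centered_normal (R : realType) (d : nat) (Omega : 'M[R]_d)
    (mu : probability (borelV R d) R) : Prop :=
  exists (k : nat) (L : 'M[R]_(d, k)) (nu : probability (borelV R k) R),
    [/\ standard_normal nu, L *m L^T = Omega &
        forall B : set (borelV R d), measurable B ->
          mu B = nu [set x : 'cV[R]_k | B (L *m x)]].

Section Convergence.
Variables (R : realType) (d : nat) (dT : nat -> measure_display).
Variables (T : forall n, measurableType (dT n)) (P : forall n, probability (T n) R).

Definition cvg_weakly (Y : forall n, T n -> 'cV[R]_d)
    (mu : probability (borelV R d) R) : Prop :=
  forall h : 'cV[R]_d -> R, continuous h -> bounded_fun h ->
    ('E_(P n)[fun t => h (Y n t)] @[n --> \oo] --> \int[mu]_x (h x)%:E)%E.

Definition cvg_in_probability (Z : forall n, T n -> R) (c : R) : Prop :=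
  forall eps : R, 0 < eps ->
    P n [set t | eps <= `|Z n t - c|] @[n --> \oo] --> 0%E.

(* Lipschitz is with respect to the maximum norm on R^d, which gives the same
   class of functions as the Euclidean norm. *)
Definition cvg_cond_weakly (F : forall n, set (set (T n)))
    (Y : forall n, T n -> 'cV[R]_d) (mu : probability (borelV R d) R) : Prop :=
  forall h : 'cV[R]_d -> R, lipschitz h -> bounded_fun h ->
    cvg_in_probability
      (fun n => cond_expectation (P n) (F n) (fun t => h (Y n t)))
      (fine (\int[mu]_x (h x)%:E)%E).

End Convergence.

(* Main.v *)
(* Let S be m^(-1/2) times the sum of the influence vectors, Hs the sketched and
   H the true Gram matrix. Resolvent identities bound the squared distance
   between S and the normalized error of the sketched estimator by a multiple of
   |Hs - H|^2 |S|^2, where |Hs - H|^2 has mean O(1/m); the bootstrap error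
   satisfies a similar bound. Hence only the linear statistics matter.

   A bounded continuous h is replaced by a trigonometric polynomial q with
   |q| <= sup |h| (a Bernstein polynomial in the sin (w x_i)), so that
   |h(S') - q(S)| <= e (1 + |S|^2) + K |S - S'|^2 and second moments suffice.
   The mean of cos (c + th.S) converges to exp (- v / 2) cos c by peeling off one
   independent summand at a time; for the bootstrap the summands are the m draws
   that make up the multinomial weights.

   The conditional expectation of h at the bootstrap error has an explicit
   version, the multinomial average over the weights; it converges to the
   Gaussian integral in L^1, and Markov's inequality on the sketch
   sigma-algebra transfers this to the chosen version. *)

Require Import Defs.
From HB Require Import structures.
From mathcomp Require Import all_boot all_order all_algebra.
From mathcomp Require Import all_classical all_reals all_analysis.
From mathcomp Require Import measurable_realfun.
From mathcomp Require Import ring lra.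

Set Implicit Arguments.
Unset Strict Implicit.
Unset Printing Implicit Defensive.

Import Order.TTheory GRing.Theory Num.Theory.
Import numFieldNormedType.Exports.

Local Open Scope classical_set_scope.
Local Open Scope ring_scope.

(** All limits are computed with real integrals of cos (c + x) at an arbitrary phase c: since sin x
    = cos (x - pi / 2), this family is closed under the addition formula and replaces complex
    exponentials. Independence and conditional laws are given on events only; an identity of
    integrals known on the events of a variable V extends to bounded functions of V by uniform step
    approximation, and this one device serves independence, changes of law and the conditional
    multinomial law. The approximant of h must obey the same bound as h because outside a ball,
    where it says nothing about h, the only control is 2 sup |h| against e |S|^2, as in Chebyshev's
    inequality. Inverses are handled through lower bounds on quadratic forms: such a bound passes,
    with c / 2, from H + lambda I to the sketched and bootstrap matrices when these are close enough
    in Frobenius norm; outside that event, where [invmx] may meet a singular matrix, bounded test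
    functions and Markov's inequality suffice. *)

Lemma measurable_preim d d' (T : measurableType d) (T' : measurableType d')
    (f : T -> T') (B : set T') :
  measurable_fun setT f -> measurable B -> measurable (f @^-1` B).
Proof. by move=> mf mB; rewrite -[X in measurable X]setTI; exact: mf. Qed.

(** * Real-valued integrals and second moments *)

Section integral_tools.
Context d (T : measurableType d) (R : realType) (mu : {measure set T -> \bar R}).
Implicit Types f g : T -> R.

Lemma integrable_sumR (I : Type) (s : seq I) (f : I -> T -> R) :
  (forall i, mu.-integrable setT (EFin \o f i)) ->
  mu.-integrable setT (EFin \o (fun x => \sum_(i <- s) f i x)).
Proof.
move=> fi.
rewrite (_ : _ \o _ = (fun x => \sum_(i <- s) (EFin \o f i) x)%E); last first.
  by apply/funext => x /=; rewrite -sumEFin.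
exact: integrable_sum.
Qed.

Lemma Rintegral_sum (I : Type) (s : seq I) (f : I -> T -> R) :
  (forall i, mu.-integrable setT (EFin \o f i)) ->
  \int[mu]_x (\sum_(i <- s) f i x) = \sum_(i <- s) \int[mu]_x f i x.
Proof.
move=> fi; elim: s => [|i s IH].
  by under eq_Rintegral do rewrite big_nil; rewrite Rintegral_cst// mul0r big_nil.
under eq_Rintegral do rewrite big_cons.
by rewrite RintegralD//; [rewrite IH big_cons|exact: integrable_sumR].
Qed.

Lemma integrableDR f g : mu.-integrable setT (EFin \o f) ->
  mu.-integrable setT (EFin \o g) -> mu.-integrable setT (EFin \o (fun x => f x + g x)).
Proof.
by move=> fi gi; rewrite (_ : _ \o _ = (EFin \o f) \+ (EFin \o g))%E//; exact: integrableD.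
Qed.

Lemma integrableZR (k : R) f : mu.-integrable setT (EFin \o f) ->
  mu.-integrable setT (EFin \o (fun x => k * f x)).
Proof.
move=> fi; rewrite (_ : _ \o _ = (fun x => k%:E * (EFin \o f) x)%E)//.
exact: integrableZl.
Qed.

Lemma integrableBR f g : mu.-integrable setT (EFin \o f) ->
  mu.-integrable setT (EFin \o g) -> mu.-integrable setT (EFin \o (fun x => f x - g x)).
Proof.
by move=> fi gi; rewrite (_ : _ \o _ = (EFin \o f) \- (EFin \o g))%E//; exact: integrableB.
Qed.

Lemma integrable_measurable f : mu.-integrable setT (EFin \o f) -> measurable_fun setT f.
Proof. by move/integrableP => [/measurable_EFinP]. Qed.

Lemma le_integrableR f g : measurable_fun setT f ->
  (forall x, `|f x| <= g x) -> mu.-integrable setT (EFin \o g) ->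
  mu.-integrable setT (EFin \o f).
Proof.
move=> mf fg gi; apply: (le_integrable _ _ _ gi) => //; first exact/measurable_EFinP.
by move=> x _ /=; rewrite lee_fin (le_trans (fg x))// ler_norm.
Qed.

Lemma integrableM_bounded f g (M : R) : mu.-integrable setT (EFin \o f) ->
  measurable_fun setT g -> (forall x, `|g x| <= M) ->
  mu.-integrable setT (EFin \o (fun x => f x * g x)).
Proof.
move=> fi mg gM; apply: (@le_integrableR _ (fun x => M * `|f x|)).
- by apply: measurable_funM => //; exact: integrable_measurable.
- by move=> x; rewrite normrM mulrC ler_wpM2r.
- apply: integrableZR; exact: integrable_norm.
Qed.

Lemma indicE_le1 (A : set T) x : `|\1_A x : R| <= 1.
Proof. by rewrite indicE; case: (_ \in _); rewrite ?normr1 ?normr0. Qed.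

Lemma integrableM_indic f (A : set T) : mu.-integrable setT (EFin \o f) ->
  measurable A -> mu.-integrable setT (EFin \o (fun x => f x * \1_A x)).
Proof.
move=> fi mA; apply: (integrableM_bounded fi); first exact: measurable_indic.
exact: indicE_le1.
Qed.

Lemma Rintegral_dominated_cvg (f_ : nat -> T -> R) (f g : T -> R) :
  (forall n, measurable_fun setT (f_ n)) -> mu.-integrable setT (EFin \o g) ->
  (forall x, f_ n x @[n --> \oo] --> f x) -> (forall n x, `|f_ n x| <= g x) ->
  \int[mu]_x f_ n x @[n --> \oo] --> \int[mu]_x f x.
Proof.
move=> mf ig ff fg.
have iff : mu.-integrable setT (EFin \o f).
  apply: (le_integrableR _ _ ig).
    by apply: (@measurable_fun_cvg _ _ _ setT f_) => // x _; exact: ff.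
  move=> x; have h : `|f_ n x| @[n --> \oo] --> `|f x| by exact: cvg_norm (ff x).
  rewrite -(cvg_lim _ h)//.
  by apply: limr_le; [apply/cvg_ex; exists (`|f x|)|apply: nearW => n; exact: fg].
rewrite /Rintegral; apply: fine_cvg; rewrite fineK; last exact: integrable_fin_num.
apply: (@dominated_cvg _ _ _ mu _ _ (fun n x => (f_ n x)%:E) _ (EFin \o g)) => //.
- by move=> n; exact/measurable_EFinP.
- by move=> x _; apply: cvg_EFin; [exact: nearW|exact: ff].
- by move=> n x _; rewrite /= lee_fin.
Qed.

End integral_tools.
Arguments indicE_le1 {d T R}.

Section expectation_tools.
Context d (T : measurableType d) (R : realType) (P : probability T R).
Implicit Types f g : T -> R.

Lemma bounded_integrable f (M : R) : measurable_fun setT f ->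
  (forall x, `|f x| <= M) -> P.-integrable setT (EFin \o f).
Proof.
move=> mf fM; apply: measurable_bounded_integrable => //.
  by rewrite (le_lt_trans (probability_le1 P measurableT))// ltry.
by exists M; split => [|r Mr x _]; [exact: num_real|exact: le_trans (fM x) (ltW Mr)].
Qed.

Lemma Rintegral_indic (A : set T) : measurable A -> \int[P]_x \1_A x = fine (P A).
Proof. by move=> mA; rewrite /Rintegral integral_indic// setIT. Qed.

Lemma integrable_cstR (k : R) : P.-integrable setT (EFin \o (fun=> k)).
Proof. exact: finite_measure_integrable_cst. Qed.

Lemma Rintegral_cstP (k : R) : \int[P]_x k = k.
Proof. by rewrite Rintegral_cst//= probability_setT mulr1. Qed.

Lemma Rintegral_norm_le f (M : R) : measurable_fun setT f ->
  (forall x, `|f x| <= M) -> `|\int[P]_x f x| <= M.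
Proof.
move=> mf fM; have fi := bounded_integrable mf fM.
rewrite (le_trans (le_normr_Rintegral _ _))// -[leRHS]Rintegral_cstP.
by apply: le_Rintegral => //; [exact: integrable_norm|exact: integrable_cstR].
Qed.

Lemma integrableM_sqr f g : measurable_fun setT f -> measurable_fun setT g ->
  P.-integrable setT (EFin \o (fun x => f x ^+ 2)) ->
  P.-integrable setT (EFin \o (fun x => g x ^+ 2)) ->
  P.-integrable setT (EFin \o (fun x => f x * g x)).
Proof.
move=> mf mg if2 ig2; apply: (le_integrableR _ _ (integrableDR if2 ig2)).
  exact: measurable_funM.
move=> x; rewrite normrM -(real_normK (num_real (f x))) -(real_normK (num_real (g x))).
move: (normr_ge0 (f x)) (normr_ge0 (g x)); set a := `|_|; set b := `|_| => a0 b0.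
by have := sqr_ge0 (a - b); have := mulr_ge0 a0 b0; nra.
Qed.

Lemma sqr_integrable f : measurable_fun setT f ->
  P.-integrable setT (EFin \o (fun x => f x ^+ 2)) -> P.-integrable setT (EFin \o f).
Proof.
move=> mf if2; rewrite (_ : f = fun x => f x * 1); last by apply/funext => x; rewrite mulr1.
by apply: integrableM_sqr => //; exact: integrable_cstR.
Qed.

End expectation_tools.

(** * Step functions and factorization of integrals *)

Section step_approximation.
Context (R : realType) (M : R) (n : nat).

(** Strictly larger than [|M|], so that the half-open cells starting at - K also cover the value M;
    positive whatever M is. *)
Let K : R := `|M| + 1.
Let h : R := 2 * K / n.+1%:R.
Let a (k : nat) : R := - K + k%:R * h.

Definition stepset (k : nat) : set R := `[a k, a k.+1[%classic.

Definition stepfun (x : R) : R := \sum_(k < n.+1) a k * \1_(stepset k) x.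

Lemma measurable_stepset k : measurable (stepset k).
Proof. exact: measurable_itv. Qed.

(** The half-open cells are disjoint and cover [- K, K[, so exactly one term of [stepfun] survives,
    that of index floor ((x + K) / h), and its value is the left end of the cell. *)
Lemma stepfun_close (x : R) : `|x| <= M -> `|x - stepfun x| <= h.
Proof.
move=> xM.
have K0 : 0 < K by rewrite ltr_wpDl.
have h0 : 0 < h by rewrite divr_gt0// mulr_gt0.
have /andP[/ltW xKl xKr] : - K < x < K.
  rewrite -ltr_norml (le_lt_trans xM)// (le_lt_trans (ler_norm M))//.
  by rewrite ltrDl.
have y0 : 0 <= (x + K) / h by apply: divr_ge0; [lra|exact: ltW].
have := truncn_itv y0; set k := Num.truncn _ => /andP[k1 k2].
have kn : (k < n.+1)%N.
  rewrite -(ltr_nat R) (le_lt_trans k1)// ltr_pdivrMr// /h mulrCA divff ?pnatr_eq0//.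
  by rewrite mulr1; lra.
have ka : a k <= x by move: k1; rewrite /a ler_pdivlMr// => k1; lra.
have ka' : x < a k.+1 by move: k2; rewrite /a ltr_pdivrMr// => k2; lra.
rewrite /stepfun (bigD1 (Ordinal kn))//= big1 ?addr0 => [|j jk].
  rewrite indicE mem_set; last by rewrite /stepset/= in_itv/= ka ka'.
  rewrite mulr1 ger0_norm ?subr_ge0//.
  by move: ka'; rewrite /a -natr1 mulrDl mul1r => ka'; lra.
rewrite indicE memNset ?mulr0// /stepset/= in_itv/= => /andP[j1 j2].
move/eqP: jk; apply; apply/val_inj => /=; apply/eqP; rewrite eqn_leq.
rewrite -ltnS -[in X in _ && X]ltnS -!(ltr_nat R).
apply/andP; split; rewrite -(ltr_pM2r h0) -(ltrD2l (- K)).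
  exact: le_lt_trans j1 ka'.
exact: le_lt_trans ka j2.
Qed.

End step_approximation.

Section factorization.
Context d d' (T : measurableType d) (T' : measurableType d') (R : realType).
Variables (mu : {measure set T -> \bar R}) (P : probability T' R).
Variables (G V : T -> R) (W : T' -> R) (c M : R).
Hypothesis iG : mu.-integrable setT (EFin \o G).
Hypotheses (mV : measurable_fun setT V) (mW : measurable_fun setT W).
Hypotheses (VM : forall x, `|V x| <= M) (WM : forall x, `|W x| <= M).
Hypothesis GV : forall B : set R, measurable B ->
  \int[mu]_x (G x * \1_(V @^-1` B) x) = c * fine (P (W @^-1` B)).

(* V and W are approximated uniformly by step functions of V and W, for which
   the identity is the hypothesis GV. *)
Lemma Rintegral_transfer_bounded :
  \int[mu]_x (G x * V x) = c * \int[P]_x W x.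
Proof.
pose K : R := `|M| + 1.
have iW := bounded_integrable P mW WM.
have iGV := integrableM_bounded iG mV VM.
pose C : R := \int[mu]_x `|G x| + `|c|.
have C0 : 0 <= C by rewrite addr_ge0// Rintegral_ge0.
(* 2 K / (n + 1) is the mesh of the step functions; it tends to 0 while C does not depend on n. *)
suff H (n : nat) : `|\int[mu]_x (G x * V x) - c * \int[P]_x W x| <= (2 * K / n.+1%:R) * C.
  apply/eqP; rewrite -subr_eq0 -normr_le0; apply/ler_addgt0Pl => e e0.
  rewrite addr0; pose n := Num.truncn (2 * K * C / e).
  apply: (le_trans (H n)).
  have : 2 * K * C / e < n.+1%:R by exact: truncnS_gt.
  rewrite ltr_pdivrMr// => /ltW nC; rewrite mulrAC ler_pdivrMr//.
  by rewrite [e * _]mulrC.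
pose B := stepset M n; pose phi := stepfun M n.
have mB k : measurable (B k) by exact: measurable_stepset.
have mVB k : measurable (V @^-1` B k) by exact: measurable_preim.
have mWB k : measurable (W @^-1` B k) by exact: measurable_preim.
have iG1 k : mu.-integrable setT (EFin \o (fun x => G x * \1_(V @^-1` B k) x)).
  exact: integrableM_indic.
have i1 k : P.-integrable setT (EFin \o (\1_(W @^-1` B k) : T' -> R)).
  exact: integrable_indic.
have E (x : T) : G x * phi (V x) =
    \sum_(k < n.+1) (- K + k%:R * (2 * K / n.+1%:R)) * (G x * \1_(V @^-1` B k) x).
  by rewrite mulr_sumr; apply: eq_bigr => k _; rewrite mulrCA.
have E' (x : T') : phi (W x) =
    \sum_(k < n.+1) (- K + k%:R * (2 * K / n.+1%:R)) * \1_(W @^-1` B k) x.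
  by [].
have iphi : P.-integrable setT (EFin \o (fun x => phi (W x))).
  by under eq_fun do rewrite E'; apply: integrable_sumR => k; exact/integrableZR.
have iGphi : mu.-integrable setT (EFin \o (fun x => G x * phi (V x))).
  by under eq_fun do rewrite E; apply: integrable_sumR => k; exact/integrableZR.
have Gphi : \int[mu]_x (G x * phi (V x)) = c * \int[P]_x phi (W x).
  under eq_Rintegral do rewrite E.
  under [in RHS]eq_Rintegral do rewrite E'.
  rewrite !Rintegral_sum; last 2 first.
  - by move=> k; exact/integrableZR.
  - by move=> k; exact/integrableZR.
  rewrite mulr_sumr; apply: eq_bigr => k _.
  rewrite (RintegralZl _ _ (iG1 k))// (RintegralZl _ _ (i1 k))//.
  by rewrite [RHS]mulrCA GV// (Rintegral_indic _ (mWB k)).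
(* The step functions satisfy the identity exactly, so only the two approximation errors remain. *)
rewrite (_ : _ - _ = \int[mu]_x (G x * (V x - phi (V x))) - c * \int[P]_x (W x - phi (W x)));
    last first.
  under [X in _ = X - _]eq_Rintegral do rewrite mulrBr.
  by rewrite !RintegralB// Gphi; ring.
have iD := integrableBR iW iphi.
have iGD : mu.-integrable setT (EFin \o (fun x => G x * (V x - phi (V x)))).
  by under eq_fun do rewrite mulrBr; exact: integrableBR.
rewrite (le_trans (ler_normB _ _))// mulrDr lerD//.
  rewrite (le_trans (le_normr_Rintegral _ _))// -RintegralZl//; last exact: integrable_norm.
  apply: le_Rintegral => //; first exact: integrable_norm.
    by apply/integrableZR; exact: integrable_norm.
  by move=> x _; rewrite normrM mulrC ler_wpM2r// stepfun_close.
rewrite normrM mulrC ler_wpM2r//; apply: Rintegral_norm_le.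
  exact: integrable_measurable iD.
by move=> x; exact: stepfun_close.
Qed.

End factorization.

Section factorization_unbounded.
Context d (T : measurableType d) (R : realType) (P : probability T R).

(** The hypothesis on events says that the conditional expectation of G given V is the constant
    c. *)
Lemma Rintegral_factor_bounded (G V : T -> R) (c M : R) :
  P.-integrable setT (EFin \o G) -> measurable_fun setT V ->
  (forall x, `|V x| <= M) ->
  (forall B : set R, measurable B ->
    \int[P]_x (G x * \1_(V @^-1` B) x) = c * fine (P (V @^-1` B))) ->
  \int[P]_x (G x * V x) = c * \int[P]_x V x.
Proof. by move=> iG mV VM GV; exact: (Rintegral_transfer_bounded iG mV mV VM VM GV). Qed.

(** Truncation of V to [- n, n] gives bounded functions of V, whose events are events of V;
    dominated convergence, by |G V| and |V|, removes the truncation. *)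
Lemma Rintegral_factor (G V : T -> R) (c : R) :
  P.-integrable setT (EFin \o G) -> P.-integrable setT (EFin \o V) ->
  P.-integrable setT (EFin \o (fun x => G x * V x)) ->
  (forall B : set R, measurable B ->
    \int[P]_x (G x * \1_(V @^-1` B) x) = c * fine (P (V @^-1` B))) ->
  \int[P]_x (G x * V x) = c * \int[P]_x V x.
Proof.
move=> iG iV iGV GV.
have mV := integrable_measurable iV.
pose tau (n : nat) (v : R) : R := v * \1_(`[- n%:R, n%:R]%classic) v.
have mtau n : measurable_fun setT (tau n).
  by apply: measurable_funM => //; apply: measurable_indic; exact: measurable_itv.
have taule n v : `|tau n v| <= `|v|.
  by rewrite /tau normrM -[leRHS]mulr1 ler_wpM2l// indicE_le1.
have taub n v : `|tau n v| <= n%:R.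
  rewrite /tau indicE; have [|_] := boolP (_ \in _); last by rewrite mulr0 normr0.
  by rewrite inE/= in_itv/= mulr1 ler_norml.
have tauc v : tau n v @[n --> \oo] --> v.
  apply: cvg_near_cst; near=> n; rewrite /tau indicE mem_set ?mulr1//=.
  rewrite in_itv/= -ler_norml.
  near: n; exact: nbhs_infty_ger.
have step n : \int[P]_x (G x * tau n (V x)) = c * \int[P]_x tau n (V x).
  apply: (Rintegral_factor_bounded iG _ (fun x => taub n (V x))).
    exact: measurableT_comp.
  move=> B mB; rewrite -[X in X @^-1` B]/(tau n \o V) comp_preimage; apply: GV.
  by rewrite -[X in measurable X]setTI; exact: mtau.
have c1 : \int[P]_x (G x * tau n (V x)) @[n --> \oo] --> \int[P]_x (G x * V x).
  apply: (@Rintegral_dominated_cvg _ _ _ _ _ _ (fun x => `|G x * V x|)).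
  - move=> n; apply: measurable_funM; first exact: integrable_measurable iG.
    exact: measurableT_comp.
  - exact: integrable_norm.
  - by move=> x; apply: cvgM; [exact: cvg_cst|exact: tauc].
  - by move=> n x; rewrite normrM [leRHS]normrM; apply: ler_wpM2l => //; exact: taule.
have c2 : c * \int[P]_x (tau n (V x)) @[n --> \oo] --> c * \int[P]_x V x.
  apply: cvgM; first exact: cvg_cst.
  apply: (@Rintegral_dominated_cvg _ _ _ _ _ _ (fun x => `|V x|)) => //.
  - by move=> n; exact: measurableT_comp.
  - exact: integrable_norm.
move: c1; under eq_cvg do rewrite step.
move=> c1.
exact: (cvg_unique _ c1 c2).
Unshelve. all: by end_near. Qed.

End factorization_unbounded.

(** * Independence and cosines of sums *)

Section independence.
Context d (T : measurableType d) (R : realType) (P : probability T R).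

Lemma indicM (A B : set T) x : \1_A x * \1_B x = \1_(A `&` B) x :> R.
Proof. by rewrite indicI. Qed.

Lemma fin_num_prob (A : set T) : measurable A -> P A \is a fin_num.
Proof. by move=> mA; exact: fin_num_measure. Qed.

Section pair.
Variables (I : finType) (V : I -> T -> R).
Hypothesis mV : forall i, measurable_fun setT (V i).
Hypothesis ind : mutually_independent P V.

Lemma indep_pair (i j : I) (B C : set R) : i != j -> measurable B -> measurable C ->
  P (V i @^-1` B `&` V j @^-1` C) = (P (V i @^-1` B) * P (V j @^-1` C))%E.
Proof.
move=> ij mB mC.
have := @ind [set i; j]%SET (fun k => if k == i then B else C).
rewrite big_setU1/= ?inE// big_set1 eqxx (negbTE (_ : j != i)) 1?eq_sym// => <-.
  congr (P _); apply/seteqP; split => [t [Bi Cj] k|t H].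
    by rewrite !inE => /orP[/eqP ->|/eqP ->]; rewrite ?eqxx// eq_sym (negbTE ij).
  split; first by have := H i; rewrite !inE !eqxx; exact.
  by have := H j; rewrite !inE eqxx orbT eq_sym (negbTE ij); exact.
by move=> k; case: ifP.
Qed.

(** [Rintegral_factor] is used twice: it reduces the integrand to [V i] times the indicator of an
    event of [V j], then to the indicator of an intersection, where independence applies. *)
Lemma indep_Rintegral_mul (i j : I) : i != j ->
  P.-integrable setT (EFin \o V i) -> P.-integrable setT (EFin \o V j) ->
  P.-integrable setT (EFin \o (fun x => V i x * V j x)) ->
  \int[P]_x (V i x * V j x) = \int[P]_x V i x * \int[P]_x V j x.
Proof.
move=> ij iVi iVj iVV; apply: Rintegral_factor => // B mB.
under eq_Rintegral do rewrite mulrC.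
have mjB : measurable (V j @^-1` B) by exact: measurable_preim.
rewrite [RHS]mulrC; apply: Rintegral_factor => //.
- exact: integrable_indic.
- under eq_fun do rewrite mulrC.
  apply: (integrableM_bounded iVi); first exact: measurable_indic.
  exact: indicE_le1.
- move=> C mC.
  have miC : measurable (V i @^-1` C) by exact: measurable_preim.
  under eq_Rintegral do rewrite indicM.
  rewrite Rintegral_indic; last exact: measurableI.
  by rewrite setIC indep_pair// fineM// ?fin_num_prob// mulrC.
Qed.

(** In the expanded square the mixed terms are products of zero means; only the diagonal
    contributes. *)
Lemma indep_Rintegral_sqr_sum (C : R) (s : seq I) : uniq s ->
  (forall i, P.-integrable setT (EFin \o (fun x => V i x ^+ 2))) ->
  (forall i, \int[P]_x V i x = 0) ->
  (forall i, \int[P]_x (V i x ^+ 2) <= C) ->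
  P.-integrable setT (EFin \o (fun x => (\sum_(i <- s) V i x) ^+ 2)) /\
  \int[P]_x ((\sum_(i <- s) V i x) ^+ 2) <= (size s)%:R * C.
Proof.
move=> us iV2 V0 VC.
have iVV i j : P.-integrable setT (EFin \o (fun x => V i x * V j x)).
  exact: integrableM_sqr.
have iV i : P.-integrable setT (EFin \o V i) by exact: sqr_integrable.
have E x : (\sum_(i <- s) V i x) ^+ 2 = \sum_(i <- s) \sum_(j <- s) V i x * V j x.
  by rewrite expr2 mulr_suml; apply: eq_bigr => i _; rewrite mulr_sumr.
split.
  by under eq_fun do rewrite E; do 2 apply: integrable_sumR => ?.
under eq_Rintegral do rewrite E.
rewrite Rintegral_sum; last by move=> i; exact: integrable_sumR.
rewrite -sum1_size natr_sum mulr_suml big_seq [leRHS]big_seq; apply: ler_sum => i si.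
rewrite mul1r Rintegral_sum// (bigD1_seq i)//= big1 => [|j ji].
  by rewrite addr0; have := VC i; under eq_Rintegral do rewrite expr2.
by rewrite indep_Rintegral_mul// 1?eq_sym// V0 mul0r.
Qed.

End pair.

Section cosines.
Variables (I : finType) (V : I -> T -> R).
Hypothesis mV : forall i, measurable_fun setT (V i).
Hypothesis ind : mutually_independent P V.

Lemma measurable_cos_comp (f : T -> R) : measurable_fun setT f ->
  measurable_fun setT (fun x => cos (f x)).
Proof.
by move=> mf; apply: (measurableT_comp _ mf); apply: continuous_measurable_fun; exact: continuous_cos.
Qed.

Lemma measurable_sin_comp (f : T -> R) : measurable_fun setT f ->
  measurable_fun setT (fun x => sin (f x)).
Proof.
by move=> mf; apply: (measurableT_comp _ mf); apply: continuous_measurable_fun; exact: continuous_sin.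
Qed.

Lemma norm_cos_le1 (x : R) : `|cos x| <= 1.
Proof. by rewrite ler_norml cos_geN1 cos_le1. Qed.

Lemma norm_sin_le1 (x : R) : `|sin x| <= 1.
Proof. by rewrite ler_norml sin_geN1 sin_le1. Qed.

Lemma sin_cosB (x : R) : sin x = cos (x - pi / 2).
Proof. by rewrite cosB sin_pihalf cos_pihalf mulr0 mulr1 add0r. Qed.

Let Event (Q : {set I}) (A : I -> set R) : set T :=
  [set t | forall i, i \in Q -> A i (V i t)].

Let mEvent Q A : (forall i, measurable (A i)) -> measurable (Event Q A).
Proof.
move=> mA; rewrite (_ : Event Q A = \bigcap_(i in [set i | i \in Q]) (V i @^-1` A i))//.
apply: fin_bigcap_measurable => // i _; exact: measurable_preim.
Qed.

Let S (s : seq I) (c : R) x := c + \sum_(i <- s) V i x.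

Let mS s c : measurable_fun setT (S s c).
Proof. by apply: measurable_funD => //; exact: measurable_sum. Qed.

Let icos f : measurable_fun setT f -> P.-integrable setT (EFin \o (fun x => cos (f x))).
Proof.
move=> mf; apply: (@bounded_integrable _ _ _ _ _ 1); first exact: measurable_cos_comp.
by move=> x; exact: norm_cos_le1.
Qed.

(** The invariant of the induction on s. Independence being known on events only, the cosine of a
    partial sum is carried together with an arbitrary event on variables outside s; the phase is
    arbitrary so that sines are included. *)
Let factors s := forall (Q : {set I}) A, (forall i, measurable (A i)) ->
  (forall i, i \in s -> i \notin Q) -> forall c,
  \int[P]_x (cos (S s c x) * \1_(Event Q A) x) =
  \int[P]_x cos (S s c x) * fine (P (Event Q A)).

(** An event of f (V i) is an event of [V i]: merged into the event on [i |: Q] it is covered by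
    [factors s], and [ind] splits it off again as a factor. *)
Let factors_mul s (Q : {set I}) A i (f : R -> R) (M : R) : factors s ->
  (forall j, measurable (A j)) -> (forall j, j \in s -> j \notin Q) ->
  i \notin s -> i \notin Q -> measurable_fun setT f -> (forall x, `|f x| <= M) ->
  forall c, \int[P]_x (cos (S s c x) * \1_(Event Q A) x * f (V i x)) =
    \int[P]_x cos (S s c x) * fine (P (Event Q A)) * \int[P]_x f (V i x).
Proof.
move=> fs mA sQ si Qi mf fM c.
apply: (@Rintegral_factor_bounded _ _ _ _ _ _ _ M) => //.
- by apply: integrableM_indic; [exact: icos|exact: mEvent].
- exact: measurableT_comp.
- move=> B mB.
  have mfB : measurable (f @^-1` B) by exact: measurable_preim.
  pose A' j := if j == i then f @^-1` B else A j.
  have mA' j : measurable (A' j) by rewrite /A'; case: ifP.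
  have E : Event (i |: Q) A' = Event Q A `&` (f \o V i) @^-1` B.
    apply/seteqP; split => [t H|t [H Bt] j].
      split => [j Qj|]; last by have := H i; rewrite !inE eqxx /A' eqxx; exact.
      have := H j; rewrite !inE Qj orbT /A'.
      by case: eqP => [ji|_]; [rewrite ji (negbTE Qi) in Qj|exact].
    by rewrite !inE /A'; case: eqP => [-> _|_ /= Qj]; [exact: Bt|exact: H].
  under eq_Rintegral do rewrite -mulrA indicM -E.
  rewrite fs//; last first.
    move=> j sj; rewrite !inE negb_or sQ// andbT.
    by apply: contraNneq si => <-.
  rewrite -mulrA; congr (_ * _).
  have -> : P (Event (i |: Q) A') = (P ((f \o V i) @^-1` B) * P (Event Q A))%E.
    rewrite /Event (ind _ mA') (ind _ mA) big_setU1//= {1}/A' eqxx; congr (_ * _)%E.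
    apply: eq_bigr => j Qj; rewrite /A'; case: eqP => // ji.
    by rewrite ji (negbTE Qi) in Qj.
  rewrite fineM ?fin_num_prob//; last exact: mEvent.
    by rewrite mulrC.
  by apply: measurable_preim => //; exact: measurableT_comp.
Qed.

Let S_cons i s c x : cos (S (i :: s) c x) =
  cos (S s c x) * cos (V i x) - cos (S s (c - pi / 2) x) * sin (V i x).
Proof.
rewrite (_ : S (i :: s) c x = S s c x + V i x); last by rewrite /S big_cons; ring.
by rewrite cosD (sin_cosB (S s c x)); congr (_ - cos _ * _); rewrite /S; ring.
Qed.

Let imul s c (f : R -> R) i : measurable_fun setT f -> (forall x, `|f x| <= 1) ->
  P.-integrable setT (EFin \o (fun x => cos (S s c x) * f (V i x))).
Proof.
move=> mf f1; apply: (integrableM_bounded _ _ (fun x => f1 (V i x))); first exact: icos.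
exact: measurableT_comp.
Qed.

Let mcos : measurable_fun setT (cos : R -> R).
Proof. by apply: continuous_measurable_fun; exact: continuous_cos. Qed.

Let msin : measurable_fun setT (sin : R -> R).
Proof. by apply: continuous_measurable_fun; exact: continuous_sin. Qed.

Let Event0 A : Event finset.set0 A = setT.
Proof. by apply/seteqP; split => // t _ i; rewrite inE. Qed.

Let cosS_cons i s c : factors s -> i \notin s ->
  \int[P]_x cos (S (i :: s) c x) =
  \int[P]_x cos (S s c x) * \int[P]_x cos (V i x)
  - \int[P]_x cos (S s (c - pi / 2) x) * \int[P]_x sin (V i x).
Proof.
move=> fs si.
have H (f : R -> R) c' : measurable_fun setT f -> (forall x, `|f x| <= 1) ->
    \int[P]_x (cos (S s c' x) * f (V i x)) =
    \int[P]_x cos (S s c' x) * \int[P]_x f (V i x).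
  move=> mf f1.
  have n0 j : j \notin (finset.set0 : {set I}) by rewrite inE.
  have := factors_mul fs (fun=> measurableT : measurable (setT : set R))
    (fun j _ => n0 j) si (n0 i) mf f1 c'.
  rewrite Event0; under eq_Rintegral do rewrite indicT mulr1.
  have -> : P setT = 1%E := probability_setT P.
  by rewrite mulr1.
under eq_Rintegral do rewrite S_cons.
rewrite RintegralB//; do ?[by apply: imul => // x; rewrite ?norm_cos_le1 ?norm_sin_le1].
by rewrite !H// => x; rewrite ?norm_cos_le1 ?norm_sin_le1.
Qed.

(** The addition formula writes the new cosine as two products, to which [factors_mul] applies; with
    the event removed, the same two products recombine by [cosS_cons]. *)
Let factors_uniq s : uniq s -> factors s.
Proof.
elim: s => [_ Q A mA _ c|i s IH /= /andP[si us] Q A mA sQ c].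
  have E x : S [::] c x = c by rewrite /S big_nil addr0.
  under eq_Rintegral do rewrite E.
  rewrite RintegralZl//; last exact/integrable_indic/mEvent.
  under [X in _ = X * _]eq_Rintegral do rewrite E.
  by rewrite Rintegral_indic ?Rintegral_cstP//; exact: mEvent.
have {}IH := IH us.
rewrite cosS_cons//.
have sQ' j : j \in s -> j \notin Q by move=> sj; apply: sQ; rewrite inE sj orbT.
have Qi : i \notin Q by apply: sQ; rewrite mem_head.
under eq_Rintegral do rewrite S_cons mulrBl mulrAC [X in _ - X]mulrAC.
have i1 c' (f : R -> R) : measurable_fun setT f -> (forall x, `|f x| <= 1) ->
    P.-integrable setT (EFin \o (fun x => cos (S s c' x) * \1_(Event Q A) x * f (V i x))).
  move=> mf f1; under eq_fun do rewrite mulrAC.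
  by apply: integrableM_indic; [exact: imul|exact: mEvent].
rewrite RintegralB//; do ?[by apply: i1 => // x; rewrite ?norm_cos_le1 ?norm_sin_le1].
rewrite (factors_mul IH mA sQ' si Qi mcos norm_cos_le1).
rewrite (factors_mul IH mA sQ' si Qi msin norm_sin_le1).
by ring.
Qed.

(** The real form of the multiplicativity of characteristic functions. The shifted phase stands for
    the sine of the partial sum, so the recursion stays inside one family. *)
Lemma indep_cos_sum_cons i s c : uniq (i :: s) ->
  \int[P]_x cos (c + \sum_(j <- i :: s) V j x) =
  \int[P]_x cos (c + \sum_(j <- s) V j x) * \int[P]_x cos (V i x)
  - \int[P]_x cos (c - pi / 2 + \sum_(j <- s) V j x) * \int[P]_x sin (V i x).
Proof. by move=> /= /andP[si us]; exact: (cosS_cons _ (factors_uniq us) si). Qed.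

End cosines.
End independence.

(** * Error recursion and Taylor bounds *)

Section cosine_recursion.
Variable R : realType.
Implicit Types a b l e x c : R.

(** F and G stand for the means of the cosine of a partial sum at the phases c and c - pi / 2, a and
    b for the mean cosine and sine of the next summand, l for the target of a. The old error is
    multiplied by l <= 1 and the new summand adds at most e. *)
Lemma cos_recursion_step a b l e n (F G c : R) : 0 <= l <= 1 ->
  `|F| <= 1 -> `|G| <= 1 -> `|F - l ^+ n * cos c| <= n%:R * e -> `|a - l| + `|b| <= e ->
  `|F * a - G * b - l ^+ n.+1 * cos c| <= n.+1%:R * e.
Proof.
move=> /andP[l0 l1] F1 G1 Fe abe.
rewrite (_ : _ - _ = l * (F - l ^+ n * cos c) + (F * (a - l) - G * b)); last first.
  by rewrite exprS; ring.
rewrite -natr1 mulrDl mul1r (le_trans (ler_normD _ _))// lerD//.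
  rewrite normrM (ger0_norm l0) (le_trans _ Fe)// -[leRHS]mul1r ler_wpM2r//.
rewrite (le_trans (ler_normB _ _))// (le_trans _ abe)// !normrM lerD//.
  by rewrite -[leRHS]mul1r ler_wpM2r.
by rewrite -[leRHS]mul1r ler_wpM2r.
Qed.

(** By the mean value theorem. It serves four times in a row: the derivative of each of the next
    four inequalities is the previous one, starting from cos <= 1. *)
Lemma derive_ge0_ge0 (f f' : R -> R) : (forall x, is_derive x (1 : R) f (f' x)) ->
  0 <= f 0 -> (forall x, 0 <= x -> 0 <= f' x) -> forall x, 0 <= x -> 0 <= f x.
Proof.
move=> df f0 f'0 x; rewrite le_eqVlt => /predU1P[<-//|x0].
have cf : {within `[0, x], continuous f}.
  by apply: continuous_subspaceT => y; apply/differentiable_continuous/derivable1_diffP.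
have [c + E] := MVT x0 (fun y _ => df y) cf.
rewrite in_itv/= => /andP[c0 _].
rewrite -(subrK (f 0) (f x)) E addr_ge0// mulr_ge0//; last by rewrite subr0 ltW.
by rewrite f'0// ltW.
Qed.

Lemma sin_le x : 0 <= x -> sin x <= x.
Proof.
move=> x0; rewrite -subr_ge0.
apply: (@derive_ge0_ge0 (fun x => x - sin x) (fun x => 1 - cos x)) => //.
  by rewrite sin0 subr0.
Qed.

Lemma cos_ge x : 0 <= x -> 1 - x ^+ 2 / 2 <= cos x.
Proof.
move=> x0; rewrite -subr_ge0.
apply: (@derive_ge0_ge0 (fun x => cos x - (1 - x ^+ 2 / 2)) (fun x => x - sin x)) => //.
- move=> y; apply: is_derive_eq.
  by rewrite /GRing.scale/=; field.
- by rewrite cos0; lra.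
- by move=> y y0; rewrite subr_ge0 sin_le.
Qed.

Lemma sin_ge x : 0 <= x -> x - x ^+ 3 / 6 <= sin x.
Proof.
move=> x0; rewrite -subr_ge0.
apply: (@derive_ge0_ge0 (fun x => sin x - (x - x ^+ 3 / 6))
  (fun x => cos x - (1 - x ^+ 2 / 2))) => //.
- move=> y; apply: is_derive_eq.
  by rewrite /GRing.scale/=; field.
- by rewrite sin0; lra.
- by move=> y y0; rewrite subr_ge0 cos_ge.
Qed.

Lemma cos_le x : 0 <= x -> cos x <= 1 - x ^+ 2 / 2 + x ^+ 4 / 24.
Proof.
move=> x0; rewrite -subr_ge0.
apply: (@derive_ge0_ge0 (fun x => 1 - x ^+ 2 / 2 + x ^+ 4 / 24 - cos x)
  (fun x => sin x - (x - x ^+ 3 / 6))) => //.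
- move=> y; apply: is_derive_eq.
  by rewrite /GRing.scale/=; field.
- by rewrite cos0; lra.
- by move=> y y0; rewrite subr_ge0 sin_ge.
Qed.

Lemma norm_sinB_le x : `|sin x - x| <= `|x| ^+ 3 / 6.
Proof.
wlog x0 : x / 0 <= x.
  move=> H; have [x0|/ltW x0] := leP 0 x; first exact: H.
  by have := H (- x); rewrite oppr_ge0 sinN -opprD !normrN; exact.
rewrite (ger0_norm x0) ler_norml.
by have := sin_ge x0; have := sin_le x0; have := exprn_ge0 3 x0; lra.
Qed.

Lemma norm_cosB_le x : `|cos x - (1 - x ^+ 2 / 2)| <= x ^+ 4 / 24.
Proof.
wlog x0 : x / 0 <= x.
  move=> H; have [x0|/ltW x0] := leP 0 x; first exact: H.
  have := H (- x); rewrite oppr_ge0 cosN sqrrN.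
  by rewrite (_ : (- x) ^+ 4 = x ^+ 4); [exact|ring].
rewrite ler_norml.
by have := cos_ge x0; have := cos_le x0; have := exprn_ge0 4 x0; lra.
Qed.

(** For x >= 0, [expR (- x)] lies between 1 - x and 1 / (1 + x), and the latter is at most 1 - x +
    x^2. *)
Lemma norm_expRB_le x : 0 <= x -> `|expR (- x) - (1 - x)| <= x ^+ 2.
Proof.
move=> x0.
have e1 : 1 - x <= expR (- x) by have := expR_ge1Dx (- x).
have e2 : expR (- x) <= (1 + x)^-1.
  by rewrite expRN lef_pV2 ?posrE ?expR_gt0 ?expR_ge1Dx//; lra.
have e3 : (1 + x)^-1 <= 1 - x + x ^+ 2.
  rewrite -[leLHS]mul1r ler_pdivrMr; last by lra.
  by have := exprn_ge0 3 x0; rewrite -subr_ge0; nra.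
by rewrite ler_norml; have := sqr_ge0 x; lra.
Qed.

End cosine_recursion.

(** * The characteristic function of N(0,1) *)

Section normal_characteristic_function.
Variable R : realType.
Notation mu := (@lebesgue_measure R).
Notation phi := (normal_pdf (0 : R) 1).

Let phiE x : phi x = normal_peak 1 * expR (- x ^+ 2 / 2).
Proof. by rewrite normal_pdfE ?oner_neq0//= /normal_fun subr0 expr1n. Qed.

Let phi_derive x : is_derive x (1 : R) phi (- x * phi x).
Proof.
rewrite (_ : normal_pdf _ _ = fun x => normal_peak 1 * expR (- x ^+ 2 / 2)); last first.
  by apply/funext => z; exact: phiE.
apply: is_derive_eq.
by rewrite /GRing.scale/=; field.
Qed.

(** An integrable majorant of |x| times the density. The quotient of the exponentials for standard
    deviations 1 and 2 is exp (- 3 x^2 / 8), at most 1 / (1 + 3 x^2 / 8), and |x| <= 4 (1 + 3 x^2 /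
    8). *)
Let id_phi_le x : `|x| * phi x <= 4 * (normal_peak 1 / normal_peak 2) * normal_pdf 0 2 x.
Proof.
rewrite phiE normal_pdfE//=.
have p2 : 0 < normal_peak 2 :> R by rewrite normal_peak_gt0.
rewrite [leRHS]mulrA -(mulrA 4) divfK ?gt_eqF//.
rewrite mulrCA -mulrA [leRHS]mulrCA ler_wpM2l ?normal_peak_ge0//.
rewrite /normal_fun subr0.
rewrite (_ : - x ^+ 2 / 2 = - (3 / 8 * x ^+ 2) + - x ^+ 2 / (2 ^+ 2 *+ 2)); last first.
  by rewrite -mulr_natr; field.
rewrite expRD mulrA ler_wpM2r ?expR_ge0// expRN ler_pdivrMr ?expR_gt0//.
have := expR_ge1Dx (3 / 8 * x ^+ 2).
rewrite -(real_normK (num_real x)); have := normr_ge0 x.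
by nra.
Qed.

Let iphi : mu.-integrable setT (EFin \o phi).
Proof. exact: integrable_normal_pdf. Qed.

Let mphi : measurable_fun setT phi.
Proof. exact: measurable_normal_pdf. Qed.

Let i_id_phi : mu.-integrable setT (EFin \o (fun x => `|x| * phi x)).
Proof.
have i2 : mu.-integrable setT
    (EFin \o (fun x => 4 * (normal_peak 1 / normal_peak 2) * normal_pdf 0 2 x)).
  by apply: integrableZR; exact: integrable_normal_pdf.
apply: (le_integrableR _ _ i2).
  by apply: measurable_funM => //; exact: measurable_normr.
by move=> x; rewrite ger0_norm ?mulr_ge0 ?normal_pdf_ge0//; exact: id_phi_le.
Qed.

Variable c : R.

Let arg (t x : R) := t * x + c.

Let marg t : measurable_fun setT (arg t).
Proof. by apply: measurable_funD => //; exact: measurable_funM. Qed.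

Let F (t : R) := \int[mu]_x (cos (arg t x) * phi x).

Let icosphi t : mu.-integrable setT (EFin \o (fun x => cos (arg t x) * phi x)).
Proof.
under eq_fun do rewrite mulrC.
apply: (integrableM_bounded iphi) => [|x]; last exact: norm_cos_le1.
exact: (measurable_cos_comp (marg t)).
Qed.

Let isinphi t : mu.-integrable setT (EFin \o (fun x => x * sin (arg t x) * phi x)).
Proof.
apply: (le_integrableR _ _ i_id_phi).
  apply: measurable_funM => //; apply: measurable_funM => //.
  exact: (measurable_sin_comp (marg t)).
move=> x; rewrite normrM (ger0_norm (normal_pdf_ge0 _ _ _)) ler_wpM2r ?normal_pdf_ge0//.
by rewrite normrM -[leRHS]mulr1 ler_wpM2l// norm_sin_le1.
Qed.

(** The derivative in x of sin (t x + c) times the density. That its integral over the line vanishes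
    is the integration by parts behind the differential equation for [F]. *)
Let g t x := t * (cos (arg t x) * phi x) - x * sin (arg t x) * phi x.

Let ig t : mu.-integrable setT (EFin \o g t).
Proof. by apply: integrableBR => //; exact: integrableZR. Qed.

Let g_derive t x : is_derive x (1 : R) (fun y => sin (arg t y) * phi y) (g t x).
Proof.
rewrite /arg; have dphi := phi_derive x.
have ds : is_derive x (1 : R) (fun y => sin (t * y + c)) (cos (t * x + c) * t).
  by apply: is_derive_eq; rewrite /GRing.scale/=; ring.
by apply: is_derive_eq; rewrite /GRing.scale/= /g /arg; ring.
Qed.

Let continuous_g t : continuous (g t).
Proof.
have carg : continuous (arg t).
  by move=> x; apply: cvgD; [apply: cvgM; [exact: cvg_cst|exact: cvg_id]|exact: cvg_cst].
have cphi : continuous phi by apply: continuous_normal_pdf; exact: oner_neq0.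
move=> x; apply: cvgB; apply: cvgM; do ?[exact: cvg_cst|exact: cphi].
  apply: cvgM; last exact: cphi.
  by apply: (cvg_comp _ _ (carg x)); exact: continuous_cos.
apply: cvgM; first exact: cvg_id.
by apply: (cvg_comp _ _ (carg x)); exact: continuous_sin.
Qed.

Let Rintegral_g_itv t (n : nat) :
  \int[mu]_(x in `[- n.+1%:R, n.+1%:R]) g t x =
  sin (arg t n.+1%:R) * phi n.+1%:R - sin (arg t (- n.+1%:R)) * phi (- n.+1%:R).
Proof.
rewrite /Rintegral (@continuous_FTC2 _ _ (fun y => sin (arg t y) * phi y))//.
- by rewrite gtrN.
- exact: continuous_subspaceT (@continuous_g t).
- have ct x : continuous_at x (fun y => sin (arg t y) * phi y).
    by apply/differentiable_continuous/derivable1_diffP; have [] := g_derive t x.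
  split.
  - by move=> x _; have [] := g_derive t x.
  - by apply: cvg_at_right_filter; exact: ct.
  - by apply: cvg_at_left_filter; exact: ct.
- by move=> x _; rewrite derive1E; have dg := g_derive t x; rewrite derive_val.
Qed.

(** The sign s covers both ends of the interval; [id_phi_le] and the boundedness of the density give
    a bound of order 1 / n. *)
Let cvg_phi (s : R) : `|s| = 1 -> phi (s * n.+1%:R) @[n --> \oo] --> 0.
Proof.
move=> s1.
pose C : R := 4 * (normal_peak 1 / normal_peak 2) * normal_peak 2.
have C0 : 0 <= C by rewrite !mulr_ge0 ?normal_peak_ge0// invr_ge0 normal_peak_ge0.
have H n : 0 <= phi (s * n.+1%:R) <= C * n.+1%:R^-1.
  rewrite normal_pdf_ge0/= ler_pdivlMr// mulrC.
  have := id_phi_le (s * n.+1%:R); rewrite normrM s1 mul1r normr_nat => h.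
  apply: (le_trans h); rewrite ler_wpM2l ?normal_pdf_ub//.
  by rewrite !mulr_ge0 ?normal_peak_ge0// invr_ge0 normal_peak_ge0.
apply: (@squeeze_cvgr _ _ _ _ (fun=> 0) (fun n => C * n.+1%:R^-1)).
- by apply: nearW.
- exact: cvg_cst.
- rewrite -[X in _ --> X](mulr0 C); apply: cvgM; first exact: cvg_cst.
  exact: cvg_harmonic.
Qed.

Let Rintegral_g t : \int[mu]_x g t x = 0.
Proof.
have c1 : \int[mu]_(x in `[- n.+1%:R, n.+1%:R]) g t x @[n --> \oo] --> \int[mu]_x g t x.
  under eq_cvg do rewrite Rintegral_mkcond.
  apply: (Rintegral_dominated_cvg _ (integrable_norm (ig t))).
  - move=> n; apply/(measurable_restrictT (g t)); first exact: measurable_itv.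
    by apply: measurable_funTS; exact: integrable_measurable (ig t).
  - move=> x; apply: cvg_near_cst; near=> n.
    rewrite patchE mem_set//= in_itv/= -ler_norml.
    apply: (@le_trans _ _ n%:R); last by rewrite ler_nat.
    by near: n; exact: nbhs_infty_ger.
  - move=> n x; rewrite patchE/=; case: ifP => _ //; rewrite normr0; exact: normr_ge0.
have c2 : \int[mu]_(x in `[- n.+1%:R, n.+1%:R]) g t x @[n --> \oo] --> (0 : R).
  rewrite (_ : (fun n => _) = (fun n : nat =>
    sin (arg t (1 * n.+1%:R)) * phi (1 * n.+1%:R)
    - sin (arg t (- 1 * n.+1%:R)) * phi (- 1 * n.+1%:R))); last first.
    by apply/funext => n; rewrite Rintegral_g_itv !mul1r !mulN1r.
  have H (s : R) : `|s| = 1 ->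
      sin (arg t (s * n.+1%:R)) * phi (s * n.+1%:R) @[n --> \oo] --> (0 : R).
    move=> s1; apply/norm_cvg0P.
    apply: (@squeeze_cvgr _ _ _ _ (fun=> 0) (fun n => phi (s * n.+1%:R))).
    - apply: nearW => n; rewrite normr_ge0/= normrM (ger0_norm (normal_pdf_ge0 _ _ _)).
      by rewrite -[leRHS]mul1r ler_wpM2r ?normal_pdf_ge0// norm_sin_le1.
    - exact: cvg_cst.
    - exact: cvg_phi.
  rewrite -[X in _ --> X](subr0 0); apply: cvgB.
    exact: H (normr1 _).
  exact: H (normrN1 _).
exact: cvg_unique c1 c2.
Unshelve. all: by end_near. Qed.

(** Differentiation under the integral, dominated by |x| times the density, gives minus the integral
    of x sin (t x + c) against the density, which is - t F by [Rintegral_g]. *)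
Let F_derive t : is_derive t (1 : R) F (- t * F t).
Proof.
pose f (u x : R) := cos (arg u x) * phi x.
have df u x : is_derive u (1 : R) (f ^~ x) (- (x * sin (arg u x) * phi x)).
  by rewrite /f /arg; apply: is_derive_eq; rewrite /GRing.scale/= /arg; ring.
have d1 u x : partial1of2 f u x = - (x * sin (arg u x) * phi x).
  by rewrite partial1of2E; have := df u x => dfu; rewrite derive_val.
have tI : `]t - 1, t + 1[%classic t by rewrite /= in_itv/=; apply/andP; split; lra.
have H1 : forall u, `]t - 1, t + 1[%classic u -> mu.-integrable setT (EFin \o f u).
  by move=> u _; exact: icosphi.
have H2 : forall u x, `]t - 1, t + 1[%classic u -> setT x -> derivable (f ^~ x) u 1.
  by move=> u x _ _; have [] := df u x.
have H3 : forall x, 0 <= `|x| * phi x by move=> x; rewrite mulr_ge0// normal_pdf_ge0.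
have H4 : forall u x, `]t - 1, t + 1[%classic u -> setT x ->
    `|partial1of2 f u x| <= `|x| * phi x.
  move=> u x _ _; rewrite d1 normrN normrM (ger0_norm (normal_pdf_ge0 _ _ _)).
  rewrite ler_wpM2r ?normal_pdf_ge0//.
  by rewrite normrM -[leRHS]mulr1 ler_wpM2l// norm_sin_le1.
apply: DeriveDef.
  exact: (derivable_under_integral measurableT tI H1 H2 H3 i_id_phi H4).
rewrite -derive1E (differentiation_under_integral measurableT tI H1 H2 H3 i_id_phi H4).
under eq_Rintegral do rewrite d1.
have := Rintegral_g t; rewrite RintegralB//; last exact: integrableZR.
rewrite RintegralZl// => /eqP; rewrite subr_eq0 => /eqP E.
rewrite mulNr -[F t]/(\int[mu]_x (cos (arg t x) * phi x)) E -mulN1r -RintegralZl//.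
by apply: eq_Rintegral => x _; rewrite mulN1r.
Qed.

(** F solves F' = - t F with F 0 = cos c, so exp (t^2 / 2) F is constant. *)
Lemma normal_cos_Rintegral t : \int[mu]_x (cos (t * x + c) * phi x) = expR (- t ^+ 2 / 2) * cos c.
Proof.
pose K (u : R) := expR (u ^+ 2 / 2) * F u.
have dK u : is_derive u (1 : R) K 0.
  by have dF := F_derive u; apply: is_derive_eq; rewrite /GRing.scale/=; field.
have F0 : F 0 = cos c.
  rewrite /F /arg; under eq_Rintegral do rewrite mul0r add0r.
  rewrite RintegralZl// -[RHS]mulr1; congr (_ * _).
  by rewrite /Rintegral integral_normal_pdf.
have : K t = K 0 by exact: is_derive_0_is_cst.
rewrite {2}/K F0 expr0n/= mul0r expR0 mul1r => <-.
by rewrite /K mulrA -expRD mulNr addNr expR0 mul1r.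
Qed.

End normal_characteristic_function.

(** * Gaussian vectors *)

Definition dot (R : realType) d (x y : 'cV[R]_d) : R := \sum_i x i 0 * y i 0.

Section borel_vectors.
Variables (R : realType).

Lemma measurable_borelV_continuous d (f : 'cV[R]_d -> R) : continuous f ->
  measurable_fun setT (f : borelV R d -> R).
Proof.
move=> /continuousP cf; apply: (measurability _ (RGenOpens.measurableE R)).
move=> _ [_ [a [b ->] <-]]; rewrite setTI; apply: sub_sigma_algebra.
exact/cf/interval_open.
Qed.

Lemma measurable_coord d (i : 'I_d) :
  measurable_fun setT ((fun x : 'cV[R]_d => x i 0) : borelV R d -> R).
Proof. by apply: measurable_borelV_continuous; exact: coord_continuous. Qed.

Lemma measurable_dot d (th : 'cV[R]_d) :
  measurable_fun setT ((fun x : 'cV[R]_d => dot th x) : borelV R d -> R).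
Proof.
apply: measurable_sum => i; apply: measurable_funM; first exact: measurable_cst.
exact: measurable_coord.
Qed.

End borel_vectors.

Section gaussian_vectors.
Variables (R : realType).

Lemma dotC d (x y : 'cV[R]_d) : dot x y = dot y x.
Proof. by apply: eq_bigr => i _; rewrite mulrC. Qed.

Lemma dot_trmx d k (A : 'M[R]_(d, k)) (x : 'cV[R]_d) (y : 'cV[R]_k) :
  dot x (A *m y) = dot (A^T *m x) y.
Proof.
rewrite /dot; under eq_bigr do rewrite mxE mulr_sumr.
rewrite exchange_big; apply: eq_bigr => j _; rewrite mxE mulr_suml.
by apply: eq_bigr => i _; rewrite mxE mulrA (mulrC (x i 0)).
Qed.

Variables (k : nat) (nu : probability (borelV R k) R).
Hypothesis hnu : standard_normal nu.

Let coord_prob (J : {set 'I_k}) (B : 'I_k -> set R) :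
  (forall i, measurable (B i)) ->
  nu [set x : 'cV[R]_k | forall i, i \in J -> B i (x i 0)] =
  (\prod_(i in J) normal_prob (0 : R) 1 (B i))%E.
Proof.
move=> mB; pose B' i := if i \in J then B i else setT.
have := @hnu B' _; rewrite (_ : [set x | _] = [set x : 'cV[R]_k | forall i, i \in J -> B i (x i 0)]).
  move=> ->; last by move=> i; rewrite /B'; case: ifP.
  rewrite [RHS]big_mkcond/=; apply: eq_bigr => i _; rewrite /B'; case: ifP => // _.
  exact: probability_setT.
apply/seteqP; split => x H i.
  by move=> iJ; have := H i; rewrite /B' iJ.
by rewrite /B'; case: ifP => // iJ; exact: H.
Qed.

Let coord1 (i : 'I_k) (B : set R) : measurable B ->
  nu [set x : 'cV[R]_k | B (x i 0)] = normal_prob (0 : R) 1 B.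
Proof.
move=> mB; have := @coord_prob [set i]%SET (fun=> B) (fun=> mB).
rewrite big_set1 => <-; congr (nu _); apply/seteqP; split => x /= H.
  by move=> j; rewrite inE => /eqP ->.
by apply: H; rewrite inE.
Qed.

(** With the normal density as G, [Rintegral_transfer_bounded] turns the Lebesgue integral against
    the density into an integral over [nu], since the two agree on events of one coordinate. *)
Let cos1 (i : 'I_k) a c :
  \int[nu]_x cos (a * (x : 'cV[R]_k) i 0 + c) = expR (- a ^+ 2 / 2) * cos c.
Proof.
rewrite -normal_cos_Rintegral -[LHS]mul1r.
under [in RHS]eq_Rintegral do rewrite mulrC.
have mV : measurable_fun setT (fun y : R => cos (a * y + c)).
  by apply: measurable_cos_comp; apply: measurable_funD => //; exact: measurable_funM.
have mW : measurable_fun setT ((fun x : 'cV[R]_k => cos (a * x i 0 + c)) : borelV R k -> R).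
  exact: (measurableT_comp mV (measurable_coord i)).
apply: esym; apply: (Rintegral_transfer_bounded (M := 1) (integrable_normal_pdf 0 1) mV mW).
- by move=> x; exact: norm_cos_le1.
- by move=> x; exact: norm_cos_le1.
- move=> B mB; rewrite mul1r.
  rewrite (@coord1 i ((fun y => cos (a * y + c)) @^-1` B)); last exact: measurable_preim.
  rewrite /normal_prob /Rintegral; congr fine; rewrite [RHS]integral_mkcond.
  apply: eq_integral => y _; rewrite patchE indicE.
  by case: ifP => _; rewrite ?mulr1 ?mulr0.
Qed.

(** The coordinates are independent under [nu], so the cosine recursion applies to the terms of the
    dot product. *)
Lemma standard_normal_cos (a : 'cV[R]_k) c :
  \int[nu]_x cos (c + dot a x) = expR (- dot a a / 2) * cos c.
Proof.
pose V (i : 'I_k) (x : borelV R k) := a i 0 * (x : 'cV[R]_k) i 0.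
have mV i : measurable_fun setT (V i).
  by apply: measurable_funM; [exact: measurable_cst|exact: measurable_coord].
have mB' i (B : set R) : measurable B -> measurable [set y | B (a i 0 * y)].
  move=> mB; apply: (@measurable_preim _ _ _ _ (fun y : R => a i 0 * y)) => //.
  exact: measurable_funM.
have ind : mutually_independent nu V.
  move=> J B mB.
  rewrite (@coord_prob J (fun i => [set y | B i (a i 0 * y)]))//; last by move=> i; exact: mB'.
  by apply: eq_bigr => i _; rewrite -(@coord1 i)//; exact: mB'.
rewrite /dot; move: c.
suff H s : uniq s -> forall c, \int[nu]_x cos (c + \sum_(i <- s) V i x) =
    expR (- (\sum_(i <- s) a i 0 * a i 0) / 2) * cos c.
  by move=> c; exact: (H _ (index_enum_uniq _)).
elim: s => [_ c|i s IH /[dup] us /= /andP[_ us'] c].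
  under eq_Rintegral do rewrite big_nil addr0.
  by rewrite Rintegral_cstP big_nil oppr0 mul0r expR0 mul1r.
rewrite indep_cos_sum_cons// !IH//.
have E0 : \int[nu]_x cos (V i x) = expR (- a i 0 ^+ 2 / 2).
  have := cos1 i (a i 0) 0; under eq_Rintegral do rewrite addr0.
  by rewrite cos0 mulr1.
(* The phase - pi / 2 turns the cosine into a sine, and the value carries the factor cos (pi / 2) =
   0. *)
have E1 : \int[nu]_x sin (V i x) = 0.
  have := cos1 i (a i 0) (- (pi / 2)); rewrite cosN cos_pihalf mulr0 => <-.
  by apply: eq_Rintegral => x _; rewrite sin_cosB.
rewrite E0 E1 mulr0 subr0 mulrAC -expRD big_cons; congr (expR _ * _).
by rewrite expr2; ring.
Qed.

End gaussian_vectors.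

(** The law is the image of [nu] under L, and th.(L x) = (L^T th).x; the transfer lemma with G = 1
    performs the change of variables. *)
Lemma centered_normal_cos (R : realType) d (Omega : 'M[R]_d) (mu : probability (borelV R d) R)
    (th : 'cV[R]_d) c : centered_normal Omega mu ->
  \int[mu]_x cos (c + dot th x) = expR (- dot th (Omega *m th) / 2) * cos c.
Proof.
move=> [k [L [nu [hnu LL muE]]]].
have mcos n (t : 'cV[R]_n) : measurable_fun setT
    ((fun x : 'cV[R]_n => cos (c + dot t x)) : borelV R n -> R).
  by apply: measurable_cos_comp; apply: measurable_funD => //; exact: measurable_dot.
have -> : dot th (Omega *m th) = dot (L^T *m th) (L^T *m th).
  by rewrite -LL -mulmxA dot_trmx.
rewrite -(standard_normal_cos hnu) -[LHS]mul1r.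
rewrite -[RHS](_ : \int[nu]_x (1 * cos (c + dot (L^T *m th) x)) = _); last first.
  by apply: eq_Rintegral => x _; rewrite mul1r.
apply: esym; apply: (Rintegral_transfer_bounded (M := 1) (integrable_cstR nu 1) (mcos _ _) (mcos _ _)).
- by move=> x; exact: norm_cos_le1.
- by move=> x; exact: norm_cos_le1.
- move=> B mB; rewrite mul1r muE; last exact: measurable_preim.
  under eq_Rintegral do rewrite mul1r.
  rewrite Rintegral_indic; last exact: measurable_preim.
  by congr (fine (nu _)); apply/seteqP; split => x /=; rewrite dot_trmx.
Qed.

(** * Multinomial averages *)

Section multinomial_average.
Variables (R : realType) (I : finType).
Implicit Types (p : I -> R) (k : {ffun I -> nat}) (G : {ffun I -> nat} -> R) (N : nat).

Definition incr k (i : I) : {ffun I -> nat} := [ffun j => (k j + (j == i))%N].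

(* The mean of G(k) when k counts the outcomes of N independent draws from p. *)
Fixpoint multinomial_mean p N G : R :=
  if N is N'.+1 then \sum_i p i * multinomial_mean p N' (fun k => G (incr k i))
  else G [ffun=> 0%N].

Local Notation total k := (\sum_i k i)%N.

Lemma total_incr k i : total (incr k i) = (total k).+1.
Proof.
under eq_bigr do rewrite ffunE; rewrite big_split/= [X in (_ + X)%N](bigD1 i)//= eqxx.
by rewrite [X in (_ + (_ + X))%N]big1 ?addn1// => j /negbTE ->.
Qed.

Lemma total0 : total ([ffun=> 0%N] : {ffun I -> nat}) = 0%N.
Proof. by rewrite big1// => i _; rewrite ffunE. Qed.

Variable p : I -> R.
Local Notation mean := (multinomial_mean p).

(** The recursion only reaches counts of total N, so identities that need the weights to sum to N
    may be used under the mean. *)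
Lemma eq_multinomial_mean N G G' : (forall k, total k = N -> G k = G' k) ->
  mean N G = mean N G'.
Proof.
elim: N G G' => [|N IH] G G' GG' /=; first by apply: GG'; exact: total0.
apply: eq_bigr => i _; congr (_ * _); apply: IH => k kN; apply: GG'.
by rewrite total_incr kN.
Qed.

Lemma multinomial_meanD N G G' : mean N (fun k => G k + G' k) = mean N G + mean N G'.
Proof.
elim: N G G' => [|N IH] G G' //=.
by rewrite -big_split; apply: eq_bigr => i _; rewrite /= IH mulrDr.
Qed.

Lemma multinomial_meanZ N (a : R) G : mean N (fun k => a * G k) = a * mean N G.
Proof.
elim: N G => [|N IH] G //=.
by rewrite mulr_sumr; apply: eq_bigr => i _; rewrite /= IH mulrCA.
Qed.

Lemma multinomial_meanB N G G' : mean N (fun k => G k - G' k) = mean N G - mean N G'.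
Proof.
rewrite -mulN1r -multinomial_meanZ -multinomial_meanD.
by apply: eq_multinomial_mean => k _; rewrite mulN1r.
Qed.

Lemma multinomial_mean_sum N (J : Type) (r : seq J) (G : J -> {ffun I -> nat} -> R) :
  mean N (fun k => \sum_(j <- r) G j k) = \sum_(j <- r) mean N (G j).
Proof.
elim: r => [|j r IH].
  rewrite big_nil -[RHS](mul0r (mean N (fun=> 0))) -multinomial_meanZ.
  by apply: eq_multinomial_mean => k _; rewrite big_nil mul0r.
rewrite big_cons -IH -multinomial_meanD.
by apply: eq_multinomial_mean => k _; rewrite big_cons.
Qed.

(** A count of total N has entries at most N, so a finite type of functions lists all the k that
    matter. *)
Lemma multinomial_mean_indic N G : mean N G =
  \sum_(k : {ffun I -> 'I_N.+1}) G [ffun i => k i : nat] *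
     mean N (fun k' => (k' == [ffun i => k i : nat])%:R).
Proof.
under eq_bigr do rewrite -multinomial_meanZ.
rewrite -multinomial_mean_sum; apply: eq_multinomial_mean => k kN.
have kb i : (k i < N.+1)%N by rewrite ltnS -kN (bigD1 i)//= leq_addr.
rewrite (bigD1 [ffun i => Ordinal (kb i)])//= big1 => [|k' kk'].
  rewrite addr0 (_ : [ffun i => _] = k) ?eqxx ?mulr1//.
  by apply/ffunP => i; rewrite !ffunE.
case: eqP => [E|_]; last by rewrite mulr0.
case/eqP: kk'; apply/ffunP => i; apply/val_inj; rewrite ffunE/=.
by rewrite E ffunE.
Qed.

Hypothesis p1 : \sum_i p i = 1.

Lemma multinomial_mean_cst N (a : R) : mean N (fun=> a) = a.
Proof. by elim: N => [|N IH] //=; rewrite IH -mulr_suml p1 mul1r. Qed.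

Hypothesis p0 : forall i, 0 <= p i.

Lemma le_multinomial_mean N G G' : (forall k, total k = N -> G k <= G' k) ->
  mean N G <= mean N G'.
Proof.
elim: N G G' => [|N IH] G G' GG' /=; first by apply: GG'; exact: total0.
apply: ler_sum => i _; apply: ler_wpM2l => //; apply: IH => k kN; apply: GG'.
by rewrite total_incr kN.
Qed.

Lemma norm_multinomial_mean_le N G (M : R) : (forall k, total k = N -> `|G k| <= M) ->
  `|mean N G| <= M.
Proof.
move=> GM; rewrite ler_norml -(multinomial_mean_cst N M) -mulN1r -multinomial_meanZ.
apply/andP; split; apply: le_multinomial_mean => k /GM; rewrite ?mulN1r ler_norml.
  by case/andP.
by case/andP.
Qed.

Lemma multinomial_mean_dist N G (a : R) :
  `|mean N G - a| <= mean N (fun k => `|G k - a|).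
Proof.
rewrite -[X in _ - X](multinomial_mean_cst N) -multinomial_meanB ler_norml.
rewrite -mulN1r -multinomial_meanZ; apply/andP; split.
  by apply: le_multinomial_mean => k _; rewrite mulN1r lerNl -normrN ler_norm.
by apply: le_multinomial_mean => k _; exact: ler_norm.
Qed.

(** When k counts N draws, this is the sum of [a] over the draws. *)
Definition lincount (a : I -> R) k : R := \sum_i (k i)%:R * a i.

Lemma lincount_incr a k i : lincount a (incr k i) = lincount a k + a i.
Proof.
rewrite /lincount; under eq_bigr do rewrite ffunE natrD mulrDl.
rewrite big_split/=; rewrite [X in _ + X](bigD1 i)//= eqxx mul1r [X in _ + (_ + X)]big1 ?addr0//.
by move=> j /negbTE ->; rewrite mul0r.
Qed.

Lemma lincount0 a : lincount a [ffun=> 0%N] = 0.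
Proof. by rewrite /lincount big1// => i _; rewrite ffunE mul0r. Qed.

Lemma multinomial_mean_sqr N (a : I -> R) : \sum_i p i * a i = 0 ->
  mean N (fun k => lincount a k ^+ 2) = N%:R * \sum_i p i * a i ^+ 2.
Proof.
move=> pa.
(* The constant c absorbs one draw, whose outcome i replaces c by c + a i. *)
suff H c : mean N (fun k => (c + lincount a k) ^+ 2) = c ^+ 2 + N%:R * \sum_i p i * a i ^+ 2.
  have := H 0; rewrite expr0n/= add0r => <-.
  by apply: eq_multinomial_mean => k _; rewrite add0r.
elim: N c => [|N IH] c /=; first by rewrite lincount0 mul0r !addr0.
under eq_bigr => i _.
  rewrite (@eq_multinomial_mean _ _ (fun k => (c + a i + lincount a k) ^+ 2)); last first.
    by move=> k _; rewrite lincount_incr; congr (_ ^+ 2); ring.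
  rewrite IH (_ : _ * _ = p i * (c ^+ 2 + N%:R * \sum_i p i * a i ^+ 2) +
    (2 * c * (p i * a i) + p i * a i ^+ 2)); last by ring.
  over.
rewrite 2!big_split/= -mulr_suml p1 -mulr_sumr pa -natr1.
by ring.
Qed.

Lemma multinomial_mean_cos N (x : I -> R) c :
  mean N.+1 (fun k => cos (c + lincount x k)) =
  mean N (fun k => cos (c + lincount x k)) * \sum_i p i * cos (x i)
  - mean N (fun k => cos (c - pi / 2 + lincount x k)) * \sum_i p i * sin (x i).
Proof.
rewrite /= !mulr_sumr -sumrB; apply: eq_bigr => i _.
rewrite (@eq_multinomial_mean _ _ (fun k => cos (x i) * cos (c + lincount x k)
   - sin (x i) * cos (c - pi / 2 + lincount x k))); last first.
  move=> k _; rewrite lincount_incr addrA [LHS]cosD (sin_cosB (c + _)).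
  by rewrite mulrC [X in _ - X]mulrC; congr (_ - _ * cos _); ring.
by rewrite multinomial_meanB !multinomial_meanZ; ring.
Qed.

(** One step of [cos_recursion_step] per draw: the draws play the role of independent summands, with
    mean cosine and sine given by the sums over i. *)
Lemma multinomial_mean_cos_close N (x : I -> R) c l : 0 <= l <= 1 ->
  `|mean N (fun k => cos (c + lincount x k)) - l ^+ N * cos c| <=
  N%:R * (`|\sum_i p i * cos (x i) - l| + `|\sum_i p i * sin (x i)|).
Proof.
move=> l01; elim: N c => [|N IH] c.
  by rewrite /= lincount0 addr0 expr0 !mul1r subrr normr0 mul0r.
rewrite multinomial_mean_cos; apply: cos_recursion_step => //.
  by apply: norm_multinomial_mean_le => k _; exact: norm_cos_le1.
by apply: norm_multinomial_mean_le => k _; exact: norm_cos_le1.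
Qed.

End multinomial_average.

Lemma uniform_weights_sum (R : realType) m : (0 < m)%N -> \sum_(i < m) m%:R^-1 = 1 :> R.
Proof. by move=> m0; rewrite sumr_const card_ord -[LHS]mulr_natl mulfV// pnatr_eq0 -lt0n. Qed.

Lemma uniform_weights_ge0 (R : realType) m (i : 'I_m) : 0 <= m%:R^-1 :> R.
Proof. by rewrite invr_ge0. Qed.

Section multinomial_mass.
Variables (R : realType) (m : nat) (p : 'I_m -> R).

(** The mass of k is the sum, over the outcome i of one draw, of p i times the mass of k with one i
    removed. Each such term is k i times a common factor, and the k i sum to N + 1, which turns N!
    into (N + 1)!. *)
Lemma multinomial_mean_pmf N (k : {ffun 'I_m -> nat}) :
  multinomial_mean p N (fun k' => (k' == k)%:R) = multinomial_pmf N p k.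
Proof.
rewrite /multinomial_pmf.
elim: N k => [|N IH] k /=.
  case: ifPn => [/eqP k0|kn].
    have kk i : k i = 0%N.
      by apply/eqP; move/eqP: k0; rewrite sum_nat_eq0 => /forallP/(_ i).
    rewrite (_ : [ffun=> 0%N] = k) ?eqxx; last by apply/ffunP => i; rewrite ffunE kk.
    rewrite !big1 ?fact0 ?divr1 ?mulr1// => i _; by rewrite ?kk.
  case: eqP => // E; move: kn; rewrite -E big1 ?eqxx// => i _; by rewrite ffunE.
(* Subtraction is truncated: [dec i] is undone by [incr] at i only when k i is positive, whence the
   case distinctions. *)
pose dec i : {ffun 'I_m -> nat} := [ffun j => (k j - (j == i))%N].
have incrE k' i : (incr k' i == k) = (0 < k i)%N && (k' == dec i).
  apply/eqP/andP => [kE|[ki /eqP ->]].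
    split; first by rewrite -kE ffunE eqxx addn1.
    by apply/eqP/ffunP => j; rewrite /dec -kE !ffunE addnK.
  apply/ffunP => j; rewrite !ffunE; case: eqP => [->|_]; last by rewrite subn0 addn0.
  by rewrite subnK.
have E i : p i * multinomial_mean p N (fun k' => (incr k' i == k)%:R) =
    if (0 < k i)%N then p i * multinomial_mean p N (fun k' => (k' == dec i)%:R) else 0.
  case: ifPn => ki.
    by congr (_ * _); apply: eq_multinomial_mean => k' _; rewrite incrE ki.
  rewrite (@eq_multinomial_mean _ _ _ _ _ (fun=> 0 * 0)).
    by rewrite multinomial_meanZ mul0r mulr0.
  by move=> k' _; rewrite incrE (negbTE ki) mul0r.
under eq_bigr do rewrite E IH.
have tdec i : (0 < k i)%N -> (\sum_j k j = (\sum_j dec i j).+1)%N.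
  move=> ki; rewrite (bigD1 i)//= [in RHS](bigD1 i)//= ffunE eqxx -addSn -subSn// subn1/=.
  by congr (_ + _)%N; apply: eq_bigr => j /negbTE ji; rewrite ffunE ji subn0.
case: ifPn => [/eqP kN|kN]; last first.
  rewrite big1// => i _; case: ifPn => // ki; case: ifPn => [/eqP dN|_]; last by rewrite mulr0.
  by case/negP: kN; rewrite (tdec i)// dN.
have F0 : (\prod_(i < m) (k i)`!)%:R != 0 :> R.
  by rewrite pnatr_eq0 -lt0n prodn_gt0// => i; exact: fact_gt0.
have term i : (if (0 < k i)%N then p i * (if (\sum_j dec i j)%N == N
      then N`!%:R / (\prod_(j < m) (dec i j)`!)%:R * \prod_(j < m) p j ^+ dec i j else 0) else 0) =
    (k i)%:R * (N`!%:R / (\prod_(j < m) (k j)`!)%:R * \prod_(j < m) p j ^+ k j).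
  case: ifPn => [ki|]; last by rewrite -eqn0Ngt => /eqP ->; rewrite mul0r.
  rewrite (_ : _ == _); last by rewrite -eqSS -tdec// kN.
  have E1 : (\prod_(j < m) (k j)`!)%:R = (k i)%:R * (\prod_(j < m) (dec i j)`!)%:R :> R.
    rewrite -natrM; congr (_%:R); rewrite (bigD1 i)//= [in RHS](bigD1 i)//= mulnA.
    rewrite ffunE eqxx subn1 -[in LHS](prednK ki) factS prednK//; congr (_ * _)%N.
    by apply: eq_bigr => j /negbTE ji; rewrite ffunE ji subn0.
  have E2 : \prod_(j < m) p j ^+ k j = p i * \prod_(j < m) p j ^+ dec i j.
    rewrite (bigD1 i)//= [in RHS](bigD1 i)//= mulrA ffunE eqxx subn1.
    rewrite -exprS prednK//; congr (_ * _).
    by apply: eq_bigr => j /negbTE ji; rewrite ffunE ji subn0.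
  move: F0; rewrite E1 E2 mulf_eq0 negb_or => /andP[k0 d0].
  by field; rewrite d0 k0.
under eq_bigr do rewrite term.
rewrite -mulr_suml -natr_sum kN factS natrM.
by rewrite !mulrA.
Qed.

End multinomial_mass.

(** * Squared Frobenius norm and a quadratic modulus of continuity *)

Definition sqn (R : realType) p q (M : 'M[R]_(p, q)) : R := \sum_i \sum_j M i j ^+ 2.

Section square_norm.
Variable R : realType.

Lemma sqn_dot d (x : 'cV[R]_d) : sqn x = dot x x.
Proof. by apply: eq_bigr => i _; rewrite big_ord1 expr2. Qed.

Lemma sqnE d (x : 'cV[R]_d) : sqn x = \sum_i x i 0 ^+ 2.
Proof. by apply: eq_bigr => i _; rewrite big_ord1. Qed.

Lemma sqn_ge0 p q (M : 'M[R]_(p, q)) : 0 <= sqn M.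
Proof. by apply: sumr_ge0 => i _; apply: sumr_ge0 => j _; exact: sqr_ge0. Qed.

Lemma sqr_le_sqn p q (M : 'M[R]_(p, q)) i j : M i j ^+ 2 <= sqn M.
Proof.
rewrite /sqn (bigD1 i)//= (bigD1 j)//= -addrA lerDl addr_ge0//.
  by apply: sumr_ge0 => ? _; exact: sqr_ge0.
by apply: sumr_ge0 => ? _; apply: sumr_ge0 => ? _; exact: sqr_ge0.
Qed.

Lemma continuous_sqn d : continuous (fun x : 'cV[R]_d => sqn x).
Proof.
rewrite (_ : (fun x => _) = (fun x : 'cV[R]_d => \sum_i x i 0 ^+ 2)); last first.
  by apply/funext => z; exact: sqnE.
apply: (continuous_big (@add_continuous R)) => i _ x.
apply: (@cvg_comp _ _ _ (fun x : 'cV[R]_d => x i 0) (fun y => y ^+ 2)).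
  exact: coord_continuous.
exact: exprn_continuous.
Qed.

Lemma continuous_trmx d : continuous (@trmx R 1 d).
Proof.
move=> v A /nbhs_ballP[e e0 eA]; apply/nbhs_ballP; exists e => // w vw; apply: eA.
by case: vw => e' vw; split => // i j; rewrite !mxE.
Qed.

(** Heine-Borel for row vectors, carried over by transposition; the entries are bounded because |v|
    <= 1 + v^2. *)
Lemma compact_sqn_le d (rho : R) : compact [set x : 'cV[R]_d | sqn x <= rho].
Proof.
rewrite (_ : [set x | _] = trmx @` [set v : 'rV[R]_d | sqn v^T <= rho]); last first.
  by apply/seteqP; split => [x xr|_ [v vr <-]//]; exists x^T; rewrite /= ?trmxK.
apply: continuous_compact.
  by apply: continuous_subspaceT; exact: continuous_trmx.
apply: bounded_closed_compact.
  exists (1 + rho); split=> [|M Mr v /= vr]; first exact: num_real.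
  rewrite /Num.norm/= mx_normrE; apply: bigmax_le => [|[i j] _ /=].
    by rewrite (le_trans _ (ltW Mr))// addr_ge0// (le_trans (sqn_ge0 _) vr).
  rewrite (le_trans _ (ltW Mr))//.
  have := le_trans (sqr_le_sqn v^T j i) vr.
  rewrite mxE -(real_normK (num_real (v i j))).
  by have := normr_ge0 (v i j); have := sqr_ge0 (`|v i j| - 1); nra.
apply: (@preimage_closed _ _ (fun v : 'rV[R]_d => sqn v^T) [set x | x <= rho]).
  move=> v _; apply: (@cvg_comp _ _ _ trmx (fun x : 'cV[R]_d => sqn x)).
    exact: continuous_trmx.
  exact: continuous_sqn.
exact: closed_le.
Qed.

(** For y close to x, uniform continuity on the compact ball gives the term e. Otherwise some
    coordinate differs by at least dl / 2, and K is chosen so that K (dl / 2)^2 is the trivial bound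
    2 M. The square makes second moments of x - y sufficient later. *)
Lemma continuous_quadratic_modulus d (h : 'cV[R]_d -> R) (M : R) : continuous h ->
  (forall x, `|h x| <= M) -> forall rho e, 0 < e ->
  exists2 K : R, 0 <= K & forall x y, sqn x <= rho -> `|h x - h y| <= e + K * sqn (x - y).
Proof.
move=> ch hM rho e e0.
have M0 : 0 <= M by apply: le_trans (hM 0).
(* Compactness in its covering form yields one radius dl valid at all x of the ball, while y is
   unrestricted. *)
have := @compact_sqn_le d rho; rewrite compact_near_coveringP => cov.
have := cov R (0^'+) (fun dl x => forall y, ball x dl y -> `|h x - h y| <= e) _.
have H : forall x : 'cV[R]_d, [set x : 'cV[R]_d | sqn x <= rho] x ->
    \forall x' \near x & dl \near (0 : R)^'+, forall y, ball x' dl y -> `|h x' - h y| <= e.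
  move=> x _.
  have e2 : 0 < e / 2 by rewrite divr_gt0.
  have /cvgrPdist_le/(_ _ e2) := ch x.
  move=> /nbhs_ballP[r /= r0 rh].
  exists (ball x (r / 2), [set dl | dl < r / 2]).
    split; first by apply: nbhsx_ballx; rewrite divr_gt0.
    by apply: nbhs_right_lt; rewrite divr_gt0.
  move=> [x' dl] /= [xx' dlr] y x'y.
  have xy : ball x r y.
    rewrite [r]splitr; apply: ball_triangle xx' _.
    exact: le_ball (ltW dlr) _ x'y.
  have xx'' : ball x r x' by apply: le_ball xx'; lra.
  rewrite (_ : h x' - h y = (h x - h y) - (h x - h x')); last by ring.
  rewrite (le_trans (ler_normB _ _))// [leRHS]splitr lerD//; exact: rh.
move=> /(_ _ H) [dl /= dl0 dlP].
have dl20 : 0 < dl / 2 by rewrite divr_gt0.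
have D : ball_ Num.norm 0 dl (dl / 2).
  by rewrite /ball_/= sub0r normrN gtr0_norm// ltr_pdivrMr// ltr_pMr// ltr1n.
have {}dlP := dlP _ D dl20.
exists (2 * M / (dl / 2) ^+ 2); first by rewrite divr_ge0 ?sqr_ge0// mulr_ge0.
move=> x y xr; have [xy|xy] := pselect (ball x (dl / 2) y).
  rewrite (le_trans (dlP x xr y xy))// lerDl mulr_ge0 ?sqn_ge0//.
  by rewrite divr_ge0 ?sqr_ge0// mulr_ge0.
have [i xyi] : exists i, dl / 2 <= `|x i 0 - y i 0|.
  apply: contrapT => /forallNP H'; apply: xy; split => // i j.
  by rewrite ord1; apply: contrapT => /negP; rewrite -leNgt; exact: H'.
rewrite (le_trans (ler_normB _ _))// (@le_trans _ _ (2 * M))//.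
  by rewrite mulr_natl mulr2n lerD.
rewrite ler_wpDl ?(ltW e0)// mulrAC ler_pdivlMr ?exprn_gt0//.
rewrite ler_wpM2l ?mulr_ge0//.
rewrite (le_trans _ (sqr_le_sqn (x - y) i 0))// !mxE.
rewrite -[leRHS](real_normK (num_real _)).
by rewrite ler_sqr ?nnegrE// ltW.
Qed.

End square_norm.

(** * Trigonometric polynomials *)

Section trigonometric_polynomials.
Variables (R : realType) (d : nat).
Implicit Types f g : 'cV[R]_d -> R.

(** Entries are amplitude, frequency vector and phase; free phases make this class an algebra
    containing the sines. *)
Definition trig_eval (l : seq (R * 'cV[R]_d * R)) (x : 'cV[R]_d) : R :=
  \sum_(q <- l) q.1.1 * cos (q.2 + dot q.1.2 x).

Definition is_trig f := exists l, f =1 trig_eval l.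

Lemma is_trigD f g : is_trig f -> is_trig g -> is_trig (fun x => f x + g x).
Proof.
by move=> [l fl] [l' gl]; exists (l ++ l') => x; rewrite /trig_eval big_cat fl gl.
Qed.

Lemma is_trigZ (a : R) f : is_trig f -> is_trig (fun x => a * f x).
Proof.
move=> [l fl]; exists [seq (a * q.1.1, q.1.2, q.2) | q <- l] => x.
rewrite fl /trig_eval big_map mulr_sumr; apply: eq_bigr => q _ /=.
by rewrite mulrA.
Qed.

Lemma is_trig_cos (c : R) (th : 'cV[R]_d) : is_trig (fun x => cos (c + dot th x)).
Proof. by exists [:: (1, th, c)] => x; rewrite /trig_eval big_seq1 mul1r. Qed.

Lemma eq_is_trig f g : f =1 g -> is_trig f -> is_trig g.
Proof. by move=> fg [l fl]; exists l => x; rewrite -fg fl. Qed.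

Lemma dot0l (x : 'cV[R]_d) : dot 0 x = 0.
Proof. by rewrite /dot big1// => i _; rewrite mxE mul0r. Qed.

Lemma dotDl (x y z : 'cV[R]_d) : dot (x + y) z = dot x z + dot y z.
Proof. by rewrite /dot -big_split; apply: eq_bigr => i _; rewrite mxE mulrDl. Qed.

Lemma dotZl (a : R) (x z : 'cV[R]_d) : dot (a *: x) z = a * dot x z.
Proof. by rewrite /dot mulr_sumr; apply: eq_bigr => i _; rewrite mxE mulrA. Qed.

Lemma is_trig_cst (c : R) : is_trig (fun=> c).
Proof.
apply: (@eq_is_trig (fun x => c * cos (0 + dot 0 x))).
  by move=> x; rewrite dot0l addr0 cos0 mulr1.
by apply: is_trigZ; exact: is_trig_cos.
Qed.

Lemma is_trig_sum (J : Type) (s : seq J) (f : J -> 'cV[R]_d -> R) :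
  (forall j, is_trig (f j)) -> is_trig (fun x => \sum_(j <- s) f j x).
Proof.
move=> tf; elim: s => [|j s IH].
  by apply: (eq_is_trig _ (is_trig_cst 0)) => x; rewrite big_nil.
by apply: (eq_is_trig _ (is_trigD (tf j) IH)) => x; rewrite big_cons.
Qed.

(** Product to sum: 2 cos a cos b = cos (a + b) + cos (a - b). *)
Lemma is_trigM f g : is_trig f -> is_trig g -> is_trig (fun x => f x * g x).
Proof.
move=> [l fl] [l' gl].
apply: (@eq_is_trig (fun x => \sum_(q <- l) \sum_(q' <- l') (q.1.1 * q'.1.1 / 2) *
   (cos (q.2 + q'.2 + dot (q.1.2 + q'.1.2) x) + cos (q.2 - q'.2 + dot (q.1.2 + (- 1) *: q'.1.2) x)))).
  move=> x; rewrite fl gl /trig_eval mulr_suml; apply: eq_bigr => q _.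
  rewrite mulr_sumr; apply: eq_bigr => q' _.
  rewrite !dotDl dotZl.
  set a := dot _ _; set b := dot _ _.
  rewrite (_ : _ + (a + b) = (q.2 + a) + (q'.2 + b)); last by ring.
  rewrite (_ : q.2 - _ + _ = (q.2 + a) - (q'.2 + b)); last by ring.
  by rewrite cosB cosD; field.
do 2 apply: is_trig_sum => ?.
by apply: is_trigZ; apply: is_trigD; exact: is_trig_cos.
Qed.

(** Unfolded, the mean is a polynomial in the weights p x i. *)
Lemma is_trig_multinomial_mean (I : finType) (p : 'cV[R]_d -> I -> R) N G :
  (forall i, is_trig (fun x => p x i)) ->
  is_trig (fun x => multinomial_mean (p x) N G).
Proof.
move=> tp; elim: N G => [|N IH] G /=; first exact: is_trig_cst.
by apply: is_trig_sum => i; apply: is_trigM.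
Qed.

Lemma trig_measurable f : is_trig f -> measurable_fun setT (f : borelV R d -> R).
Proof.
move=> [l fl]; rewrite (_ : f = trig_eval l); last exact/funext.
apply: measurable_sum => q; apply: measurable_funM; first exact: measurable_cst.
apply: measurable_cos_comp; apply: measurable_funD; first exact: measurable_cst.
exact: measurable_dot.
Qed.

End trigonometric_polynomials.

(** * Bernstein approximation by trigonometric polynomials *)

Section trigonometric_approximation.
Variables (R : realType) (d : nat) (h : 'cV[R]_d -> R) (M : R).
Hypothesis hM : forall x, `|h x| <= M.

Section bernstein.
Variables (w : R) (N : nat).
Hypotheses (w0 : 0 < w) (N0 : (0 < N)%N) (d0 : (0 < d)%N).

Let I : finType := ('I_d * bool)%type.
Let sg (b : bool) : R := (-1) ^+ b.

(* One step of a random walk: a coordinate i chosen uniformly moves by d/(wN)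
   with a sign of mean sin (w x_i). *)
Let p (x : 'cV[R]_d) (q : I) : R := (1 + sg q.2 * sin (w * x q.1 0)) / (2 * d%:R).

Let dn0 : d%:R != 0 :> R. Proof. by rewrite pnatr_eq0 -lt0n. Qed.
Let sumI (F : I -> R) : \sum_q F q = \sum_(i < d) (F (i, false) + F (i, true)).
Proof.
rewrite (eq_bigr (fun q => F (q.1, q.2))); last by case.
rewrite -(pair_bigA _ (fun i b => F (i, b)))/=; apply: eq_bigr => i _.
by rewrite (bigD1 false)//= (bigD1 true)//= big1 ?addr0//; case.
Qed.

Let p1 x : \sum_q p x q = 1.
Proof.
rewrite sumI (eq_bigr (fun=> d%:R^-1)) => [|i _].
  by rewrite sumr_const card_ord -[LHS]mulr_natl divff.
by rewrite /p /sg /= expr0 expr1; field.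
Qed.

Let p0 x q : 0 <= p x q.
Proof.
rewrite divr_ge0 ?mulr_ge0//.
have := norm_sin_le1 (w * x q.1 0); rewrite ler_norml => /andP[s1 s2].
by rewrite /sg; case: q.2; rewrite ?expr0 ?expr1; lra.
Qed.

Let step (i : 'I_d) (q : I) : R := (q.1 == i)%:R * (d%:R / w * sg q.2).

(** The position of the walk after N steps. Its i-th coordinate has mean sin (w x_i) / w, close to
    x_i for small w. *)
Let node k : 'cV[R]_d := \col_i (N%:R^-1 * lincount (step i) k).

Let mean_step x i : \sum_q p x q * step i q = sin (w * x i 0) / w.
Proof.
rewrite sumI (bigD1 i)//= big1 => [|j /negbTE ji].
  rewrite addr0 /p /step /sg /= eqxx expr0 expr1 (_ : true%:R = 1 :> R)//.
  by field; rewrite dn0 gt_eqF.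
by rewrite /step/= ji !mul0r !mulr0 addr0.
Qed.

Let sqr_step x i : \sum_q p x q * step i q ^+ 2 = d%:R / w ^+ 2.
Proof.
rewrite sumI (bigD1 i)//= big1 => [|j /negbTE ji].
  rewrite addr0 /p /step /sg /= eqxx expr0 expr1 (_ : true%:R = 1 :> R)//.
  by field; rewrite dn0 gt_eqF.
by rewrite /step/= ji !mul0r expr0n/= !mulr0 addr0.
Qed.

(** The variance of an average of N independent steps; the variance of one step is at most its
    second moment d / w^2. *)
Let node_sqr x i : multinomial_mean (p x) N (fun k => (node k i 0 - sin (w * x i 0) / w) ^+ 2)
  <= d%:R / (w ^+ 2 * N%:R).
Proof.
pose s := sin (w * x i 0) / w.
pose a q := step i q - s.
have Nn0 : N%:R != 0 :> R by rewrite pnatr_eq0 -lt0n.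
rewrite (@eq_multinomial_mean _ _ _ _ _ (fun k => N%:R ^- 2 * lincount a k ^+ 2)).
  rewrite multinomial_meanZ multinomial_mean_sqr//; last first.
    under eq_bigr do rewrite mulrBr.
    by rewrite sumrB mean_step -mulr_suml p1 mul1r subrr.
  have -> : \sum_q p x q * a q ^+ 2 = d%:R / w ^+ 2 - s ^+ 2.
    under eq_bigr => q _.
      rewrite (_ : _ * _ = p x q * step i q ^+ 2 - 2 * s * (p x q * step i q) + p x q * s ^+ 2).
        over.
      by rewrite /a; ring.
    rewrite big_split/= sumrB -mulr_sumr -mulr_suml p1 mean_step sqr_step -/s.
    by ring.
  rewrite [leRHS](_ : _ = N%:R ^- 2 * (N%:R * (d%:R / w ^+ 2))).
    by rewrite !ler_wpM2l// lerBlDr lerDl sqr_ge0.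
  by field; rewrite Nn0 gt_eqF.
move=> k kN; rewrite mxE -exprVn -exprMn; congr (_ ^+ 2).
rewrite /lincount [in RHS](eq_bigr (fun q => (k q)%:R * step i q - (k q)%:R * s)); last first.
  by move=> q _; rewrite mulrBr.
by rewrite sumrB mulrBr -mulr_suml -natr_sum kN mulrA mulVf// mul1r.
Qed.

(** As an average of values of h it keeps the bound M everywhere, also where it is far from h. *)
Definition bernstein_trig (x : 'cV[R]_d) : R := multinomial_mean (p x) N (fun k => h (node k)).

Lemma is_trig_bernstein : is_trig bernstein_trig.
Proof.
apply: is_trig_multinomial_mean => q.
apply: (@eq_is_trig _ _ (fun x => (2 * d%:R)^-1 +
   sg q.2 / (2 * d%:R) * cos (- (pi / 2) + dot (w *: delta_mx q.1 0) x))).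
  move=> x; rewrite /p (sin_cosB (w * _)) dotZl.
  rewrite (_ : dot _ _ = x q.1 0).
    by rewrite (addrC _ (w * _)); field.
  rewrite /dot (bigD1 q.1)//= mxE !eqxx mul1r big1 ?addr0// => j /negbTE ji.
  by rewrite mxE ji mul0r.
apply: is_trigD; first exact: is_trig_cst.
by apply: is_trigZ; exact: is_trig_cos.
Qed.

Lemma bernstein_le x : `|bernstein_trig x| <= M.
Proof. by apply: norm_multinomial_mean_le => //; exact: p1. Qed.

(** The modulus hypothesis reduces the error to the mean squared distance from x to the node. Each
    coordinate splits into a bias, at most w^2 |x_i|^3 by the cubic bound on sin u - u, and a
    fluctuation bounded by [node_sqr]. *)
Lemma bernstein_close (rho e K : R) : 0 <= K ->
  (forall x y, sqn x <= rho -> `|h x - h y| <= e + K * sqn (x - y)) ->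
  forall x, sqn x <= rho -> `|bernstein_trig x - h x| <=
    e + K * (2 * d%:R * (w ^+ 4 * rho ^+ 3 + d%:R / (w ^+ 2 * N%:R))).
Proof.
move=> K0 hK x xr; rewrite (le_trans (multinomial_mean_dist (p1 x) (p0 x) _ _ _))//.
apply: (@le_trans _ _ (multinomial_mean (p x) N (fun k => e + K * (\sum_(i < d)
    (2 * (w ^+ 4 * rho ^+ 3) + 2 * (node k i 0 - sin (w * x i 0) / w) ^+ 2))))).
  apply: le_multinomial_mean => // k _; rewrite distrC (le_trans (hK _ _ xr))// lerD2l.
  rewrite ler_wpM2l// sqnE; apply: ler_sum => i _; rewrite !mxE.
  have sw : (x i 0 - sin (w * x i 0) / w) ^+ 2 <= w ^+ 4 * rho ^+ 3.
    have := norm_sinB_le (w * x i 0).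
    rewrite normrM (gtr0_norm w0) exprMn => h1.
    rewrite (_ : x i 0 - _ = w^-1 * (- (sin (w * x i 0) - w * x i 0))); last by field; rewrite gt_eqF.
    rewrite exprMn sqrrN -(real_normK (num_real (sin _ - _))).
    apply: (@le_trans _ _ (w^-1 ^+ 2 * (w ^+ 3 * `|x i 0| ^+ 3) ^+ 2)).
      rewrite ler_wpM2l ?sqr_ge0// ler_sqr ?nnegrE ?mulr_ge0 ?exprn_ge0 ?(ltW w0)//.
      rewrite (le_trans h1)// ler_piMr ?mulr_ge0 ?exprn_ge0 ?(ltW w0)//; lra.
    rewrite [leLHS](_ : _ = w ^+ 4 * (`|x i 0| ^+ 2) ^+ 3); last by field; rewrite gt_eqF.
    rewrite ler_wpM2l ?exprn_ge0 ?(ltW w0)//.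
    rewrite real_normK ?num_real// lerXn2r ?nnegrE ?sqr_ge0//.
      by rewrite (le_trans _ xr) ?sqn_ge0.
    by rewrite (le_trans (sqr_le_sqn x i 0)).
  move: sw; set s := sin _ / _; set v := N%:R^-1 * _ => sw.
  by have := sqr_ge0 ((x i 0 - s) + (v - s)); lra.
rewrite multinomial_meanD multinomial_mean_cst ?p1// multinomial_meanZ lerD2l ler_wpM2l//.
rewrite multinomial_mean_sum (_ : 2 * d%:R * _ = \sum_(i < d)
   (2 * (w ^+ 4 * rho ^+ 3) + 2 * (d%:R / (w ^+ 2 * N%:R)))); last first.
  by rewrite sumr_const card_ord -[RHS]mulr_natl; ring.
apply: ler_sum => i _; rewrite multinomial_meanD multinomial_mean_cst ?p1//.
by rewrite multinomial_meanZ lerD2l ler_wpM2l.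
Qed.

End bernstein.

Hypothesis d0 : (0 < d)%N.
Hypothesis ch : continuous h.

(** The bias C1 w^4 is made small by the choice of w, then the fluctuation C2 / N by that of N. *)
Lemma trig_approx (rho e : R) : 0 < e -> exists q : 'cV[R]_d -> R,
  [/\ is_trig q, forall x, `|q x| <= M & forall x, sqn x <= rho -> `|q x - h x| <= e].
Proof.
move=> e0; have [r0|r0] := ltP rho 0.
  exists (fun=> 0); split; first exact: is_trig_cst.
    by move=> x; rewrite normr0 (le_trans _ (hM 0)).
  by move=> x xr; have := sqn_ge0 x; rewrite leNgt (le_lt_trans xr r0).
have e3 : 0 < e / 3 by rewrite divr_gt0.
have [K K0 hK] := continuous_quadratic_modulus ch hM rho e3.
pose C1 := K * (2 * d%:R * rho ^+ 3).
have C10 : 0 <= C1 by rewrite !mulr_ge0// exprn_ge0.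
(* This w is at most 1 and satisfies C1 w <= e / 3, hence C1 w^4 <= e / 3. *)
pose w := (e / 3) / (C1 + e / 3).
have Ce : 0 < C1 + e / 3 by rewrite ltr_wpDl.
have w0 : 0 < w by rewrite divr_gt0.
have w1 : w <= 1 by rewrite ler_pdivrMr// mul1r lerDr.
have Cw : C1 * w ^+ 4 <= e / 3.
  apply: (@le_trans _ _ (C1 * w)).
    by rewrite ler_wpM2l// exprS ler_piMr ?(ltW w0)// exprn_ile1 ?(ltW w0).
  rewrite /w mulrA ler_pdivrMr// mulrC ler_wpM2l ?(ltW e3)// lerDl ltW//.
pose C2 := K * (2 * d%:R * (d%:R / w ^+ 2)).
have C20 : 0 <= C2 by rewrite !mulr_ge0// invr_ge0 sqr_ge0.
pose N := (Num.truncn (C2 / (e / 3))).+1.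
have CN : C2 / N%:R <= e / 3.
  rewrite ler_pdivrMr// mulrC -ler_pdivrMr//; apply/ltW; exact: truncnS_gt.
exists (bernstein_trig w N); split.
- exact: is_trig_bernstein.
- by move=> x; exact: bernstein_le.
- move=> x xr; have := bernstein_close w0 (isT : (0 < N)%N) d0 K0 hK xr.
  move=> /le_trans; apply.
  rewrite (_ : K * _ = C1 * w ^+ 4 + C2 / N%:R); first by lra.
  have : w != 0 by rewrite gt_eqF.
  have : N%:R != 0 :> R by rewrite pnatr_eq0.
  rewrite /C1 /C2; move: (w) (N%:R : R) => a b b0 a0.
  by field; rewrite a0 b0.
Qed.

(** Inside the ball of squared radius 2 M / e the modulus and the approximation apply; outside it |h
    S' - q S| <= 2 M < e |S|^2. The second radius [rho1] serves the pointwise convergence of a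
    sequence of approximants. *)
Lemma trig_approx_quadratic (rho1 e1 e : R) : 0 < e1 -> 0 < e ->
  exists q : 'cV[R]_d -> R, exists2 K : R, 0 <= K &
  [/\ is_trig q, forall x, `|q x| <= M, forall x, sqn x <= rho1 -> `|q x - h x| <= e1 &
    forall S S', `|h S' - q S| <= e * (1 + sqn S) + K * sqn (S - S')].
Proof.
move=> e10 e0.
have M0 : 0 <= M by apply: le_trans (hM 0).
pose rho := 2 * M / e.
have e2 : 0 < e / 2 by rewrite divr_gt0.
have [K K0 hK] := continuous_quadratic_modulus ch hM rho e2.
have m0 : 0 < Num.min (e / 2) e1 by rewrite lt_min e2.
have [q [tq qM qh]] := trig_approx (Num.max rho rho1) m0.
exists q, K => //; split => // [x xr|S S'].
  by rewrite (le_trans (qh x _)) ?le_max ?xr ?orbT// ge_min lexx orbT.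
have [Sr|Sr] := leP (sqn S) rho.
  rewrite (_ : h S' - q S = - (h S - h S') + - (q S - h S)); last by ring.
  rewrite (le_trans (ler_normD _ _))// !normrN.
  have : `|q S - h S| <= e / 2.
    by rewrite (le_trans (qh S _)) ?le_max ?Sr// ge_min lexx.
  have := hK S S' Sr; have := sqn_ge0 S.
  have : 0 <= e * sqn S by rewrite mulr_ge0 ?(ltW e0) ?sqn_ge0.
  by lra.
rewrite (le_trans (ler_normB _ _))// (le_trans (lerD (hM _) (qM _)))//.
move: Sr; rewrite /rho ltr_pdivrMr// => Sr.
have : 0 <= K * sqn (S - S') by rewrite mulr_ge0 ?sqn_ge0.
by lra.
Qed.

(* The last bound lets S' replace S at the cost of second moments only. *)
Lemma trig_approx_law (N : probability (borelV R d) R) (e : R) : 0 < e ->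
  exists q : 'cV[R]_d -> R, exists2 K : R, 0 <= K &
  [/\ is_trig q, forall x, `|q x| <= M, `|\int[N]_x q x - \int[N]_x h x| <= e &
    forall S S', `|h S' - q S| <= e * (1 + sqn S) + K * sqn (S - S')].
Proof.
move=> e0.
have k0 k : 0 < k.+1%:R^-1 :> R by rewrite invr_gt0.
(* Approximants with radius and precision indexed by k converge to h pointwise under the common
   bound M, so their integrals converge. K depends on k, which is harmless because a single k is
   kept. *)
pose Q k q := exists2 K : R, 0 <= K &
  [/\ is_trig q, forall x, `|q x| <= M,
    forall x : 'cV[R]_d, sqn x <= k%:R -> `|q x - h x| <= k.+1%:R^-1 &
    forall S S', `|h S' - q S| <= e * (1 + sqn S) + K * sqn (S - S')].
have /choice[q Qq] : forall k, exists q, Q k q.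
  by move=> k; exact: trig_approx_quadratic.
have cvg_q x : q k x @[k --> \oo] --> h x.
  apply/cvgrPdist_le => e' e'0; near=> k; have [K _ [_ _ qh _]] := Qq k.
  have xk : sqn x <= k%:R by near: k; exact: nbhs_infty_ger.
  rewrite distrC (le_trans (qh x xk))//; apply/ltW.
  by near: k; exact: (near_infty_natSinv_lt (PosNum e'0)).
have : \int[N]_x q k x @[k --> \oo] --> \int[N]_x h x.
  apply: (@Rintegral_dominated_cvg _ _ _ N (fun k (x : borelV R d) => q k x) _ (fun=> M)) => //.
  - by move=> k; have [K _ [tq _ _ _]] := Qq k; exact: trig_measurable.
  - exact: integrable_cstR.
  - by move=> k x; have [K _ [_ qM _ _]] := Qq k.
move=> /cvgrPdist_le /(_ e e0) [k _ /(_ k (leqnn _))]; rewrite distrC => ke.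
by have [K K0 [tq qM _ hq]] := Qq k; exists (q k), K.
Unshelve. all: by end_near.
Qed.

End trigonometric_approximation.

(** * Coercive matrices *)

Section coercive_matrices.
Variable R : realType.

Lemma cauchy_schwarz (I : finType) (a b : I -> R) :
  (\sum_i a i * b i) ^+ 2 <= (\sum_i a i ^+ 2) * (\sum_i b i ^+ 2).
Proof.
set A := \sum_i a i ^+ 2; set B := \sum_i b i ^+ 2; set C := \sum_i a i * b i.
have A0 : 0 <= A by apply: sumr_ge0 => i _; exact: sqr_ge0.
have B0 : 0 <= B by apply: sumr_ge0 => i _; exact: sqr_ge0.
have q s t : 0 <= s ^+ 2 * A + 2 * s * t * C + t ^+ 2 * B.
  have -> : s ^+ 2 * A + 2 * s * t * C + t ^+ 2 * B = \sum_i (s * a i + t * b i) ^+ 2.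
    rewrite /A /B /C !mulr_sumr -!big_split/=; apply: eq_bigr => i _.
    by ring.
  by apply: sumr_ge0 => i _; exact: sqr_ge0.
have [B1|B1] := ltP 0 B.
  by rewrite -(ler_pM2l B1); have := q B (- C); nra.
have {B1} Be : B = 0 by apply/eqP; rewrite eq_le B1 B0.
(* With B = 0, the choice s = C, t = - (1 + A) reads - (A + 2) C^2 >= 0, so C = 0. *)
have := q 1 (- C * (1 + A)); have := q C (- (1 + A)); rewrite Be.
by nra.
Qed.

Lemma sqn_mulmx p q r (A : 'M[R]_(p, q)) (B : 'M[R]_(q, r)) :
  sqn (A *m B) <= sqn A * sqn B.
Proof.
rewrite /sqn mulr_suml; apply: ler_sum => i _.
rewrite [X in _ * X]exchange_big mulr_sumr; apply: ler_sum => j _.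
by rewrite mxE; exact: cauchy_schwarz.
Qed.

Lemma dot_sqr_le d (x y : 'cV[R]_d) : dot x y ^+ 2 <= sqn x * sqn y.
Proof. by rewrite !sqnE; exact: cauchy_schwarz. Qed.

Lemma dotDr d (x y z : 'cV[R]_d) : dot x (y + z) = dot x y + dot x z.
Proof. by rewrite dotC dotDl !(dotC x). Qed.

Lemma dotZr d (a : R) (x z : 'cV[R]_d) : dot x (a *: z) = a * dot x z.
Proof. by rewrite dotC dotZl dotC. Qed.

Lemma sqnZ p q (a : R) (x : 'M[R]_(p, q)) : sqn (a *: x) = a ^+ 2 * sqn x.
Proof.
rewrite /sqn mulr_sumr; apply: eq_bigr => i _; rewrite mulr_sumr.
by apply: eq_bigr => j _; rewrite mxE exprMn.
Qed.

Lemma sqnD_le p q (x y : 'M[R]_(p, q)) : sqn (x + y) <= 2 * sqn x + 2 * sqn y.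
Proof.
rewrite /sqn !mulr_sumr -big_split; apply: ler_sum => i _ /=.
rewrite !mulr_sumr -big_split; apply: ler_sum => j _ /=; rewrite mxE.
by have := sqr_ge0 (x i j - y i j); nra.
Qed.

Lemma sqnN p q (x : 'M[R]_(p, q)) : sqn (- x) = sqn x.
Proof. by rewrite -scaleN1r sqnZ sqrrN expr1n mul1r. Qed.

Lemma sqn_eq0 d (x : 'cV[R]_d) : sqn x <= 0 -> x = 0.
Proof.
move=> x0; apply/matrixP => i j; rewrite ord1 mxE; apply/eqP.
by rewrite -sqrf_eq0 eq_le sqr_ge0 (le_trans (sqr_le_sqn x i 0)).
Qed.

(** The usable form of a lower bound on the eigenvalues: it bounds the inverse explicitly and
    survives small perturbations. *)
Definition coercive d (c : R) (M : 'M[R]_d) := forall x, c * sqn x <= dot x (M *m x).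

Lemma coercive_unit d c (M : 'M[R]_d) : 0 < c -> coercive c M -> M \in unitmx.
Proof.
move=> c0 cM; rewrite -row_free_unit -kermx_eq0; apply/rowV0P => v.
move=> /sub_kermxP vM; have := cM v^T.
rewrite [leRHS](_ : _ = 0).
  rewrite pmulr_rle0// => /sqn_eq0 v0.
  by rewrite -[v]trmxK v0 trmx0.
rewrite (_ : dot _ _ = (v *m (M *m v^T)) 0 0); first by rewrite mulmxA vM mul0mx mxE.
by rewrite mxE /dot; apply: eq_bigr => i _; rewrite mxE.
Qed.

(** By Cauchy-Schwarz, c |x|^2 <= x.Mx <= |x| |Mx|; the case x = 0 is apart. *)
Lemma coercive_le d (c : R) (M : 'M[R]_d) (x : 'cV[R]_d) : 0 < c -> coercive c M ->
  sqn x <= c ^- 2 * sqn (M *m x).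
Proof.
move=> c0 cM; rewrite mulrC ler_pdivlMr ?exprn_gt0//.
have := cM x; have := sqn_ge0 x; have := sqn_ge0 (M *m x).
have := dot_sqr_le x (M *m x).
set s := sqn x; set t := sqn _; set u := dot _ _ => ut t0 s0 cu.
have cs0 : 0 <= c * s by rewrite mulr_ge0// ltW.
have h : (c * s) ^+ 2 <= s * t.
  by rewrite (le_trans _ ut)// ler_sqr ?nnegrE// (le_trans cs0).
have [s1|s1] := ltP 0 s; last by rewrite (_ : s = 0) ?mul0r//; lra.
by rewrite -(ler_pM2l s1) (le_trans _ h)// exprMn; nra.
Qed.

Lemma sqn_invmx_le d (c : R) (M : 'M[R]_d) (x : 'cV[R]_d) : 0 < c -> coercive c M ->
  sqn (invmx M *m x) <= c ^- 2 * sqn x.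
Proof.
move=> c0 cM; have := coercive_le (invmx M *m x) c0 cM.
by rewrite mulKVmx//; exact: coercive_unit cM.
Qed.

(** |x.Dx| <= |D| |x|^2 with the Frobenius norm, so D costs at most half of c. *)
Lemma coerciveD d c (M D : 'M[R]_d) : 0 < c -> coercive c M -> sqn D <= (c / 2) ^+ 2 ->
  coercive (c / 2) (M + D).
Proof.
move=> c0 cM Dc x; rewrite mulmxDl dotDr.
have := cM x; have := sqn_ge0 x.
have : dot x (D *m x) ^+ 2 <= ((c / 2) * sqn x) ^+ 2.
  rewrite (le_trans (dot_sqr_le _ _))// exprMn [in leRHS]expr2 mulrCA.
  rewrite ler_wpM2l ?sqn_ge0//.
  by rewrite (le_trans (sqn_mulmx _ _))// mulrC [leRHS]mulrC ler_wpM2l ?sqn_ge0.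
move=> h s0 h'.
have cs : 0 <= c / 2 * sqn x by rewrite mulr_ge0// divr_ge0// ltW.
have : `|dot x (D *m x)| <= c / 2 * sqn x.
  by rewrite -(ger0_norm cs) -ler_sqr ?nnegrE// !real_normK ?num_real.
by rewrite ler_norml => /andP[h1 _]; lra.
Qed.

Lemma dot_mulmx_sym d (M : 'M[R]_d) x y : M^T = M -> dot x (M *m y) = dot (M *m x) y.
Proof. by move=> MT; rewrite dot_trmx MT. Qed.

Lemma continuous_mulmx d (M : 'M[R]_d) : continuous (fun x : 'cV[R]_d => dot x (M *m x)).
Proof.
rewrite (_ : (fun x => _) = (fun x : 'cV[R]_d => \sum_i (x i 0 * \sum_j (M i j * x j 0)))).
  apply: (continuous_big (@add_continuous R)) => i _ x.
  apply: cvgM; [exact: (nbhs_filter x)|exact: coord_continuous|].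
  move: x; apply: (continuous_big (@add_continuous R)) => j _ x.
  apply: (@cvg_comp _ _ _ (fun x : 'cV[R]_d => x j 0) (fun y => M i j * y)).
    exact: coord_continuous.
  exact: mulrl_continuous.
by apply/funext => x; apply: eq_bigr => i _; rewrite mxE.
Qed.

(* The minimum of the Rayleigh quotient is attained, and it is an eigenvalue
   because its first variation vanishes. *)
Lemma rayleigh_coercive d (M : 'M[R]_d) (c : R) : (0 < d)%N -> M^T = M ->
  0 < c -> c <= lambda_min M -> coercive c M.
Proof.
move=> d0 MT c0 cM.
have lb a : eigenvalue M a -> c <= a.
  move=> Ma; apply: (le_trans cM); rewrite /lambda_min.
  (* [inf] is 0 on a set without infimum, which 0 < c <= [lambda_min M] excludes. *)
  have [[_ hl]|nh] := pselect (has_inf [set a | eigenvalue M a]).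
    exact: ge_inf.
  by move: cM; rewrite /lambda_min inf_out// leNgt c0.
pose f (x : 'cV[R]_d) := dot x (M *m x).
pose A := [set x : 'cV[R]_d | sqn x = 1].
have A0 : A !=set0.
  exists (delta_mx (Ordinal d0) 0); rewrite /A/= sqnE (bigD1 (Ordinal d0))//= mxE !eqxx.
  by rewrite expr1n big1 ?addr0// => i /negbTE i0; rewrite mxE i0 expr0n.
have cA : compact A.
  apply: (subclosed_compact _ (@compact_sqn_le R d 1)); last by move=> x /= ->.
  apply: (@preimage_closed _ _ (fun x : 'cV[R]_d => sqn x) [set x | x = 1]).
    by move=> x _; exact: continuous_sqn.
  exact: closed_eq.
have [x0 x0A x0min] := compact_EVT_min A0 cA
  (continuous_subspaceT (@continuous_mulmx d M)).
have x01 : sqn x0 = 1 by move: x0A; rewrite inE.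
pose mu := f x0.
have fmu x : mu * sqn x <= f x.
  have [s0|s0] := ltP 0 (sqn x); last by rewrite (sqn_eq0 s0) /f mulmx0 sqn_dot !dot0l mulr0.
  have s1 : Num.sqrt (sqn x) ^+ 2 = sqn x by rewrite sqr_sqrtr// ltW.
  have := x0min ((Num.sqrt (sqn x))^-1 *: x).
  rewrite inE /A/= sqnZ exprVn s1 mulVf ?gt_eqF// => /(_ erefl).
  rewrite -/(f _) -/mu -scalemxAr dotZl dotZr mulrA -invfM -expr2 s1.
  by rewrite mulrC ler_pdivlMr.
have Mx0 : M *m x0 = mu *: x0.
  (* The variation is taken along the residual r: f (x0 + t r) - mu |x0 + t r|^2 is nonnegative, has
     no constant term, and its linear coefficient is 2 |r|^2. *)
  pose r := M *m x0 - mu *: x0.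
  pose B := f r - mu * sqn r.
  have q t : 0 <= 2 * t * sqn r + t ^+ 2 * B.
    have := fmu (x0 + t *: r); rewrite -subr_ge0 /f mulmxDr -scalemxAr.
    rewrite sqn_dot !dotDl !dotDr !dotZl !dotZr.
    rewrite (dot_mulmx_sym x0 r MT) (dotC r (M *m x0)) (dotC r x0) -!sqn_dot x01.
    rewrite -/(f x0) -/(f r) -/mu.
    have -> : sqn r = dot (M *m x0) r - mu * dot x0 r.
      by rewrite sqn_dot {1}/r dotDl -scaleNr dotZl mulNr.
    rewrite /B => h; apply: (le_trans h); rewrite le_eqVlt; apply/orP; left; apply/eqP.
    have -> : sqn r = dot (M *m x0) r - mu * dot x0 r.
      by rewrite sqn_dot {1}/r dotDl -scaleNr dotZl mulNr.
    by ring.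
  apply/eqP; rewrite -subr_eq0; apply/eqP/sqn_eq0; rewrite -/r.
  have s0 := sqn_ge0 r; set s := sqn r in q s0 *.
  have B1 : 0 < 1 + `|B| by rewrite ltr_wpDr.
  (* At this t the value is (s / (1 + |B|))^2 times the negative number B - 2 (1 + |B|), so s cannot
     be positive. *)
  have := q (- (s / (1 + `|B|))).
  rewrite (_ : _ + _ = s ^+ 2 / (1 + `|B|) ^+ 2 * (B - 2 * (1 + `|B|))); last first.
    by field; rewrite gt_eqF.
  rewrite nmulr_lge0; last by have := ler_norm B; have := normr_ge0 B; lra.
  rewrite ler_pdivrMr ?exprn_gt0// mul0r => h.
  by rewrite leNgt; apply/negP => s1; move: h; rewrite leNgt exprn_gt0.
have Emu : eigenvalue M mu.
  (* [eigenvalue] refers to row vectors; the symmetry of M allows the transposition. *)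
  apply/eigenvalueP; exists x0^T.
    by rewrite -[M]MT -trmx_mul Mx0 linearZ.
  apply/eqP => x00; move: x01; rewrite -[x0]trmxK x00 trmx0 sqn_dot dot0l.
  by move/eqP; rewrite eq_sym oner_eq0.
by move=> x; apply: le_trans (fmu x); rewrite ler_wpM2r ?sqn_ge0// lb.
Qed.

End coercive_matrices.

(** * Measurability of matrix-valued maps *)

Section measurable_matrices.
Context d (T : measurableType d) (R : realType).

Definition mx_measurable p q (Y : T -> 'M[R]_(p, q)) :=
  forall i j, measurable_fun setT (fun t => Y t i j).

Lemma mx_measurable_cst p q (A : 'M[R]_(p, q)) : mx_measurable (fun=> A).
Proof. by move=> i j; exact: measurable_cst. Qed.

Lemma mx_measurableD p q (Y Z : T -> 'M[R]_(p, q)) : mx_measurable Y -> mx_measurable Z ->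
  mx_measurable (fun t => Y t + Z t).
Proof.
move=> mY mZ i j; under eq_fun do rewrite mxE.
exact: measurable_funD.
Qed.

Lemma mx_measurableZ p q (f : T -> R) (Y : T -> 'M[R]_(p, q)) : measurable_fun setT f ->
  mx_measurable Y -> mx_measurable (fun t => f t *: Y t).
Proof.
move=> mf mY i j; under eq_fun do rewrite mxE.
exact: measurable_funM.
Qed.

Lemma mx_measurable_sum p q (I : Type) (s : seq I) (Y : I -> T -> 'M[R]_(p, q)) :
  (forall i, mx_measurable (Y i)) -> mx_measurable (fun t => \sum_(i <- s) Y i t).
Proof.
move=> mY i j; under eq_fun do rewrite summxE.
by apply: measurable_sum => k; exact: mY.
Qed.

Lemma mx_measurableM p q r (Y : T -> 'M[R]_(p, q)) (Z : T -> 'M[R]_(q, r)) :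
  mx_measurable Y -> mx_measurable Z -> mx_measurable (fun t => Y t *m Z t).
Proof.
move=> mY mZ i j; under eq_fun do rewrite mxE.
by apply: measurable_sum => k; exact: measurable_funM.
Qed.

Lemma mx_measurableB p q (Y Z : T -> 'M[R]_(p, q)) : mx_measurable Y -> mx_measurable Z ->
  mx_measurable (fun t => Y t - Z t).
Proof.
move=> mY mZ i j; under eq_fun do rewrite !mxE.
exact: measurable_funB.
Qed.

Lemma mx_measurable_tr p q (Y : T -> 'M[R]_(p, q)) : mx_measurable Y ->
  mx_measurable (fun t => (Y t)^T).
Proof. by move=> mY i j; under eq_fun do rewrite mxE; exact: mY. Qed.

Lemma measurable_det p (Y : T -> 'M[R]_p) : mx_measurable Y ->
  measurable_fun setT (fun t => \det (Y t)).
Proof.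
move=> mY; apply: measurable_sum => s; apply: measurable_funM; first exact: measurable_cst.
by apply: measurable_prod => i _; exact: mY.
Qed.

(** The pointwise limit of the continuous maps x / (x^2 + 1 / (n + 1)), which vanish at 0 in
    agreement with the convention 0^-1 = 0. *)
Lemma measurable_invr : measurable_fun setT (fun x : R => x^-1).
Proof.
apply: (@measurable_fun_cvg _ _ _ setT (fun n (x : R) => x / (x ^+ 2 + n.+1%:R^-1))).
  move=> n; apply: continuous_measurable_fun => x.
  apply: cvgM; first exact: cvg_id.
  have p0 : 0 < x ^+ 2 + n.+1%:R^-1 by rewrite ltr_wpDl ?sqr_ge0 ?invr_gt0.
  apply: cvgV; first by rewrite gt_eqF.
  by apply: cvgD; [exact: exprn_continuous|exact: cvg_cst].
move=> x _; have [->|x0] := eqVneq x 0.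
  by rewrite invr0; under eq_cvg do rewrite mul0r; exact: cvg_cst.
rewrite [X in _ --> X](_ : _ = x / (x ^+ 2 + 0)); last by rewrite addr0; field.
apply: cvgM; first exact: cvg_cst.
apply: cvgV; first by rewrite addr0 sqrf_eq0.
by apply: cvgD; [exact: cvg_cst|exact: cvg_harmonic].
Qed.

(** Cramer's formula off the zeros of the determinant; on them [invmx] returns its argument. *)
Lemma mx_measurable_inv p (Y : T -> 'M[R]_p) : mx_measurable Y ->
  mx_measurable (fun t => invmx (Y t)).
Proof.
move=> mY i j.
rewrite (_ : (fun t => _) = (fun t => if \det (Y t) == 0 then Y t i j
   else (\det (Y t))^-1 * \adj (Y t) i j)); last first.
  apply/funext => t; rewrite /invmx unitmxE unitfE.
  by case: eqP => // _; rewrite mxE.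
have mdet := measurable_det mY.
apply: measurable_fun_ifT => //.
  by apply: measurable_fun_eqr => //; exact: measurable_cst.
apply: measurable_funM; first exact: (measurableT_comp measurable_invr).
under eq_fun do rewrite mxE.
apply: measurable_funM; first exact: measurable_cst.
apply: measurable_det => k l; under eq_fun do rewrite !mxE.
exact: mY.
Qed.

Lemma measurable_dot_comp n (th : 'cV[R]_n) (Y : T -> 'cV[R]_n) : mx_measurable Y ->
  measurable_fun setT (fun t => dot th (Y t)).
Proof.
move=> mY; apply: measurable_sum => i; apply: measurable_funM; first exact: measurable_cst.
exact: mY.
Qed.

Lemma measurable_sqn p q (Y : T -> 'M[R]_(p, q)) : mx_measurable Y ->
  measurable_fun setT (fun t => sqn (Y t)).
Proof.
move=> mY; apply: measurable_sum => i; apply: measurable_sum => j.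
exact: measurable_funX.
Qed.

Lemma measurable_trig_comp n (q : 'cV[R]_n -> R) (Y : T -> 'cV[R]_n) : is_trig q ->
  mx_measurable Y -> measurable_fun setT (fun t => q (Y t)).
Proof.
move=> [l ql] mY; under eq_fun do rewrite ql.
apply: measurable_sum => a; apply: measurable_funM; first exact: measurable_cst.
apply: measurable_cos_comp; apply: measurable_funD; first exact: measurable_cst.
exact: measurable_dot_comp.
Qed.

(** Trigonometric polynomials of Y are measurable through the entries of Y, and h (Y) is a pointwise
    limit of them, taken along balls of squared radius k. *)
Lemma measurable_continuous_comp n (h : 'cV[R]_n -> R) (M : R) (Y : T -> 'cV[R]_n) :
  (0 < n)%N -> continuous h -> (forall x, `|h x| <= M) -> mx_measurable Y ->
  measurable_fun setT (fun t => h (Y t)).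
Proof.
move=> n0 ch hM mY.
have H (k : nat) : exists q : 'cV[R]_n -> R, is_trig q /\
    forall x, sqn x <= k%:R -> `|q x - h x| <= k.+1%:R^-1.
  have [|q [tq _ qh]] := trig_approx hM n0 ch k%:R (e := k.+1%:R^-1).
    by rewrite invr_gt0.
  by exists q.
have [q /all_and2[tq qh]] := choice H.
apply: (@measurable_fun_cvg _ _ _ setT (fun k t => q k (Y t))).
  by move=> k; exact: measurable_trig_comp.
move=> t _; apply/cvgrPdist_le => e e0; near=> k.
rewrite distrC (le_trans (qh k _ _))//.
  near: k; exact: nbhs_infty_ger.
apply: ltW; near: k; exact: near_infty_natSinv_lt (PosNum e0).
Unshelve. all: by end_near. Qed.

End measurable_matrices.

(** * Resolvent identities for the sketch and the bootstrap *)

Section sketch_algebra.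
Variables (R : realType) (n d : nat) (X : 'M[R]_(n, d)) (y : 'cV[R]_n) (lambda c : R).
Hypothesis c0 : 0 < c.

Local Notation H := (gramH X).
Local Notation g := (crossg X y).
Local Notation M := (H + lambda%:M).
Local Notation beta := (ridge X y lambda).
Local Notation psi := (influence X y lambda).

Definition zz_dev (v : 'cV[R]_n) : 'M[R]_d := zrow X v *m (zrow X v)^T - H.
Definition zu_dev (v : 'cV[R]_n) : 'cV[R]_d := urow y v *: zrow X v - g.
(** The scalar through which a row enters the moment estimates: up to a constant it dominates the
    squared influence, and the moment assumption bounds its second moment. *)
Definition row_dev (v : 'cV[R]_n) : R := sqn (zz_dev v) + sqn (zu_dev v).

Hypothesis cM : coercive c M.

Let uM : M \in unitmx. Proof. exact: coercive_unit cM. Qed.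

Lemma ridge_eq : M *m beta = g.
Proof. by rewrite /ridge /resolvA mulKVmx. Qed.

Lemma scalar_mulmx (a : 'M[R]_1) k (z : 'cV[R]_k) : z *m a = a 0 0 *: z.
Proof. by rewrite [a]mx11_scalar mul_mx_scalar mxE mulr1n. Qed.

(** The normal equation g = (H + lambda I) beta turns the penalty term lambda beta into the centring
    of both products. *)
Lemma influence_eq v : M *m psi v = zu_dev v - zz_dev v *m beta.
Proof.
rewrite /influence /resolvA mulKVmx// scalerBl -scalar_mulmx mulmxA.
rewrite /zu_dev /zz_dev -ridge_eq mulmxBl mulmxDl mul_scalar_mx.
by rewrite -!addrA; congr (_ + _); rewrite !opprD opprK !addrA; apply/matrixP => i j; rewrite !mxE; ring.
Qed.

Lemma sqn_ridge_le : sqn beta <= c ^- 2 * sqn g.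
Proof. by rewrite /ridge /resolvA; exact: sqn_invmx_le. Qed.

Lemma row_dev_ge0 v : 0 <= row_dev v.
Proof. by rewrite addr_ge0 ?sqn_ge0. Qed.

Lemma sqn_influence_le v : sqn (psi v) <= 2 * c ^- 2 * (1 + sqn beta) * row_dev v.
Proof.
rewrite (le_trans (coercive_le _ c0 cM))// influence_eq.
rewrite [2 * _]mulrC -!mulrA ler_wpM2l ?invr_ge0 ?sqr_ge0//.
rewrite (le_trans (sqnD_le _ _))// sqnN -mulrDr ler_wpM2l//.
have := sqn_mulmx (zz_dev v) beta; rewrite /row_dev.
have := sqn_ge0 (zz_dev v); have := sqn_ge0 (zu_dev v); have := sqn_ge0 beta.
by nra.
Qed.

Variables (m : nat) (s : 'I_m -> 'cV[R]_n).
Hypothesis m0 : (0 < m)%N.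

Local Notation Hs := (sketchH X s).
Local Notation gs := (sketchg X y s).
Local Notation betas := (sketched_ridge X y lambda s).

Let mr0 : m%:R != 0 :> R. Proof. by rewrite pnatr_eq0 -lt0n. Qed.

Lemma mean_cst k l (a : 'M[R]_(k, l)) : m%:R^-1 *: \sum_(i < m) a = a.
Proof. by rewrite sumr_const card_ord -[a *+ m]scaler_nat scalerA mulVf// scale1r. Qed.

Lemma sketchH_dev : Hs - H = m%:R^-1 *: \sum_i zz_dev (s i).
Proof. by rewrite sumrB scalerBr mean_cst. Qed.

Lemma sketchg_dev : gs - g = m%:R^-1 *: \sum_i zu_dev (s i).
Proof. by rewrite sumrB scalerBr mean_cst. Qed.

(* The leading term of the normalized error of the sketched estimator. *)
Definition influence_sum : 'cV[R]_d := (Num.sqrt m%:R)^-1 *: \sum_i psi (s i).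

Let sqrtm : Num.sqrt m%:R * m%:R^-1 = (Num.sqrt m%:R)^-1 :> R.
Proof.
have q0 : Num.sqrt m%:R != 0 :> R by rewrite sqrtr_eq0 -ltNge ltr0n.
by rewrite -[X in _ / X]sqr_sqrtr ?ler0n// expr2 invfM mulrA divff// mul1r.
Qed.

(** [influence_eq] averaged over the rows leaves, up to scaling, the residual of [ridge] in the
    sketched normal equations. *)
Lemma influence_sum_eq :
  M *m influence_sum = Num.sqrt m%:R *: (gs - (Hs + lambda%:M) *m beta).
Proof.
rewrite /influence_sum -scalemxAr mulmx_sumr.
under eq_bigr do rewrite influence_eq.
rewrite (_ : gs - _ = (gs - g) - (Hs - H) *m beta); last first.
  rewrite -[X in _ = _ - X - _]ridge_eq !mulmxBl !mulmxDl.
  by apply/matrixP => i j; rewrite !mxE; ring.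
rewrite sketchH_dev sketchg_dev sumrB -mulmx_suml -scalemxAl -scalerBr scalerA.
by rewrite sqrtm.
Qed.

(** M S and Hs + lambda I applied to the normalized error are the same residual, so Hs + lambda I
    maps the difference to (Hs - H) S. Coercivity with c / 2 divides it back out. *)
Lemma sketch_error_dist : sqn (Hs - H) <= (c / 2) ^+ 2 ->
  sqn (influence_sum - Num.sqrt m%:R *: (betas - beta)) <=
    (c / 2) ^- 2 * (sqn (Hs - H) * sqn influence_sum).
Proof.
move=> Hc; have c2 : 0 < c / 2 by rewrite divr_gt0.
have cMs : coercive (c / 2) (Hs + lambda%:M).
  rewrite (_ : Hs + _ = M + (Hs - H)); first exact: coerciveD.
  by apply/matrixP => i j; rewrite !mxE; ring.
rewrite (le_trans (coercive_le _ c2 cMs))// ler_wpM2l ?invr_ge0 ?sqr_ge0//.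
rewrite mulmxBr -(scalemxAr _ _ (betas - beta)) mulmxBr.
rewrite [(Hs + lambda%:M) *m betas]mulKVmx ?(coercive_unit c2 cMs)//.
rewrite -influence_sum_eq -mulmxBl.
rewrite (_ : _ - M = Hs - H); first exact: sqn_mulmx.
by apply/matrixP => i j; rewrite !mxE; ring.
Qed.

Variable w : {ffun 'I_m -> nat}.
Hypothesis wm : (\sum_i w i = m)%N.

Local Notation Hb := (bootH X s w).
Local Notation gb := (bootg X y s w).
Local Notation betab := (boot_ridge X y lambda s w).

Let cw : \sum_i ((w i)%:R - 1) = 0 :> R.
Proof. by rewrite sumrB sumr_const card_ord -natr_sum wm subrr. Qed.

(** The centred weights sum to 0, so the products may be replaced by their deviations from H. *)
Lemma bootH_dev : Hb - Hs = m%:R^-1 *: \sum_i ((w i)%:R - 1) *: zz_dev (s i).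
Proof.
rewrite -scalerBr -sumrB; congr (_ *: _).
rewrite [RHS](eq_bigr (fun i => ((w i)%:R - 1) *: (zrow X (s i) *m (zrow X (s i))^T)
  - ((w i)%:R - 1) *: H)); last by move=> i _; rewrite scalerBr.
rewrite [RHS]sumrB -scaler_suml cw scale0r subr0; apply: eq_bigr => i _.
by rewrite scalerBl scale1r.
Qed.

Lemma bootg_dev : gb - gs = m%:R^-1 *: \sum_i ((w i)%:R - 1) *: zu_dev (s i).
Proof.
rewrite -scalerBr -sumrB; congr (_ *: _).
rewrite [RHS](eq_bigr (fun i => ((w i)%:R - 1) *: (urow y (s i) *: zrow X (s i))
  - ((w i)%:R - 1) *: g)); last by move=> i _; rewrite scalerBr.
rewrite [RHS]sumrB -scaler_suml cw scale0r subr0; apply: eq_bigr => i _.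
by rewrite scalerBl scale1r.
Qed.

(** The leading term of the normalized bootstrap error; under the uniform multinomial law its
    weights w i - 1 have mean 0. *)
Definition boot_influence_sum : 'cV[R]_d :=
  (Num.sqrt m%:R)^-1 *: \sum_i ((w i)%:R - 1) *: psi (s i).

Lemma boot_influence_sum_eq :
  M *m boot_influence_sum = Num.sqrt m%:R *: ((gb - gs) - (Hb - Hs) *m beta).
Proof.
rewrite /boot_influence_sum -scalemxAr mulmx_sumr.
under eq_bigr do rewrite -scalemxAr influence_eq scalerBr scalemxAl.
by rewrite bootH_dev bootg_dev sumrB -mulmx_suml -scalemxAl -scalerBr scalerA sqrtm.
Qed.

(** Hb + lambda I maps the difference to (Hb - H) b + (Hb - Hs) sqrt m (betas - beta), b being the
    leading term. The second term is the price of linearizing at [ridge] while the bootstrap is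
    centred at the sketched estimator. *)
Lemma boot_error_dist : sqn (Hs - H) <= (c / 2) ^+ 2 -> sqn (Hb - H) <= (c / 2) ^+ 2 ->
  sqn (boot_influence_sum - Num.sqrt m%:R *: (betab - betas)) <=
    (c / 2) ^- 2 * (2 * (sqn (Hb - H) * sqn boot_influence_sum)
       + 2 * (sqn (Hb - Hs) * sqn (Num.sqrt m%:R *: (betas - beta)))).
Proof.
move=> Hc Hbc; have c2 : 0 < c / 2 by rewrite divr_gt0.
have cMs : coercive (c / 2) (Hs + lambda%:M).
  rewrite (_ : Hs + _ = M + (Hs - H)); first exact: coerciveD.
  by apply/matrixP => i j; rewrite !mxE; ring.
have cMb : coercive (c / 2) (Hb + lambda%:M).
  rewrite (_ : Hb + _ = M + (Hb - H)); first exact: coerciveD.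
  by apply/matrixP => i j; rewrite !mxE; ring.
rewrite (le_trans (coercive_le _ c2 cMb))// ler_wpM2l ?invr_ge0 ?sqr_ge0//.
have Es : (Hs + lambda%:M) *m betas = gs.
  by rewrite mulKVmx ?(coercive_unit c2 cMs).
have Eb : (Hb + lambda%:M) *m betab = gb.
  by rewrite mulKVmx ?(coercive_unit c2 cMb).
rewrite (_ : _ *m _ = (Hb - H) *m boot_influence_sum
    + (Hb - Hs) *m (Num.sqrt m%:R *: (betas - beta))).
  by rewrite (le_trans (sqnD_le _ _))// lerD// ler_wpM2l// sqn_mulmx.
have E := boot_influence_sum_eq.
rewrite mulmxBr -(scalemxAr _ _ (betab - betas)) -(scalemxAr _ _ (betas - beta)) !mulmxBr Eb.
rewrite (_ : (Hb + lambda%:M) *m boot_influence_sum =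
   (Hb - H) *m boot_influence_sum + M *m boot_influence_sum); last first.
  by rewrite -mulmxDl; congr (_ *m _); apply/matrixP => i j; rewrite !mxE; ring.
rewrite E -addrA -scalerBr; congr (_ + _ *: _).
rewrite -Es !mulmxBl !mulmxDl.
by apply/matrixP => i j; rewrite !mxE; ring.
Qed.

End sketch_algebra.

(** * Quantitative central limit bounds for cosines *)

Section cosine_limit.
Variables (R : realType) (m : nat).
Hypothesis m0 : (0 < m)%N.

Local Notation rm := (Num.sqrt m%:R : R).

Let mr0 : 0 < m%:R :> R. Proof. by rewrite ltr0n. Qed.
Let rm0 : 0 < rm. Proof. by rewrite sqrtr_gt0. Qed.
Let rm2 : rm ^+ 2 = m%:R. Proof. by rewrite sqr_sqrtr// ltW. Qed.
Let rm1 : 1 <= rm.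
Proof. by rewrite -[leLHS](sqrtr1 R) ler_sqrt ?ler1n// ltW. Qed.

(** The reason for the one-step target exp (- s / (2 m)): its m-th power is exactly the Gaussian
    value. *)
Lemma expR_pow_limit (s : R) : expR (- (s / (2 * m%:R))) ^+ m = expR (- s / 2).
Proof. by rewrite -expRM_natl; congr expR; field; rewrite gt_eqF. Qed.

(** [al] and [be] stand for the mean cosine and sine of one summand of variance sn / m; m steps cost
    m times the one-step error. The remainders k1 / m and s^2 / m are weakened to order 1 / sqrt m,
    since 1 <= sqrt m. *)
Lemma cosine_limit_numeric (sn s k1 k2 al be : R) : 0 <= s -> 0 <= k1 -> 0 <= k2 ->
  `|al - (1 - sn / (2 * m%:R))| <= k1 / m%:R ^+ 2 -> `|be| <= k2 / (m%:R * rm) ->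
  m%:R * (`|al - expR (- (s / (2 * m%:R)))| + `|be|) <=
    `|sn - s| / 2 + (k1 + k2 + s ^+ 2) / rm.
Proof.
move=> s0 k10 k20 hal hbe.
have s1 : 0 <= s / (2 * m%:R) by rewrite divr_ge0// mulr_ge0// ltW.
have hl := norm_expRB_le s1.
have h1 : `|al - expR (- (s / (2 * m%:R)))| <=
    k1 / m%:R ^+ 2 + `|sn - s| / (2 * m%:R) + s ^+ 2 / m%:R ^+ 2.
  rewrite (_ : al - _ = (al - (1 - sn / (2 * m%:R)) - (sn - s) / (2 * m%:R))
     - (expR (- (s / (2 * m%:R))) - (1 - s / (2 * m%:R)))); last by ring.
  rewrite (le_trans (ler_normB _ _))// lerD//.
    rewrite (le_trans (ler_normB _ _))// lerD//.
    by rewrite normrM (@ger0_norm _ (_^-1))// invr_ge0 mulr_ge0// ltW.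
  rewrite (le_trans hl)// exprMn ler_wpM2l ?sqr_ge0//.
  rewrite -exprVn ler_sqr ?nnegrE ?invr_ge0 ?mulr_ge0 ?(ltW mr0)//.
  by rewrite lef_pV2 ?posrE ?mulr_gt0// ler_peMl ?(ltW mr0)// ler1n.
apply: (@le_trans _ _ (m%:R * (k1 / m%:R ^+ 2 + `|sn - s| / (2 * m%:R) + s ^+ 2 / m%:R ^+ 2
    + k2 / (m%:R * rm)))).
  by rewrite ler_wpM2l ?(ltW mr0)// lerD.
have -> : m%:R * (k1 / m%:R ^+ 2 + `|sn - s| / (2 * m%:R) + s ^+ 2 / m%:R ^+ 2
    + k2 / (m%:R * rm)) = `|sn - s| / 2 + ((k1 + s ^+ 2) / rm ^+ 2 + k2 / rm).
  by rewrite rm2; field; rewrite !gt_eqF.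
rewrite lerD2l (_ : (k1 + k2 + s ^+ 2) / rm = (k1 + s ^+ 2) / rm + k2 / rm); last by ring.
rewrite lerD2r ler_wpM2l ?addr_ge0 ?sqr_ge0//.
by rewrite lef_pV2 ?posrE ?exprn_gt0// expr2 ler_peMl// ltW.
Qed.

(** Trades the cubic remainder of the sine for second and fourth moments, which are the ones
    available. *)
Lemma norm3_le (v : R) : `|v| ^+ 3 <= v ^+ 2 + v ^+ 4.
Proof.
rewrite -(real_normK (num_real v)) (_ : v ^+ 4 = `|v| ^+ 4); last first.
  by rewrite (exprM v 2 2) -(real_normK (num_real v)) -exprM.
by have := normr_ge0 v; have := sqr_ge0 (`|v| - 1); set a := `|v|; nra.
Qed.

Lemma sin_scaled_le (v : R) : `|sin (v / rm) - v / rm| <= (v ^+ 2 + v ^+ 4) / (6 * (m%:R * rm)).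
Proof.
rewrite (le_trans (norm_sinB_le _))// normrM (@ger0_norm _ (rm^-1)) ?invr_ge0 ?(ltW rm0)//.
rewrite exprMn [leLHS](_ : _ = `|v| ^+ 3 / (6 * (rm ^+ 2 * rm))).
  by rewrite rm2 ler_wpM2r ?norm3_le// invr_ge0 !mulr_ge0 ?(ltW rm0)// ltW.
by field; rewrite gt_eqF.
Qed.

Lemma cos_scaled_le (v : R) :
  `|cos (v / rm) - (1 - v ^+ 2 / (2 * m%:R))| <= v ^+ 4 / m%:R ^+ 2.
Proof.
have := norm_cosB_le (v / rm).
rewrite (_ : (v / rm) ^+ 2 / 2 = v ^+ 2 / (2 * m%:R)); last by rewrite -[in RHS]rm2; field; rewrite gt_eqF.
move=> /le_trans; apply.
rewrite (_ : (v / rm) ^+ 4 = v ^+ 4 / m%:R ^+ 2); last by rewrite -[in RHS]rm2; field; rewrite gt_eqF.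
rewrite ler_pdivrMr// ler_peMr ?ler1n//.
by rewrite divr_ge0 ?sqr_ge0// (exprM v 2 2) sqr_ge0.
Qed.

Section bootstrap_weights.
Variable v : 'I_m -> R.

Local Notation p := (fun _ : 'I_m => m%:R^-1 : R).

Let p1 := uniform_weights_sum R m0.
Let p0 := @uniform_weights_ge0 R m.

Let vb := (m%:R^-1 * \sum_(i < m) v i).
Let a i := v i - vb.

Let suma : \sum_i p i * a i = 0.
Proof. by rewrite -mulr_sumr sumrB sumr_const card_ord -[vb *+ m]mulr_natl mulrBr mulKf ?gt_eqF// subrr. Qed.

(** Since the counts sum to m, centring the weights amounts to centring the values at their average
    [vb]. *)
Let centered (k : {ffun 'I_m -> nat}) : (\sum_i k i = m)%N -> \sum_i ((k i)%:R - 1) * v i = lincount a k.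
Proof.
move=> km; rewrite /lincount [RHS](eq_bigr (fun i => (k i)%:R * v i - (k i)%:R * vb)); last first.
  by move=> i _; rewrite mulrBr.
rewrite [RHS]sumrB -mulr_suml -natr_sum km /vb mulVKf ?gt_eqF//.
by rewrite -sumrB; apply: eq_bigr => i _; rewrite mulrBl mul1r.
Qed.

Let avg_sqr : (m%:R^-1 * \sum_(i < m) (a i ^+ 2)) = (m%:R^-1 * \sum_(i < m) (v i ^+ 2)) - vb ^+ 2.
Proof.
rewrite (eq_bigr (fun i => v i ^+ 2 - 2 * vb * v i + vb ^+ 2)); last by move=> i _; rewrite /a; ring.
rewrite big_split/= sumrB sumr_const card_ord -[vb ^+ 2 *+ m]mulr_natl -mulr_sumr.
rewrite mulrDr mulrBr mulKf ?gt_eqF// (mulrCA _ (2 * vb)) -/vb; ring.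
Qed.

(** The variance of m draws is m times the average of v^2 minus vb^2, that is, the right side less m
    vb^2. *)
Lemma bootstrap_sqr : multinomial_mean p m (fun k => (\sum_i ((k i)%:R - 1) * v i) ^+ 2)
  <= \sum_i v i ^+ 2.
Proof.
rewrite (@eq_multinomial_mean _ _ _ _ _ (fun k => lincount a k ^+ 2)); last first.
  by move=> k km; rewrite centered.
rewrite multinomial_mean_sqr// -mulr_sumr avg_sqr mulrBr mulVKf ?gt_eqF//.
by rewrite lerBlDr lerDl mulr_ge0 ?sqr_ge0// ltW.
Qed.

(** Jensen twice: vb^2 is at most the average of v^2, whose square is at most the average of v^4. *)
Let vb4 : vb ^+ 4 <= (m%:R^-1 * \sum_(i < m) (v i ^+ 4)).
Proof.
have h1 : vb ^+ 2 <= (m%:R^-1 * \sum_(i < m) (v i ^+ 2)).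
  have : 0 <= (m%:R^-1 * \sum_(i < m) (a i ^+ 2)).
    by rewrite mulr_ge0 ?invr_ge0 ?(ltW mr0)// sumr_ge0// => i _; exact: sqr_ge0.
  by rewrite avg_sqr subr_ge0.
have h2 : ((m%:R^-1 * \sum_(i < m) (v i ^+ 2))) ^+ 2 <= (m%:R^-1 * \sum_(i < m) (v i ^+ 4)).
  set t := (m%:R^-1 * \sum_(i < m) (v i ^+ 2)).
  have : 0 <= (m%:R^-1 * \sum_(i < m) ((v i ^+ 2 - t) ^+ 2)).
    by rewrite mulr_ge0 ?invr_ge0 ?(ltW mr0)// sumr_ge0// => i _; exact: sqr_ge0.
  rewrite (eq_bigr (fun i => v i ^+ 4 - 2 * t * v i ^+ 2 + t ^+ 2)); last by move=> i _; ring.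
  rewrite big_split/= sumrB sumr_const card_ord -[t ^+ 2 *+ m]mulr_natl -mulr_sumr.
  rewrite mulrDr mulrBr mulKf ?gt_eqF// (mulrCA _ (2 * t)) -/t; nra.
rewrite (exprM vb 2 2) (le_trans _ h2)// ler_sqr ?nnegrE ?sqr_ge0//.
by rewrite (le_trans _ h1) ?sqr_ge0.
Qed.

(** The m draws act as independent summands a i / sqrt m of mean 0. The bound is explicit in the
    empirical moments of v so that it can later be integrated over the sketch. *)
Lemma bootstrap_cos (c s : R) : 0 <= s ->
  `|multinomial_mean p m (fun k => cos (c + rm^-1 * \sum_i ((k i)%:R - 1) * v i))
    - expR (- s / 2) * cos c| <=
  (`|(m%:R^-1 * \sum_(i < m) (v i ^+ 2)) - s| + vb ^+ 2) / 2 + (1 + 20 * (m%:R^-1 * \sum_(i < m) (v i ^+ 4)) + s ^+ 2) / rm.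
Proof.
move=> s0.
rewrite (@eq_multinomial_mean _ _ _ _ _ (fun k => cos (c + lincount (fun i => a i / rm) k))); last first.
  move=> k km; rewrite centered// /lincount mulr_sumr; congr (cos (c + _)).
  by apply: eq_bigr => i _; rewrite mulrCA mulrC (mulrC rm^-1) mulrC.
rewrite -expR_pow_limit.
have l01 : 0 <= expR (- (s / (2 * m%:R))) <= 1.
  by rewrite expR_ge0 -[leRHS]expR0 ler_expR oppr_le0 divr_ge0.
apply: (le_trans (multinomial_mean_cos_close p1 p0 _ _ _ l01)).
set P4 := (m%:R^-1 * \sum_(i < m) (v i ^+ 4)).
have P40 : 0 <= P4.
  rewrite mulr_ge0 ?invr_ge0 ?(ltW mr0)// sumr_ge0// => i _.
  by rewrite (exprM _ 2 2) sqr_ge0.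
(* 16 = 8 + 8: (v - vb)^4 <= 8 (v^4 + vb^4), and [vb4] bounds vb^4 by P4. *)
have A4 : (m%:R^-1 * \sum_(i < m) (a i ^+ 4)) <= 16 * P4.
  apply: (@le_trans _ _ ((m%:R^-1 * \sum_(i < m) (8 * (v i ^+ 4 + vb ^+ 4))))).
    rewrite ler_wpM2l ?invr_ge0 ?(ltW mr0)//; apply: ler_sum => i _; rewrite /a.
    have h1 : (v i - vb) ^+ 2 <= 2 * (v i ^+ 2 + vb ^+ 2).
      by have := sqr_ge0 (v i + vb); nra.
    have h2 : (v i - vb) ^+ 4 <= (2 * (v i ^+ 2 + vb ^+ 2)) ^+ 2.
      rewrite (exprM _ 2 2) ler_sqr ?nnegrE ?sqr_ge0//.
      by rewrite mulr_ge0// addr_ge0 ?sqr_ge0.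
    by apply: (le_trans h2); have := sqr_ge0 (v i ^+ 2 - vb ^+ 2); lra.
  rewrite -mulr_sumr big_split/= sumr_const card_ord -[vb ^+ 4 *+ m]mulr_natl.
  rewrite mulrCA mulrDr mulKf ?gt_eqF// -/P4.
  by have := vb4; rewrite -/P4; lra.
have A2 : (m%:R^-1 * \sum_(i < m) (a i ^+ 2)) <= 1 + P4.
  rewrite avg_sqr; apply: (@le_trans _ _ ((m%:R^-1 * \sum_(i < m) (v i ^+ 2)))).
    by rewrite lerBlDr lerDl sqr_ge0.
  apply: (@le_trans _ _ ((m%:R^-1 * \sum_(i < m) (1 + v i ^+ 4)))).
    rewrite ler_wpM2l ?invr_ge0 ?(ltW mr0)//; apply: ler_sum => i _.
    by have := sqr_ge0 (v i ^+ 2 - 1); have := sqr_ge0 (v i); nra.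
  by rewrite big_split/= sumr_const card_ord mulrDr mulVf ?gt_eqF.
have hal : `|\sum_i p i * cos (a i / rm) - (1 - (m%:R^-1 * \sum_(i < m) (a i ^+ 2)) / (2 * m%:R))| <=
    (16 * P4) / m%:R ^+ 2.
  have -> : 1 - (m%:R^-1 * \sum_(i < m) (a i ^+ 2)) / (2 * m%:R) = \sum_i p i * (1 - a i ^+ 2 / (2 * m%:R)).
    under [RHS]eq_bigr do rewrite mulrBr mulr1.
    rewrite sumrB p1; congr (_ - _).
    by rewrite -mulr_sumr -mulr_suml mulrA.
  rewrite -sumrB (le_trans (ler_norm_sum _ _ _))//.
  apply: (@le_trans _ _ (\sum_i p i * (a i ^+ 4 / m%:R ^+ 2))).
    apply: ler_sum => i _; rewrite -mulrBr normrM ger0_norm// ler_wpM2l//.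
    exact: cos_scaled_le.
  by rewrite -mulr_sumr -mulr_suml mulrA ler_wpM2r// invr_ge0 exprn_ge0// ltW.
have hbe : `|\sum_i p i * sin (a i / rm)| <= (1 + 17 * P4) / (6 * (m%:R * rm)).
  have -> : \sum_i p i * sin (a i / rm) = \sum_i p i * (sin (a i / rm) - a i / rm).
    under [RHS]eq_bigr do rewrite mulrBr.
    rewrite sumrB -[LHS]subr0; congr (_ - _).
    under eq_bigr do rewrite mulrA.
    by rewrite -mulr_suml suma mul0r.
  rewrite (le_trans (ler_norm_sum _ _ _))//.
  apply: (@le_trans _ _ (\sum_i p i * ((a i ^+ 2 + a i ^+ 4) / (6 * (m%:R * rm))))).
    apply: ler_sum => i _; rewrite normrM ger0_norm// ler_wpM2l//.
    exact: sin_scaled_le.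
  rewrite -mulr_sumr -mulr_suml mulrA ler_wpM2r ?invr_ge0 ?mulr_ge0 ?(ltW mr0) ?(ltW rm0)//.
  by rewrite big_split/= mulrDr; lra.
have hbe' : `|\sum_i p i * sin (a i / rm)| <= ((1 + 17 * P4) / 6) / (m%:R * rm).
  by rewrite -mulrA -invfM.
have k1 : 0 <= 16 * P4 by rewrite mulr_ge0.
have k2 : 0 <= (1 + 17 * P4) / 6 by lra.
apply: (le_trans (cosine_limit_numeric s0 k1 k2 hal hbe')); apply: lerD.
  rewrite ler_wpM2r// avg_sqr.
  rewrite (_ : _ - _ - _ = ((m%:R^-1 * \sum_(i < m) (v i ^+ 2)) - s) - vb ^+ 2); last by ring.
  by rewrite (le_trans (ler_normB _ _))// (ger0_norm (sqr_ge0 vb)).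
(* 16 P4 + (1 + 17 P4) / 6 is at most 1 + 20 P4. *)
by rewrite ler_wpM2r ?invr_ge0 ?(ltW rm0)//; lra.
Qed.

End bootstrap_weights.
End cosine_limit.

(** * Cosines of i.i.d. sums *)

Section independent_cosines.
Context dT (T : measurableType dT) (R : realType) (P : probability T R).

Lemma mutually_independent_comp dE dE' (E : measurableType dE) (E' : measurableType dE')
    (I : finType) (Y : I -> T -> E) (f : I -> E -> E') :
  (forall i, measurable_fun setT (f i)) -> mutually_independent P Y ->
  mutually_independent P (fun i t => f i (Y i t)).
Proof.
move=> mf ind J B mB.
by apply: (ind J (fun i => f i @^-1` B i)) => i; exact: measurable_preim.
Qed.

Variables (m : nat) (V : 'I_m -> T -> R).
Hypothesis m0 : (0 < m)%N.
Hypothesis mV : forall i, measurable_fun setT (V i).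
Hypothesis ind : mutually_independent P V.

Local Notation rm := (Num.sqrt m%:R : R).

(** The m-step recursion for the summands V i / sqrt m. Since sn <= 1 + k, the sine remainder is at
    most (1 + 2 k) / 6, and k + (1 + 2 k) / 6 <= 1 + 2 k. *)
Lemma iid_cos (c s sn k : R) : 0 <= s ->
  (forall i, P.-integrable setT (EFin \o (fun t => V i t ^+ 4))) ->
  (forall i, \int[P]_t V i t = 0) -> (forall i, \int[P]_t (V i t ^+ 2) = sn) ->
  (forall i, \int[P]_t (V i t ^+ 4) <= k) ->
  `|\int[P]_t cos (c + rm^-1 * \sum_i V i t) - expR (- s / 2) * cos c| <=
    `|sn - s| / 2 + (1 + 2 * k + s ^+ 2) / rm.
Proof.
move=> s0 iV4 V0 V2 V4.
have mr0 : 0 < m%:R :> R by rewrite ltr0n.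
have rm0 : 0 < rm by rewrite sqrtr_gt0.
have iV2 i : P.-integrable setT (EFin \o (fun t => V i t ^+ 2)).
  apply: sqr_integrable; first exact: measurable_funX.
  by under eq_fun do rewrite -exprM.
have iV i : P.-integrable setT (EFin \o V i) by exact: sqr_integrable.
pose i0 : 'I_m := Ordinal m0.
have k0 : 0 <= k.
  apply: le_trans (V4 i0); apply: Rintegral_ge0 => t _.
  by rewrite (exprM _ 2 2) sqr_ge0.
have sn0 : 0 <= sn by rewrite -(V2 i0) Rintegral_ge0// => t _; exact: sqr_ge0.
have snk : sn <= 1 + k.
  rewrite -(V2 i0) (le_trans _ (lerD (lexx 1) (V4 i0)))//.
  rewrite -[X in _ <= X + _](Rintegral_cstP P 1) -RintegralD//; last exact: integrable_cstR.
  apply: le_Rintegral => //; first by apply: integrableDR => //; exact: integrable_cstR.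
  by move=> t _; have := sqr_ge0 (V i0 t ^+ 2 - 1); have := sqr_ge0 (V i0 t); nra.
pose W i t := V i t / rm.
have mW i : measurable_fun setT (W i) by exact: measurable_funM.
have indW : mutually_independent P W.
  apply: (@mutually_independent_comp _ _ _ _ _ V (fun _ x => x / rm)) => // i.
  exact: measurable_funM.
have icosW i : P.-integrable setT (EFin \o (fun t => cos (W i t))).
  apply: (@bounded_integrable _ _ _ _ _ 1); first exact: measurable_cos_comp.
  by move=> t; exact: norm_cos_le1.
have isinW i : P.-integrable setT (EFin \o (fun t => sin (W i t))).
  apply: (@bounded_integrable _ _ _ _ _ 1); first exact: measurable_sin_comp.
  by move=> t; exact: norm_sin_le1.
have hal i : `|\int[P]_t cos (W i t) - (1 - sn / (2 * m%:R))| <= k / m%:R ^+ 2.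
  have i2 : P.-integrable setT (EFin \o (fun t => (2 * m%:R)^-1 * V i t ^+ 2)).
    exact: integrableZR.
  have -> : 1 - sn / (2 * m%:R) = \int[P]_t (1 - (2 * m%:R)^-1 * V i t ^+ 2).
    by rewrite RintegralB// ?RintegralZl// ?V2 ?Rintegral_cstP 1?mulrC//; exact: integrable_cstR.
  have i1 : P.-integrable setT (EFin \o (fun t => 1 - (2 * m%:R)^-1 * V i t ^+ 2)).
    by apply: integrableBR => //; exact: integrable_cstR.
  rewrite -RintegralB// (le_trans (le_normr_Rintegral _ _))//; first exact: integrableBR.
  apply: (@le_trans _ _ (\int[P]_t ((m%:R ^+ 2)^-1 * V i t ^+ 4))).
    apply: le_Rintegral => //.
    - by apply: integrable_norm; exact: integrableBR.
    - exact: integrableZR.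
    - move=> t _; rewrite /W [(2 * _)^-1 * _]mulrC [leRHS]mulrC; exact: cos_scaled_le.
  by rewrite RintegralZl// mulrC ler_wpM2r// invr_ge0 sqr_ge0.
have hbe i : `|\int[P]_t sin (W i t)| <= ((1 + 2 * k) / 6) / (m%:R * rm).
  have iW : P.-integrable setT (EFin \o W i).
    by rewrite /W; under eq_fun do rewrite mulrC; exact: integrableZR.
  have -> : \int[P]_t sin (W i t) = \int[P]_t (sin (W i t) - W i t).
    rewrite RintegralB// /W.
    under [X in _ = _ - X]eq_Rintegral do rewrite mulrC.
    by rewrite RintegralZl// V0 mulr0 subr0.
  rewrite (le_trans (le_normr_Rintegral _ _))//; first exact: integrableBR.
  apply: (@le_trans _ _ (\int[P]_t ((6 * (m%:R * rm))^-1 * (V i t ^+ 2 + V i t ^+ 4)))).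
    apply: le_Rintegral => //.
    - by apply: integrable_norm; exact: integrableBR.
    - by apply: integrableZR; exact: integrableDR.
    - by move=> t _; rewrite [leRHS]mulrC; exact: sin_scaled_le.
  rewrite RintegralZl//; last exact: integrableDR.
  rewrite RintegralD// V2 mulrC -mulrA -invfM ler_wpM2r ?invr_ge0 ?mulr_ge0 ?(ltW rm0)//.
  by have := V4 i; lra.
pose e := m%:R^-1 * (`|sn - s| / 2 + (1 + 2 * k + s ^+ 2) / rm).
have he i : `|\int[P]_t cos (W i t) - expR (- (s / (2 * m%:R)))| + `|\int[P]_t sin (W i t)| <= e.
  rewrite /e -(ler_pM2l mr0) mulVKf ?gt_eqF//.
  have k6 : 0 <= (1 + 2 * k) / 6 by lra.
  apply: (le_trans (cosine_limit_numeric m0 s0 k0 k6 (hal i) (hbe i))).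
  by rewrite lerD2l ler_wpM2r ?invr_ge0 ?(ltW rm0)//; lra.
have l01 : 0 <= expR (- (s / (2 * m%:R))) <= 1.
  by rewrite expR_ge0 -[leRHS]expR0 ler_expR oppr_le0 divr_ge0.
have Fle1 (r : seq 'I_m) c' : `|\int[P]_t cos (c' + \sum_(i <- r) W i t)| <= 1.
  apply: Rintegral_norm_le => [|t]; last exact: norm_cos_le1.
  by apply: measurable_cos_comp; apply: measurable_funD => //; exact: measurable_sum.
have main (r : seq 'I_m) c' : uniq r -> `|\int[P]_t cos (c' + \sum_(i <- r) W i t)
    - expR (- (s / (2 * m%:R))) ^+ size r * cos c'| <= (size r)%:R * e.
  elim: r c' => [|i r IH] c' /=.
    move=> _; under eq_Rintegral do rewrite big_nil addr0.
    by rewrite Rintegral_cstP expr0 mul1r subrr normr0 mul0r.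
  move=> ur; rewrite (indep_cos_sum_cons mW indW)//.
  by apply: cos_recursion_step => //; apply: IH; case/andP: ur.
have := main (index_enum 'I_m) c (index_enum_uniq _).
rewrite (_ : size _ = m); last by rewrite -sum1_size big_const_ord iter_addn_0 mul1n.
rewrite expR_pow_limit// /e mulVKf ?gt_eqF// => h.
rewrite (le_trans _ h)// le_eqVlt; apply/orP; left; apply/eqP.
congr (`|_ - _|); apply: eq_Rintegral => t _.
by congr (cos (c + _)); rewrite mulr_sumr; apply: eq_bigr => i _; rewrite mulrC.
Qed.

End independent_cosines.

(** * Identically distributed and isotropic rows *)

Section identically_distributed.
Context dT (T : measurableType dT) dE (E : measurableType dE) (R : realType)
  (P : probability T R) (I : finType) (Y : I -> {RV P >-> E}).
Hypothesis ident : identically_distributed P (fun i => Y i : T -> E).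

Let distE i j (A : set E) : measurable A -> distribution P (Y i) A = distribution P (Y j) A.
Proof. by move=> mA; exact: ident. Qed.

Lemma ident_integral_ge0 (f : E -> \bar R) i j : measurable_fun setT f ->
  (forall x, 0 <= f x)%E -> (\int[P]_t f (Y i t) = \int[P]_t f (Y j t))%E.
Proof.
move=> mf f0; have := ge0_integral_distribution (Y i) mf f0.
have := ge0_integral_distribution (Y j) mf f0.
rewrite /comp => <- <-; apply: eq_measure_integral => A mA _; exact: distE.
Qed.

Lemma ident_integrable (f : E -> R) i j : measurable_fun setT f ->
  P.-integrable setT (EFin \o (fun t => f (Y i t))) ->
  P.-integrable setT (EFin \o (fun t => f (Y j t))).
Proof.
move=> mf /integrableP[_ fi]; apply/integrableP; split.
  by apply/measurable_EFinP; exact: measurableT_comp.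
rewrite (le_lt_trans _ fi)//.
rewrite (ident_integral_ge0 (f := fun x => `|(f x)%:E|%E) j i)//.
by apply: measurableT_comp => //; exact/measurable_EFinP.
Qed.

Lemma ident_Rintegral (f : E -> R) i j : measurable_fun setT f ->
  P.-integrable setT (EFin \o (fun t => f (Y i t))) ->
  \int[P]_t f (Y j t) = \int[P]_t f (Y i t).
Proof.
move=> mf fi; have fj := ident_integrable j mf fi.
have mf' : measurable_fun setT (EFin \o f) by exact/measurable_EFinP.
rewrite /Rintegral; congr fine.
have := @integral_distribution _ _ _ _ _ P (Y i) _ mf' fi.
have := @integral_distribution _ _ _ _ _ P (Y j) _ mf' fj.
rewrite /comp => <- <-; apply: eq_measure_integral => A mA _; exact: distE.
Qed.

End identically_distributed.

Section isotropic_vectors.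
Context dT (T : measurableType dT) (R : realType) (P : probability T R) (n : nat)
  (s : {RV P >-> borelV R n}).
Hypothesis iso : mx_expectation P (fun t => (s t : 'cV[R]_n) *m (s t : 'cV[R]_n)^T) = 1%:M.

Local Notation s_ k := (fun t => (s t : 'cV[R]_n) k 0).

Let ms k : measurable_fun setT (s_ k).
Proof. exact: (measurableT_comp (measurable_coord k)). Qed.

Let fineE k l : fine (\int[P]_t (s_ k t * s_ l t)%:E)%E = (k == l)%:R.
Proof.
have := congr1 (fun A : 'M[R]_n => A k l) iso.
rewrite mxE [RHS]mxE unlock => <-; congr fine; apply: eq_integral => t _.
by rewrite mxE big_ord1 mxE.
Qed.

(** [fine] sends an infinite expectation to 0, whereas the diagonal entries of the second moment
    matrix are 1; so they come from finite expectations. *)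
Let i2 k : P.-integrable setT (EFin \o (fun t => s_ k t ^+ 2)).
Proof.
apply/integrableP; split; first by apply/measurable_EFinP; exact: measurable_funX.
under eq_integral do rewrite /= ger0_norm ?sqr_ge0// expr2.
rewrite ltNge leye_eq; apply/negP => /eqP E; have := fineE k k; rewrite E eqxx /=.
by move/eqP; rewrite eq_sym oner_eq0.
Qed.

Let ikl k l : P.-integrable setT (EFin \o (fun t => s_ k t * s_ l t)).
Proof.
apply: (le_integrableR _ _ (integrableDR (i2 k) (i2 l))); first exact: measurable_funM.
move=> t; rewrite normrM -(real_normK (num_real (s_ k t))) -(real_normK (num_real (s_ l t))).
have := normr_ge0 (s_ k t); have := normr_ge0 (s_ l t).
set a := `|_|; set b := `|_| => a0 b0.
by have := sqr_ge0 (a - b); have := mulr_ge0 a0 b0; nra.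
Qed.

Lemma isotropic_dot (p q : 'cV[R]_n) :
  P.-integrable setT (EFin \o (fun t => dot p (s t : 'cV[R]_n) * dot q (s t : 'cV[R]_n))) /\
  \int[P]_t (dot p (s t : 'cV[R]_n) * dot q (s t : 'cV[R]_n)) = dot p q.
Proof.
have E t : dot p (s t : 'cV[R]_n) * dot q (s t : 'cV[R]_n) =
    \sum_k \sum_l (p k 0 * q l 0) * (s_ k t * s_ l t).
  rewrite /dot mulr_suml; apply: eq_bigr => k _; rewrite mulr_sumr; apply: eq_bigr => l _.
  by rewrite mulrACA.
have iE k l : P.-integrable setT (EFin \o (fun t => (p k 0 * q l 0) * (s_ k t * s_ l t))).
  exact: integrableZR.
split.
  by under eq_fun do rewrite E; do 2 apply: integrable_sumR => ?.
under eq_Rintegral do rewrite E.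
rewrite Rintegral_sum; last by move=> k; exact: integrable_sumR.
apply: eq_bigr => k _; rewrite Rintegral_sum// (bigD1 k)//= RintegralZl//.
rewrite {1}/Rintegral fineE eqxx mulr1 big1 ?addr0// => l lk.
by rewrite RintegralZl// {1}/Rintegral fineE eq_sym (negbTE lk) mulr0.
Qed.

Lemma zrowE d (X : 'M[R]_(n, d)) (v : 'cV[R]_n) a :
  zrow X v a 0 = (Num.sqrt n%:R)^-1 * dot (col a X) v.
Proof. by rewrite !mxE; congr (_ * _); apply: eq_bigr => k _; rewrite !mxE. Qed.

Lemma urowE (y v : 'cV[R]_n) : urow y v = (Num.sqrt n%:R)^-1 * dot y v.
Proof. by rewrite /urow mxE; congr (_ * _); apply: eq_bigr => k _; rewrite mxE. Qed.

Let sqn1 : (Num.sqrt n%:R)^-1 * (Num.sqrt n%:R)^-1 = n%:R^-1 :> R.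
Proof. by rewrite -invfM -expr2 sqr_sqrtr ?ler0n. Qed.

Lemma zz_dev_mean0 d (X : 'M[R]_(n, d)) a b :
  P.-integrable setT (EFin \o (fun t => zz_dev X (s t) a b)) /\
  \int[P]_t zz_dev X (s t) a b = 0.
Proof.
have [iD ID] := isotropic_dot (col a X) (col b X).
have E t : zz_dev X (s t) a b = n%:R^-1 *
    (dot (col a X) (s t : 'cV[R]_n) * dot (col b X) (s t : 'cV[R]_n)) - gramH X a b.
  by rewrite mxE [in LHS]mxE big_ord1 [X in _ * X]mxE !zrowE mulrACA sqn1 [X in _ + X]mxE.
split.
  under eq_fun do rewrite E.
  by apply: integrableBR; [exact: integrableZR|exact: integrable_cstR].
under eq_Rintegral do rewrite E.
rewrite RintegralB//; [|exact: integrableZR|exact: integrable_cstR].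
rewrite RintegralZl// ID Rintegral_cstP !mxE; apply/eqP; rewrite subr_eq0; apply/eqP.
by congr (_ * _); apply: eq_bigr => k _; rewrite !mxE.
Qed.

Lemma zu_dev_mean0 d (X : 'M[R]_(n, d)) y a :
  P.-integrable setT (EFin \o (fun t => zu_dev X y (s t) a 0)) /\
  \int[P]_t zu_dev X y (s t) a 0 = 0.
Proof.
have [iD ID] := isotropic_dot (col a X) y.
have E t : zu_dev X y (s t) a 0 = n%:R^-1 *
    (dot (col a X) (s t : 'cV[R]_n) * dot y (s t : 'cV[R]_n)) - crossg X y a 0.
  rewrite mxE [in LHS]mxE zrowE urowE [X in _ + X]mxE -sqn1; congr (_ - _); ring.
split.
  under eq_fun do rewrite E.
  by apply: integrableBR; [exact: integrableZR|exact: integrable_cstR].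
under eq_Rintegral do rewrite E.
rewrite RintegralB//; [|exact: integrableZR|exact: integrable_cstR].
rewrite RintegralZl// ID Rintegral_cstP !mxE; apply/eqP; rewrite subr_eq0; apply/eqP.
by congr (_ * _); apply: eq_bigr => k _; rewrite !mxE.
Qed.

End isotropic_vectors.

(** * Measurability of the row statistics *)

Section row_measurability.
Context (R : realType) (n d : nat) (X : 'M[R]_(n, d)) (y : 'cV[R]_n) (lambda : R).
Context dT (T : measurableType dT).
Variable v : T -> 'cV[R]_n.
Hypothesis mv : mx_measurable v.

Lemma measurable_zrow : mx_measurable (fun t => zrow X (v t)).
Proof.
apply: mx_measurableZ; first exact: measurable_cst.
by apply: mx_measurableM => //; exact: mx_measurable_cst.
Qed.

Lemma measurable_urow : measurable_fun setT (fun t => urow y (v t)).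
Proof.
apply: measurable_funM; first exact: measurable_cst.
have : mx_measurable (fun t => y^T *m v t) by apply: mx_measurableM => //; exact: mx_measurable_cst.
exact.
Qed.

Lemma measurable_zz : mx_measurable (fun t => zrow X (v t) *m (zrow X (v t))^T).
Proof. by apply: mx_measurableM; [|apply: mx_measurable_tr]; exact: measurable_zrow. Qed.

Lemma measurable_zu : mx_measurable (fun t => urow y (v t) *: zrow X (v t)).
Proof. by apply: mx_measurableZ; [exact: measurable_urow|exact: measurable_zrow]. Qed.

Lemma measurable_zz_dev : mx_measurable (fun t => zz_dev X (v t)).
Proof. by apply: mx_measurableB; [exact: measurable_zz|exact: mx_measurable_cst]. Qed.

Lemma measurable_zu_dev : mx_measurable (fun t => zu_dev X y (v t)).
Proof. by apply: mx_measurableB; [exact: measurable_zu|exact: mx_measurable_cst]. Qed.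

Lemma measurable_influence : mx_measurable (fun t => influence X y lambda (v t)).
Proof.
apply: mx_measurableM; first exact: mx_measurable_cst.
apply: mx_measurableB; last exact: mx_measurable_cst.
apply: mx_measurableZ; last exact: measurable_zrow.
apply: measurable_funB; first exact: measurable_urow.
have : mx_measurable (fun t => (zrow X (v t))^T *m ridge X y lambda).
  by apply: mx_measurableM; [apply: mx_measurable_tr; exact: measurable_zrow|exact: mx_measurable_cst].
exact.
Qed.

Lemma measurable_row_dev : measurable_fun setT (fun t => row_dev X y (v t)).
Proof.
apply: measurable_funD; apply: measurable_sqn; first exact: measurable_zz_dev.
exact: measurable_zu_dev.
Qed.

End row_measurability.

(** * Moment bounds over the sketch *)

Section sketch_moments.
Context (R : realType) (n d : nat) (X : 'M[R]_(n, d)) (y : 'cV[R]_n) (lambda c C4 : R).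
Context dT (T : measurableType dT) (P : probability T R) (m : nat).
Variable s : 'I_m -> {RV P >-> borelV R n}.
Variable i0 : 'I_m.
Hypotheses (c0 : 0 < c) (cM : coercive c (gramH X + lambda%:M)).
Hypothesis ind : mutually_independent P (fun i => s i : T -> borelV R n).
Hypothesis ident : identically_distributed P (fun i => s i : T -> borelV R n).
Hypothesis iso :
  mx_expectation P (fun t => (s i0 t : 'cV[R]_n) *m (s i0 t : 'cV[R]_n)^T) = 1%:M.
Hypothesis mom : (\int[P]_t (frobenius (zz_dev X (s i0 t)) ^+ 4 +
  frobenius (zu_dev X y (s i0 t)) ^+ 4)%:E <= C4%:E)%E.

Local Notation psi v := (influence X y lambda (v : 'cV[R]_n)).
Local Notation beta := (ridge X y lambda).
Local Notation D v := (row_dev X y (v : 'cV[R]_n)).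
Local Notation Kpsi := (2 * c ^- 2 * (1 + sqn beta)).
Local Notation sketch t := (fun i => s i t : 'cV[R]_n).

Let m0 : (0 < m)%N. Proof. by case: i0 => k; exact: leq_trans. Qed.
Let mr0 : 0 < m%:R :> R. Proof. by rewrite ltr0n. Qed.

Let mid : mx_measurable (fun v : borelV R n => v : 'cV[R]_n).
Proof. by move=> i j; rewrite ord1; exact: measurable_coord. Qed.

Let ms i : mx_measurable (fun t => s i t : 'cV[R]_n).
Proof. by move=> k l; rewrite ord1; exact: (measurableT_comp (measurable_coord k)). Qed.

Let mD : measurable_fun setT (fun v : borelV R n => D v).
Proof. exact: measurable_row_dev. Qed.

Lemma frobenius4 p q (A : 'M[R]_(p, q)) : frobenius A ^+ 4 = sqn A ^+ 2.
Proof. by rewrite (exprM _ 2 2) sqr_sqrtr// sqn_ge0. Qed.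

(** The factor 2 is (a + b)^2 <= 2 (a^2 + b^2); the bound for the row [i0] passes to the others by
    equality in law. *)
Lemma row_dev_sqr i : P.-integrable setT (EFin \o (fun t => D (s i t) ^+ 2)) /\
  \int[P]_t (D (s i t) ^+ 2) <= 2 * C4.
Proof.
have mD2 : measurable_fun setT (fun v : borelV R n => D v ^+ 2) by exact: measurable_funX.
have h : (\int[P]_t (D (s i0 t) ^+ 2)%:E <= (2 * C4)%:E)%E.
  apply: (@le_trans _ _ (\int[P]_t (2%:E * (frobenius (zz_dev X (s i0 t)) ^+ 4 +
      frobenius (zu_dev X y (s i0 t)) ^+ 4)%:E)))%E.
    apply: ge0_le_integral => //.
    - by move=> t _; rewrite lee_fin sqr_ge0.
    - by apply/measurable_EFinP; exact: (measurableT_comp mD2).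
    - apply/measurable_EFinP; apply: measurable_funM; first exact: measurable_cst.
      under eq_fun do rewrite !frobenius4.
      apply: measurable_funD; apply: measurable_funX; apply: measurable_sqn.
        exact: measurable_zz_dev.
      exact: measurable_zu_dev.
    - move=> t _; rewrite -EFinM lee_fin !frobenius4 /row_dev.
      set a := sqn _; set b := sqn _.
      by have := sqr_ge0 (a - b); nra.
  rewrite ge0_integralZl//; last 2 first.
  - apply/measurable_EFinP.
    under eq_fun do rewrite !frobenius4.
    apply: measurable_funD; apply: measurable_funX; apply: measurable_sqn.
      exact: measurable_zz_dev.
    exact: measurable_zu_dev.
  - by move=> t _; rewrite lee_fin !frobenius4 addr_ge0 ?sqr_ge0.
  by rewrite EFinM lee_pmul2l.
have iD0 : P.-integrable setT (EFin \o (fun t => D (s i0 t) ^+ 2)).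
  apply/integrableP; split; first by apply/measurable_EFinP; exact: (measurableT_comp mD2).
  under eq_integral do rewrite /= ger0_norm ?sqr_ge0//.
  exact: le_lt_trans h (ltry _).
split; first exact: (ident_integrable ident i mD2 iD0).
rewrite (ident_Rintegral ident i mD2 iD0) -lee_fin /Rintegral fineK//.
exact: integrable_fin_num.
Qed.

Lemma row_dev_le i : P.-integrable setT (EFin \o (fun t => D (s i t))) /\
  \int[P]_t D (s i t) <= 1 + 2 * C4.
Proof.
have [iD2 ED2] := row_dev_sqr i.
have le1 t : D (s i t) <= 1 + D (s i t) ^+ 2.
  by have := sqr_ge0 (D (s i t) - 1); have := row_dev_ge0 X y (s i t); nra.
have i1 : P.-integrable setT (EFin \o (fun t => 1 + D (s i t) ^+ 2)).
  by apply: integrableDR => //; exact: integrable_cstR.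
have iD : P.-integrable setT (EFin \o (fun t => D (s i t))).
  apply: (le_integrableR _ _ i1); first exact: (measurableT_comp mD).
  by move=> t; rewrite ger0_norm ?row_dev_ge0.
split=> //; apply: (@le_trans _ _ (\int[P]_t (1 + D (s i t) ^+ 2))).
  by apply: le_Rintegral => // t _.
rewrite RintegralD//; last exact: integrable_cstR.
by rewrite Rintegral_cstP lerD2l.
Qed.

Lemma avg_sqr_le (f : borelV R n -> R) (C : R) : measurable_fun setT f ->
  P.-integrable setT (EFin \o (fun t => f (s i0 t) ^+ 2)) ->
  \int[P]_t f (s i0 t) = 0 -> \int[P]_t (f (s i0 t) ^+ 2) <= C ->
  P.-integrable setT (EFin \o (fun t => (m%:R^-1 * \sum_i f (s i t)) ^+ 2)) /\
  \int[P]_t ((m%:R^-1 * \sum_i f (s i t)) ^+ 2) <= C / m%:R.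
Proof.
move=> mf if2 Ef Ef2.
have mf2 : measurable_fun setT (fun v => f v ^+ 2) by exact: measurable_funX.
have mV i : measurable_fun setT (fun t => f (s i t)) by exact: measurableT_comp.
have iV2 i := ident_integrable ident i mf2 if2.
have if1 : P.-integrable setT (EFin \o (fun t => f (s i0 t))) by exact: sqr_integrable.
have indf := mutually_independent_comp (fun _ => mf) ind.
have V0 i : \int[P]_t f (s i t) = 0 by rewrite (ident_Rintegral ident i mf if1).
have V2 i : \int[P]_t (f (s i t) ^+ 2) <= C by rewrite (ident_Rintegral ident i mf2 if2).
have [iS ES] := indep_Rintegral_sqr_sum mV indf (index_enum_uniq _) iV2 V0 V2.
have sz : size (index_enum 'I_m) = m by rewrite -sum1_size big_const_ord iter_addn_0 mul1n.
have E t : (m%:R^-1 * \sum_i f (s i t)) ^+ 2 = m%:R ^- 2 * (\sum_i f (s i t)) ^+ 2.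
  by rewrite exprMn exprVn.
split; first by under eq_fun do rewrite E; exact: integrableZR.
under eq_Rintegral do rewrite E.
rewrite RintegralZl// mulrC ler_pdivrMr ?exprn_gt0//.
by rewrite sz in ES; rewrite expr2 mulrA divfK ?gt_eqF// mulrC.
Qed.

Lemma dominated_sqr (f : borelV R n -> R) (K : R) i : measurable_fun setT f -> 0 <= K ->
  (forall v, f v ^+ 2 <= K * D v) ->
  P.-integrable setT (EFin \o (fun t => f (s i t) ^+ 2)) /\
  \int[P]_t (f (s i t) ^+ 2) <= K * (1 + 2 * C4).
Proof.
move=> mf K0 fK; have [iD ED] := row_dev_le i.
have mf2 : measurable_fun setT (fun v => f v ^+ 2) by exact: measurable_funX.
have if2 : P.-integrable setT (EFin \o (fun t => f (s i t) ^+ 2)).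
  apply: (le_integrableR _ _ (integrableZR K iD)); first exact: (measurableT_comp mf2).
  by move=> t; rewrite ger0_norm ?sqr_ge0.
split=> //; apply: (@le_trans _ _ (\int[P]_t (K * D (s i t)))).
  by apply: le_Rintegral => //; exact: integrableZR.
by rewrite RintegralZl// ler_wpM2l.
Qed.

Let Kpsi0 : 0 <= Kpsi.
Proof. by rewrite !mulr_ge0 ?invr_ge0 ?sqr_ge0// addr_ge0// sqn_ge0. Qed.

Let B1 := 1 + 2 * C4.

Lemma sketchH_dev_le :
  P.-integrable setT (EFin \o (fun t => sqn (sketchH X (sketch t) - gramH X))) /\
  \int[P]_t sqn (sketchH X (sketch t) - gramH X) <= d%:R ^+ 2 * B1 / m%:R.
Proof.
have H a b : P.-integrable setT
    (EFin \o (fun t => (m%:R^-1 * \sum_i zz_dev X (s i t) a b) ^+ 2)) /\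
    \int[P]_t ((m%:R^-1 * \sum_i zz_dev X (s i t) a b) ^+ 2) <= B1 / m%:R.
  have mf : measurable_fun setT (fun v : borelV R n => zz_dev X v a b).
    exact: (measurable_zz_dev X mid).
  have zD v : zz_dev X v a b ^+ 2 <= 1 * D v.
    by rewrite mul1r (le_trans (sqr_le_sqn _ a b))// lerDl sqn_ge0.
  have [i2 E2] := @dominated_sqr (fun v => zz_dev X v a b) 1 i0 mf ler01 zD.
  have [_ E0] := zz_dev_mean0 iso X a b.
  by apply: (@avg_sqr_le (fun v => zz_dev X v a b)) => //; rewrite -[leRHS]mul1r.
have E t : sqn (sketchH X (sketch t) - gramH X) =
    \sum_a \sum_b (m%:R^-1 * \sum_i zz_dev X (s i t) a b) ^+ 2.
  rewrite sketchH_dev//; apply: eq_bigr => a _; apply: eq_bigr => b _.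
  by rewrite mxE summxE.
split.
  by under eq_fun do rewrite E; do 2 apply: integrable_sumR => ?; exact: (H _ _).1.
under eq_Rintegral do rewrite E.
rewrite Rintegral_sum; last by move=> a; apply: integrable_sumR => b; exact: (H a b).1.
apply: (@le_trans _ _ (\sum_(a < d) \sum_(b < d) B1 / m%:R)).
  apply: ler_sum => a _; rewrite Rintegral_sum; last by move=> b; exact: (H a b).1.
  by apply: ler_sum => b _; exact: (H a b).2.
by rewrite !sumr_const card_ord -mulrnA -[leLHS]mulr_natl natrM expr2 !mulrA.
Qed.

(** By [influence_eq] the influence is linear in the two deviations, which have mean zero under
    isotropy. *)
Lemma influence_mean0 a : \int[P]_t psi (s i0 t) a 0 = 0.
Proof.
have uM := coercive_unit c0 cM.
have E t : psi (s i0 t) a 0 = \sum_b invmx (gramH X + lambda%:M) a b *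
    (zu_dev X y (s i0 t) b 0 - \sum_e beta e 0 * zz_dev X (s i0 t) b e).
  have := influence_eq y c0 cM (s i0 t : 'cV[R]_n) => /(congr1 (mulmx (invmx (gramH X + lambda%:M)))).
  rewrite mulKmx// => ->; rewrite mxE; apply: eq_bigr => b _; congr (_ * _).
  have -> : \sum_e beta e 0 * zz_dev X (s i0 t) b e = (zz_dev X (s i0 t) *m beta) b 0.
    by rewrite [RHS]mxE; apply: eq_bigr => e _; rewrite mulrC.
  by rewrite [LHS]mxE; congr (_ + _); rewrite mxE.
have iz b : P.-integrable setT (EFin \o (fun t => zu_dev X y (s i0 t) b 0)).
  by have [] := zu_dev_mean0 iso X y b.
have izz b e : P.-integrable setT (EFin \o (fun t => beta e 0 * zz_dev X (s i0 t) b e)).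
  by apply: integrableZR; have [] := zz_dev_mean0 iso X b e.
have iall b : P.-integrable setT (EFin \o (fun t =>
    zu_dev X y (s i0 t) b 0 - \sum_e beta e 0 * zz_dev X (s i0 t) b e)).
  by apply: integrableBR => //; exact: integrable_sumR.
under eq_Rintegral do rewrite E.
rewrite Rintegral_sum; last by move=> b; exact: integrableZR.
rewrite big1// => b _; rewrite RintegralZl// RintegralB//; last exact: integrable_sumR.
rewrite (zu_dev_mean0 iso X y b).2 Rintegral_sum// big1 ?subrr ?mulr0// => e _.
have [i1 E1] := zz_dev_mean0 iso X b e.
by rewrite RintegralZl// E1 mulr0.
Qed.

Let mpsi : mx_measurable (fun v : borelV R n => psi v).
Proof. exact: (measurable_influence X y lambda mid). Qed.

Let psi_sqr a (v : borelV R n) : psi v a 0 ^+ 2 <= Kpsi * D v.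
Proof. exact: le_trans (sqr_le_sqn _ a 0) (sqn_influence_le y c0 cM v). Qed.

Lemma influence_sum_le :
  P.-integrable setT (EFin \o (fun t => sqn (influence_sum X y lambda (sketch t)))) /\
  \int[P]_t sqn (influence_sum X y lambda (sketch t)) <= d%:R * (Kpsi * B1).
Proof.
have H a := @avg_sqr_le (fun v => psi v a 0) (Kpsi * B1) (mpsi a 0)
  (dominated_sqr i0 (mpsi a 0) Kpsi0 (psi_sqr a)).1 (influence_mean0 a)
  (dominated_sqr i0 (mpsi a 0) Kpsi0 (psi_sqr a)).2.
have E t : sqn (influence_sum X y lambda (sketch t)) =
    \sum_a m%:R * (m%:R^-1 * \sum_i psi (s i t) a 0) ^+ 2.
  rewrite sqnE; apply: eq_bigr => a _; rewrite mxE summxE; set S0 := \sum_i _.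
  rewrite exprMn exprVn sqr_sqrtr ?ler0n//; move: (gt_eqF mr0).
  by move: (m%:R) => k k0; field; rewrite k0.
have iH a : P.-integrable setT (EFin \o (fun t => m%:R * (m%:R^-1 * \sum_i psi (s i t) a 0) ^+ 2)).
  by apply: integrableZR; exact: (H a).1.
split; first by under eq_fun do rewrite E; exact: integrable_sumR.
under eq_Rintegral do rewrite E.
rewrite Rintegral_sum//; apply: (@le_trans _ _ (\sum_(a < d) Kpsi * B1)).
  apply: ler_sum => a _; rewrite RintegralZl//; last exact: (H a).1.
  by have := (H a).2; rewrite ler_pdivlMr// mulrC.
by rewrite sumr_const card_ord -[leLHS]mulr_natl.
Qed.

Section direction.
Variable th : 'cV[R]_d.

Local Notation v_ v := (dot th (psi v)).
Definition direction_var : R := \int[P]_t (v_ (s i0 t) ^+ 2).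

Let mv : measurable_fun setT (fun v : borelV R n => v_ v).
Proof. exact: measurable_dot_comp. Qed.

Lemma dot_influence_sqr (v : borelV R n) : v_ v ^+ 2 <= sqn th * Kpsi * D v.
Proof.
rewrite (le_trans (dot_sqr_le _ _))// -mulrA ler_wpM2l ?sqn_ge0//.
exact: (sqn_influence_le y c0 cM v).
Qed.

Let K4 := (sqn th * Kpsi) ^+ 2 * (2 * C4).

Let v4 (v : borelV R n) : v_ v ^+ 4 <= (sqn th * Kpsi) ^+ 2 * D v ^+ 2.
Proof.
rewrite (exprM _ 2 2) -exprMn ler_sqr ?nnegrE ?sqr_ge0 ?dot_influence_sqr//.
by rewrite !mulr_ge0 ?sqn_ge0 ?row_dev_ge0// ?invr_ge0 ?sqr_ge0// addr_ge0// sqn_ge0.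
Qed.

Let iv4 i : P.-integrable setT (EFin \o (fun t => v_ (s i t) ^+ 4)).
Proof.
have [iD2 ED2] := row_dev_sqr i.
apply: (le_integrableR _ _ (integrableZR ((sqn th * Kpsi) ^+ 2) iD2)).
  by apply: measurable_funX; exact: (measurableT_comp mv).
by move=> t; rewrite ger0_norm ?v4// (exprM _ 2 2) sqr_ge0.
Qed.

Let Ev4 i : \int[P]_t (v_ (s i t) ^+ 4) <= K4.
Proof.
have [iD2 ED2] := row_dev_sqr i.
apply: (@le_trans _ _ (\int[P]_t ((sqn th * Kpsi) ^+ 2 * D (s i t) ^+ 2))).
  by apply: le_Rintegral => //; exact: integrableZR.
by rewrite RintegralZl// ler_wpM2l ?sqr_ge0.
Qed.

Let ivmom i : P.-integrable setT (EFin \o (fun t => v_ (s i t) ^+ 2)).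
Proof.
have K0 : 0 <= sqn th * Kpsi by rewrite mulr_ge0 ?sqn_ge0.
exact: (dominated_sqr i mv K0 dot_influence_sqr).1.
Qed.

Let Ev i : \int[P]_t v_ (s i t) = 0.
Proof.
have iv : P.-integrable setT (EFin \o (fun t => v_ (s i0 t))).
  by apply: sqr_integrable => //; exact: (measurableT_comp mv).
have ipsi a : P.-integrable setT (EFin \o (fun t => psi (s i0 t) a 0)).
  apply: sqr_integrable; first exact: (measurableT_comp (mpsi a 0)).
  exact: (dominated_sqr i0 (mpsi a 0) Kpsi0 (psi_sqr a)).1.
rewrite (ident_Rintegral ident i mv iv) /dot Rintegral_sum; last by move=> a; exact: integrableZR.
by rewrite big1// => a _; rewrite RintegralZl ?influence_mean0 ?mulr0.
Qed.

(** [iid_cos] for the projections th.psi, whose fourth moment is at most K4 because their square is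
    at most a multiple of [row_dev]. *)
Lemma influence_sum_cos (c' v : R) : 0 <= v ->
  `|\int[P]_t cos (c' + dot th (influence_sum X y lambda (sketch t)))
     - expR (- v / 2) * cos c'| <=
  `|direction_var - v| / 2 + (1 + 2 * K4 + v ^+ 2) / Num.sqrt m%:R.
Proof.
move=> v0.
have mV i : measurable_fun setT (fun t => v_ (s i t)) by exact: (measurableT_comp mv).
have indv := mutually_independent_comp (fun _ => mv) ind.
have Ev2 i : \int[P]_t (v_ (s i t) ^+ 2) = direction_var.
  by rewrite (ident_Rintegral ident i (measurable_funX 2 mv) (ivmom i0)).
have := iid_cos m0 mV indv c' v0 iv4 Ev Ev2 Ev4.
congr (`|_ - _| <= _); apply: eq_Rintegral => t _; congr (cos (_ + _)).
rewrite /influence_sum dotZr; congr (_ * _).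
rewrite /dot exchange_big; apply: eq_bigr => a _ /=.
by rewrite summxE mulr_sumr.
Qed.

(** Up to a squared mean, the average is the bootstrap variance in direction th; its concentration
    makes the conditional limit agree with the unconditional one. *)
Lemma direction_avg_le :
  P.-integrable setT (EFin \o (fun t => (m%:R^-1 * \sum_i v_ (s i t) ^+ 2 - direction_var) ^+ 2)) /\
  \int[P]_t ((m%:R^-1 * \sum_i v_ (s i t) ^+ 2 - direction_var) ^+ 2) <= K4 / m%:R.
Proof.
pose f v := v_ v ^+ 2 - direction_var.
have mf : measurable_fun setT (f : borelV R n -> R).
  by apply: measurable_funB => //; exact: measurable_funX.
have ifx : P.-integrable setT (EFin \o (fun t => v_ (s i0 t) ^+ 4 - 2 * direction_var * v_ (s i0 t) ^+ 2)).
  by apply: integrableBR => //; exact: integrableZR.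
have E2 t : f (s i0 t) ^+ 2 = v_ (s i0 t) ^+ 4 - 2 * direction_var * v_ (s i0 t) ^+ 2 + direction_var ^+ 2.
  by rewrite /f; ring.
have if2 : P.-integrable setT (EFin \o (fun t => f (s i0 t) ^+ 2)).
  by under eq_fun do rewrite E2; apply: integrableDR => //; exact: integrable_cstR.
have Ef : \int[P]_t f (s i0 t) = 0.
  rewrite RintegralB//; last exact: integrable_cstR.
  by rewrite Rintegral_cstP subrr.
have Ef2 : \int[P]_t (f (s i0 t) ^+ 2) <= K4.
  under eq_Rintegral do rewrite E2.
  rewrite RintegralD//; last exact: integrable_cstR.
  rewrite RintegralB//; last exact: integrableZR.
  rewrite RintegralZl// Rintegral_cstP -/direction_var.
  by have := Ev4 i0; have := sqr_ge0 direction_var; nra.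
have := avg_sqr_le mf if2 Ef Ef2.
have E t : m%:R^-1 * \sum_i f (s i t) = m%:R^-1 * \sum_i v_ (s i t) ^+ 2 - direction_var.
  rewrite sumrB sumr_const card_ord -[direction_var *+ m]mulr_natl mulrBr.
  by rewrite mulKf// gt_eqF.
have EE : (fun t => (m%:R^-1 * \sum_i f (s i t)) ^+ 2) =
    (fun t => (m%:R^-1 * \sum_i v_ (s i t) ^+ 2 - direction_var) ^+ 2).
  by apply/funext => t; rewrite E.
by rewrite EE.
Qed.

Lemma direction_varE : direction_var = dot th (mx_expectation P
  (fun t => psi (s i0 t) *m (psi (s i0 t))^T) *m th).
Proof.
have i2 a := (dominated_sqr i0 (mpsi a 0) Kpsi0 (psi_sqr a)).1.
have iab a b : P.-integrable setT (EFin \o (fun t => psi (s i0 t) a 0 * psi (s i0 t) b 0)).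
  by apply: integrableM_sqr => //; exact: (measurableT_comp (mpsi _ 0)).
have E t : v_ (s i0 t) ^+ 2 = \sum_a \sum_b (th a 0 * th b 0) * (psi (s i0 t) a 0 * psi (s i0 t) b 0).
  rewrite expr2 /dot mulr_suml; apply: eq_bigr => a _; rewrite mulr_sumr; apply: eq_bigr => b _.
  by rewrite mulrACA.
have ie a b : P.-integrable setT (EFin \o (fun t => (th a 0 * th b 0) * (psi (s i0 t) a 0 * psi (s i0 t) b 0))).
  exact: integrableZR.
rewrite /direction_var; under eq_Rintegral do rewrite E.
rewrite Rintegral_sum; last by move=> a; exact: integrable_sumR.
rewrite /dot; apply: eq_bigr => a _; rewrite Rintegral_sum// mxE mulr_sumr.
apply: eq_bigr => b _; rewrite RintegralZl// mxE unlock -mulrA [in RHS](mulrC _ (th b 0)).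
congr (_ * (_ * _)); rewrite /Rintegral; congr fine; apply: eq_integral => t _; congr EFin.
by rewrite [in RHS]mxE big_ord1; congr (_ * _); rewrite [RHS]mxE.
Qed.

End direction.
End sketch_moments.

(** * From cosines to weak convergence *)

Section weak_limits.
Context (R : realType) (d : nat) (Omega : 'M[R]_d) (N : probability (borelV R d) R).
Hypothesis hN : centered_normal Omega N.

Lemma trig_law (l : seq (R * 'cV[R]_d * R)) : \int[N]_x trig_eval l x =
  \sum_(q <- l) q.1.1 * (expR (- dot q.1.2 (Omega *m q.1.2) / 2) * cos q.2).
Proof.
have mc (c : R) (th : 'cV[R]_d) : N.-integrable setT (EFin \o (fun x : borelV R d => cos (c + dot th x))).
  apply: (@bounded_integrable _ _ _ N _ 1); last by move=> x; exact: norm_cos_le1.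
  apply: measurable_cos_comp; apply: measurable_funD; [exact: measurable_cst|exact: measurable_dot].
rewrite /trig_eval Rintegral_sum; last by move=> q; exact: integrableZR.
by apply: eq_bigr => q _; rewrite RintegralZl// (centered_normal_cos _ _ hN).
Qed.

Lemma Rintegral_trig dT (T : measurableType dT) (P : probability T R) (S : T -> 'cV[R]_d)
    (l : seq (R * 'cV[R]_d * R)) : mx_measurable S ->
  \int[P]_t trig_eval l (S t) = \sum_(q <- l) q.1.1 * \int[P]_t cos (q.2 + dot q.1.2 (S t)).
Proof.
move=> mS.
have mc (c : R) (th : 'cV[R]_d) : P.-integrable setT (EFin \o (fun t => cos (c + dot th (S t)))).
  apply: (@bounded_integrable _ _ _ P _ 1); last by move=> x; exact: norm_cos_le1.
  by apply: measurable_cos_comp; apply: measurable_funD; [exact: measurable_cst|exact: measurable_dot_comp].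
rewrite /trig_eval Rintegral_sum; last by move=> q; exact: integrableZR.
by apply: eq_bigr => q _; rewrite RintegralZl.
Qed.

Hypothesis d0 : (0 < d)%N.
Context (dT : nat -> measure_display) (T : forall n, measurableType (dT n)).
Variables (P : forall n, probability (T n) R).
Variables (S Y : forall n, T n -> 'cV[R]_d) (D : forall n, T n -> R) (B C eta0 : R).
Hypothesis eta00 : 0 < eta0.
Hypothesis mS : \forall n \near \oo, mx_measurable (@S n) /\ mx_measurable (@Y n).
Hypothesis S2 : \forall n \near \oo, (P n).-integrable setT (EFin \o (fun t : T n => sqn (S t))) /\
  \int[P n]_t sqn (S t) <= B.
Hypothesis D0 : forall n (t : T n), 0 <= D t.
Hypothesis iD : \forall n \near \oo, (P n).-integrable setT (EFin \o @D n).
Hypothesis ED : \int[P n]_t D (t : T n) @[n --> \oo] --> 0.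
Hypothesis SY : \forall n \near \oo, forall t : T n, D t <= eta0 ->
  sqn (S t - Y t) <= C * (D t * sqn (S t)).
Hypothesis cosS : forall (c : R) (th : 'cV[R]_d),
  \int[P n]_t cos (c + dot th (S (t : T n))) @[n --> \oo] -->
  expR (- dot th (Omega *m th) / 2) * cos c.

(** D is the small quantity that controls the passage from S to Y. Where D <= eta the trigonometric
    approximant absorbs the difference; where D > eta the bound 2 M <= (2 M / eta) D is integrated,
    as in Markov's inequality. *)
Lemma cvg_continuous_test (h : 'cV[R]_d -> R) (M : R) : continuous h ->
  (forall x, `|h x| <= M) ->
  \int[P n]_t h (Y (t : T n)) @[n --> \oo] --> \int[N]_x h x.
Proof.
move=> ch hM.
have M0 : 0 <= M by apply: le_trans (hM 0).
have B0 : 0 <= B.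
  have [n _ /(_ n (leqnn _))[iS]] := S2.
  by apply: le_trans; apply: Rintegral_ge0 => t _; exact: sqn_ge0.
(* B + 5 collects one e for the limit of q (S), one for q against h under N, and e + e B + e + e for
   h (Y) against q (S). *)
have key e : 0 < e -> \forall n \near \oo, `|\int[N]_x h x - \int[P n]_t h (Y (t : T n))| <= e * (B + 5).
  move=> e0; have [q [K K0 [[l ql] qM qN hq]]] := trig_approx_law hM d0 ch N e0.
  (* The first entry makes [SY] available, the second gives K |C| B eta <= e; the added 1 keeps the
     denominator positive. *)
  pose eta := Num.min eta0 (e / (1 + K * `|C| * B)).
  have KCB : 0 < 1 + K * `|C| * B by rewrite ltr_wpDr// !mulr_ge0.
  have eta_gt0 : 0 < eta by rewrite lt_min eta00 divr_gt0.
  have eta1 : K * `|C| * B * eta <= e.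
    apply: (@le_trans _ _ ((1 + K * `|C| * B) * eta)).
      by rewrite ler_wpM2r ?(ltW eta_gt0)// lerDr.
    by rewrite mulrC -ler_pdivlMr// ge_min lexx orbT.
  have cq : \int[P n]_t q (S (t : T n)) @[n --> \oo] --> \int[N]_x q x.
    rewrite [X in _ --> X](_ : _ = \int[N]_x trig_eval l x); last exact: eq_Rintegral.
    rewrite trig_law.
    have : (\sum_(q <- l) q.1.1 * \int[P n]_t cos (q.2 + dot q.1.2 (S (t : T n)))) @[n --> \oo] -->
        \sum_(q <- l) q.1.1 * (expR (- dot q.1.2 (Omega *m q.1.2) / 2) * cos q.2).
      by apply: cvg_big => [|p _]; [exact: add_continuous|apply: cvgMl_tmp; exact: cosS].
    apply: cvg_trans; apply: near_eq_cvg; near=> n.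
    rewrite -Rintegral_trig; last by have [] : mx_measurable (@S n) /\ mx_measurable (@Y n) by near: n.
    by apply: eq_Rintegral => t _.
  have e2 : 0 < e * eta / (1 + 2 * M).
    by rewrite !mulr_gt0// invr_gt0; lra.
  near=> n.
  have [mSn mYn] : mx_measurable (@S n) /\ mx_measurable (@Y n) by near: n.
  have [iSn ESn] : (P n).-integrable setT (EFin \o (fun t => sqn (S t))) /\
    \int[P n]_t sqn (S t) <= B by near: n; exact: S2.
  have iDn : (P n).-integrable setT (EFin \o @D n) by near: n.
  have SYn : forall t : T n, D t <= eta0 -> sqn (S t - Y t) <= C * (D t * sqn (S t)).
    by near: n; exact: SY.
  have c1 : `|\int[N]_x q x - \int[P n]_t q (S t)| <= e.
    by near: n; move/cvgrPdist_le: cq; exact.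
  have c2 : `|0 - \int[P n]_t D t| <= e * eta / (1 + 2 * M).
    by near: n; move/cvgrPdist_le: ED; exact.
  have c3 : 2 * M / eta * \int[P n]_t D t <= e.
    move: c2; rewrite sub0r normrN ger0_norm; last by apply: Rintegral_ge0 => t _; exact: D0.
    set ID := \int[_]_(_ in _) _ => c2.
    have ID0 : 0 <= ID by apply: Rintegral_ge0 => t _; exact: D0.
    rewrite mulrAC ler_pdivrMr//.
    move: c2; rewrite ler_pdivlMr//; last by lra.
    by nra.
  have mh : measurable_fun setT (fun t : T n => h (Y t)).
    exact: (measurable_continuous_comp d0 ch hM).
  have mq : measurable_fun setT (fun t : T n => q (S t)).
    by apply: measurable_trig_comp => //; exists l.
  have ih := bounded_integrable (P n) mh (fun t => hM _).
  have iq := bounded_integrable (P n) mq (fun t => qM _).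
  have pw (t : T n) : `|h (Y t) - q (S t)| <= e + (e + K * `|C| * eta) * sqn (S t) + 2 * M / eta * D t.
    have S0 := sqn_ge0 (S t); have Dt0 := @D0 n t.
    have MD : 0 <= 2 * M / eta * D t by rewrite !mulr_ge0// invr_ge0 ltW.
    have [Dt|Dt] := leP (D t) eta.
      rewrite (le_trans (hq _ _))//.
      have : K * sqn (S t - Y t) <= K * `|C| * eta * sqn (S t).
        rewrite -!mulrA ler_wpM2l// (le_trans (SYn t _))//.
          by rewrite (le_trans Dt)// ge_min lexx.
        rewrite (le_trans (ler_norm _))// normrM ler_wpM2l// ger0_norm ?mulr_ge0//.
        by rewrite ler_wpM2r.
      by lra.
    rewrite (le_trans (ler_normB _ _))// (le_trans (lerD (hM _) (qM _)))//.
    have : 2 * M <= 2 * M / eta * D t.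
      by rewrite mulrAC ler_pdivlMr// ler_wpM2l ?mulr_ge0// ltW.
    have : 0 <= (e + K * `|C| * eta) * sqn (S t).
      by rewrite mulr_ge0// addr_ge0 ?(ltW e0)// !mulr_ge0 ?(ltW eta_gt0).
    by lra.
  have i1 : (P n).-integrable setT (EFin \o (fun t => e + (e + K * `|C| * eta) * sqn (S t))).
    by apply: integrableDR; [exact: integrable_cstR|exact: integrableZR].
  have i2 : (P n).-integrable setT (EFin \o (fun t => 2 * M / eta * D t)) by exact: integrableZR.
  have hqS : `|\int[P n]_t h (Y t) - \int[P n]_t q (S t)| <=
      e + (e + K * `|C| * eta) * B + e.
    rewrite -RintegralB// (le_trans (le_normr_Rintegral _ _))//; first exact: integrableBR.
    apply: (@le_trans _ _ (\int[P n]_t (e + (e + K * `|C| * eta) * sqn (S t) + 2 * M / eta * D t))).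
      apply: le_Rintegral => //; last exact: integrableDR.
      by apply: integrable_norm; exact: integrableBR.
    rewrite RintegralD// RintegralD//; last 2 first.
      exact: integrable_cstR.
      exact: integrableZR.
    rewrite Rintegral_cstP !RintegralZl//.
    apply: lerD => //; rewrite lerD2l ler_wpM2l// addr_ge0 ?(ltW e0)//.
    by rewrite !mulr_ge0 ?(ltW eta_gt0).
  rewrite (_ : _ - _ = (\int[N]_x q x - \int[P n]_t q (S t))
     - (\int[N]_x q x - \int[N]_x h x) - (\int[P n]_t h (Y t) - \int[P n]_t q (S t))); last by ring.
  rewrite (le_trans (ler_normB _ _))// (le_trans (lerD (ler_normB _ _) (lexx _)))//.
  by move: c1 qN hqS eta1; lra.
apply/cvgrPdist_le => e e0.
have B5 : 0 < B + 5 by lra.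
have := key (e / (B + 5)); rewrite divfK ?gt_eqF//; apply.
by rewrite divr_gt0.
Unshelve. all: by end_near.
Qed.

End weak_limits.

(** * Comparison of versions of a conditional expectation *)

Section conditional_expectation.
Context dT (T : measurableType dT) (R : realType) (P : probability T R).
Variable F : set (set T).
Hypothesis FT : forall A, F A -> measurable A.

(** The two tail sets of the chosen version belong to F, so over each of them its integral equals
    that of the explicit version [Y0]. Markov's inequality on both sets gives the factor 2. *)
Lemma cond_expectation_prob (Z Y0 : T -> R) (c e : R) : is_cond_expectation P F Z Y0 ->
  0 < e ->
  (P [set t | (e <= `|cond_expectation P F Z t - c|)%R] <=
    (2 / e * \int[P]_t `|Y0 t - c|)%R%:E)%E.
Proof.
move=> hY0 e0.
(* The set of versions contains [Y0], so [xget] does not fall back on its default. *)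
have : is_cond_expectation P F Z (cond_expectation P F Z).
  by rewrite /cond_expectation; case: xgetP => [Y _//|/(_ Y0)].
set Y := cond_expectation _ _ _ => hY.
have [iZ iY mY EY] := hY; have [_ iY0 mY0 EY0] := hY0.
have iD : P.-integrable setT (EFin \o (fun t => Y0 t - c)).
  by apply: integrableBR => //; exact: integrable_cstR.
have iN : P.-integrable setT (EFin \o (fun t => `|Y0 t - c|)) by exact: integrable_norm.
have EA A : F A -> \int[P]_t (Y t * \1_A t) = \int[P]_t (Y0 t * \1_A t).
  move=> FA; have mA := FT FA.
  have tr f : \int[P]_t (f t * \1_A t) = fine (\int[P]_(t in A) (f t)%:E)%E.
    by rewrite /Rintegral [in RHS]integral_mkcond epatch_indic.
  by rewrite !tr EY// EY0.
have half (A : set T) (sg : R) : F A -> `|sg| = 1 -> (forall t, A t -> e <= sg * (Y t - c)) ->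
    e * fine (P A) <= \int[P]_t `|Y0 t - c|.
  move=> FA sg1 hA; have mA := FT FA.
  have iA f : P.-integrable setT (EFin \o f) -> P.-integrable setT (EFin \o (fun t => f t * \1_A t)).
    by move=> i; exact: integrableM_indic.
  have iYA : P.-integrable setT (EFin \o (fun t => (Y t - c) * \1_A t)).
    by apply: iA; apply: integrableBR => //; exact: integrable_cstR.
  rewrite -(Rintegral_indic P mA) -RintegralZl//; last first.
    exact: integrable_indic.
  apply: (@le_trans _ _ (\int[P]_t (sg * ((Y t - c) * \1_A t)))).
    apply: le_Rintegral => //.
    - by apply: integrableZR; exact: integrable_indic.
    - exact: integrableZR.
    - move=> t _; rewrite indicE mulrA; have [tA|] := boolP (t \in A).
        by rewrite !mulr1; apply: hA; exact: set_mem.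
      by rewrite !mulr0.
  have -> : \int[P]_t (sg * ((Y t - c) * \1_A t)) = \int[P]_t (sg * ((Y0 t - c) * \1_A t)).
    rewrite !RintegralZl//; last exact: iA.
    congr (_ * _).
    under eq_Rintegral do rewrite mulrBl.
    under [RHS]eq_Rintegral do rewrite mulrBl.
    have ic : P.-integrable setT (EFin \o (fun t => c * \1_A t)).
      exact: (iA (fun=> c) (integrable_cstR P c)).
    by rewrite !RintegralB//; [rewrite EA|exact: iA|exact: iA].
  apply: le_Rintegral => //; first by apply: integrableZR; exact: iA.
  move=> t _; rewrite (le_trans (ler_norm _))// !normrM sg1 mul1r.
  by rewrite ler_piMr// indicE_le1.
have FB B : measurable B -> F (Y @^-1` B) by exact: mY.
pose A1 := Y @^-1` `[c + e, +oo[; pose A2 := Y @^-1` `]-oo, c - e].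
have FA1 : F A1 by exact: FB.
have FA2 : F A2 by exact: FB.
have h1 : e * fine (P A1) <= \int[P]_t `|Y0 t - c|.
  apply: (half A1 1) => //; first by rewrite normr1.
  by move=> t; rewrite /A1/= in_itv/= andbT mul1r; lra.
have h2 : e * fine (P A2) <= \int[P]_t `|Y0 t - c|.
  apply: (half A2 (-1)) => //; first by rewrite normrN1.
  by move=> t; rewrite /A2/= in_itv/=; lra.
have sub : [set t | e <= `|Y t - c|] = A1 `|` A2.
  apply/seteqP; split=> t; rewrite /A1 /A2/= !in_itv/= andbT ler_normr.
    by case/orP => h; [left|right]; lra.
  by case=> h; apply/orP; [left|right]; lra.
rewrite sub; have mA1 := FT FA1; have mA2 := FT FA2.
apply: (@le_trans _ _ (P A1 + P A2)%E); first exact: measureU2.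
rewrite -(fineK (fin_num_prob P mA1)) -(fineK (fin_num_prob P mA2)) -EFinD lee_fin.
rewrite mulrAC ler_pdivlMr//; lra.
Qed.

End conditional_expectation.

(** * Conditional expectation under multinomial weights *)

Section conditional_multinomial.
Context dT (T : measurableType dT) (R : realType) (P : probability T R).
Variables (E : set (set T)) (m : nat) (w : T -> {ffun 'I_m -> nat}).
Hypothesis ET : forall A, <<s E >> A -> measurable A.
Hypothesis m0 : (0 < m)%N.
Local Notation p := (fun _ : 'I_m => m%:R^-1 : R).
Hypothesis hw : cond_multinomial P <<s E >> m p w.
Variables (G : T -> {ffun 'I_m -> nat} -> R) (M : R).
Hypothesis GM : forall t k, `|G t k| <= M.
Local Notation TE := (g_sigma_algebraType E).
Hypothesis mG : forall k, measurable_fun setT (fun t : TE => G t k).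

Let p1 := uniform_weights_sum R m0.
Let p0 := @uniform_weights_ge0 R m.

Let mGT k : measurable_fun setT (fun t => G t k).
Proof.
by move=> _ B mB; rewrite setTI; apply: ET; have := mG k measurableT mB; rewrite setTI.
Qed.

(** The event is the preimage of 1 under its indicator, which [hw] makes integrable and hence
    measurable. *)
Let mw k : measurable [set t | w t = k].
Proof.
have [/integrable_measurable mI _ _ _] := hw k.
have := measurable_preim mI (measurable_set1 (1 : R)); congr (measurable _).
apply/seteqP; split=> t /=; rewrite indicE; last by move=> wt; rewrite mem_set.
by have [/set_mem//|_ /eqP] := boolP (t \in _); rewrite eq_sym oner_eq0.
Qed.

Let prob_w k (A : set T) : <<s E >> A ->
  \int[P]_t (\1_[set t | w t = k] t * \1_A t) = multinomial_pmf m p k * fine (P A).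
Proof.
move=> EA; have mA := ET EA; have [_ _ _ /(_ _ EA) h] := hw k.
transitivity (fine (\int[P]_(t in A) (cst (multinomial_pmf m p k) t)%:E)%E).
  by rewrite h /Rintegral [in RHS]integral_mkcond epatch_indic.
transitivity (fine ((multinomial_pmf m p k)%:E * P A)%E); last first.
  by rewrite -(fineK (fin_num_prob P mA)).
by congr fine; exact: (integral_cst P mA (multinomial_pmf m p k)%:E).
Qed.

Let emb (k : {ffun 'I_m -> 'I_m.+1}) : {ffun 'I_m -> nat} := [ffun i => k i : nat].

Let emb_inj : injective emb.
Proof. by move=> k l /ffunP kl; apply/ffunP => i; apply/val_inj; have := kl i; rewrite !ffunE. Qed.

Let meanE H : multinomial_mean p m H = \sum_k H (emb k) * multinomial_pmf m p (emb k).
Proof.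
by rewrite multinomial_mean_indic; apply: eq_bigr => k _; rewrite multinomial_mean_pmf.
Qed.

(** The indicator that w takes one of the values listed by [emb]. [hw] describes each value
    separately; since the listed values have total mass 1, almost surely no other occurs, which is
    [wrange_int]. *)
Let wrange t : R := \sum_k \1_[set t | w t = emb k] t.

Let wrange01 t : wrange t = 1 \/ wrange t = 0.
Proof.
rewrite /wrange; have [[k wk]|nk] := pselect (exists k, w t = emb k).
  left; rewrite (bigD1 k)//= big1 ?addr0 ?indicE ?mem_set// => l lk.
  rewrite indicE memNset//= wk => /emb_inj kl.
  by rewrite kl eqxx in lk.
by right; rewrite big1// => k _; rewrite indicE memNset//= => wk; apply: nk; exists k.
Qed.

Let iI k : P.-integrable setT (EFin \o (\1_[set t | w t = k] : T -> R)).
Proof. by have [] := hw k. Qed.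

Let wrange_int : \int[P]_t `|1 - wrange t| = 0.
Proof.
have E1 t : `|1 - wrange t| = 1 - wrange t.
  by case: (wrange01 t) => ->; rewrite ?subrr ?subr0 ?normr0 ?normr1.
under eq_Rintegral do rewrite E1.
rewrite RintegralB//; [|exact: integrable_cstR|exact: integrable_sumR].
rewrite Rintegral_cstP Rintegral_sum//.
apply/eqP; rewrite subr_eq0; apply/eqP.
rewrite -[LHS](multinomial_mean_cst p1 m 1) meanE; apply: eq_bigr => k _.
rewrite mul1r; have := prob_w (emb k) (A := setT) _.
rewrite probability_setT/= mulr1 => <-.
  by apply: eq_Rintegral => t _; rewrite indicT mulr1.
by have := @measurableT _ TE.
Qed.

(** For fixed k, [G t k] is measurable for the conditioning sigma-algebra and factors out of the
    event w = k. Summation over the listed k gives the multinomial mean, the remaining values of w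
    having probability 0. *)
Lemma cond_multinomial_expectation :
  is_cond_expectation P <<s E >> (fun t => G t (w t)) (fun t => multinomial_mean p m (G t)).
Proof.
have mZ : measurable_fun setT (fun t => G t (w t)).
  move=> _ B mB; rewrite setTI.
  rewrite (_ : _ @^-1` _ = \bigcup_k ([set t | w t = k] `&` (fun t => G t k) @^-1` B)).
    apply: countable_bigcupT_measurable; first exact: countableP.
    by move=> k; apply: measurableI => //; exact: measurable_preim.
  apply/seteqP; split=> t /=; first by move=> GB; exists (w t).
  by move=> [k _ [<-]].
have mY : measurable_fun setT (fun t : TE => multinomial_mean p m (G t)).
  under eq_fun do rewrite meanE.
  by apply: measurable_sum => k; apply: measurable_funM.
have YM t : `|multinomial_mean p m (G t)| <= M by exact: norm_multinomial_mean_le.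
have mYT : measurable_fun setT (fun t => multinomial_mean p m (G t)).
  by move=> _ B mB; rewrite setTI; apply: ET; have := mY measurableT _ mB; rewrite setTI.
have iZ := bounded_integrable P mZ (fun t => GM t _).
have iY := bounded_integrable P mYT YM.
split=> //.
  by move=> B mB; have := mY measurableT _ mB; rewrite setTI.
move=> A EA; have mA := ET EA.
have tr f : P.-integrable setT (EFin \o f) ->
    (\int[P]_(t in A) (f t)%:E)%E = (\int[P]_t (f t * \1_A t))%:E.
  move=> jf; rewrite integral_mkcond epatch_indic /Rintegral fineK//.
  apply: integrable_fin_num => //.
  exact: integrableM_indic.
rewrite !tr//; congr EFin.
have GA k : \int[P]_t (\1_[set t | w t = k] t * (G t k * \1_A t)) =
    multinomial_pmf m p k * \int[P]_t (G t k * \1_A t).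
  apply: (@Rintegral_factor_bounded _ _ _ P _ _ _ M) => //.
  - by apply: measurable_funM => //; exact: measurable_indic.
  - move=> t; rewrite normrM -[leRHS]mulr1.
    by rewrite ler_pM// indicE_le1.
  - move=> B mB; apply: prob_w.
    have mA' : measurable (A : set TE) by [].
    by apply: (measurable_preim (T := TE) _ mB); apply: measurable_funM.
have iGA k : P.-integrable setT (EFin \o (fun t => G t k * \1_A t)).
  by apply: integrableM_indic => //; exact: (bounded_integrable P (mGT k) (fun t => GM t k)).
transitivity (\sum_k multinomial_pmf m p (emb k) * \int[P]_t (G t (emb k) * \1_A t)).
  under eq_Rintegral do rewrite meanE mulr_suml.
  rewrite Rintegral_sum; last first.
    move=> k; under eq_fun do rewrite mulrAC mulrC.
    exact: integrableZR.
  apply: eq_bigr => k _; rewrite -RintegralZl//.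
  by apply: eq_Rintegral => t _; rewrite mulrAC mulrC.
under eq_bigr do rewrite -GA.
have iGw k : P.-integrable setT (EFin \o (fun t => \1_[set t | w t = k] t * (G t k * \1_A t))).
  under eq_fun do rewrite mulrC.
  exact: integrableM_indic.
have iZA : P.-integrable setT (EFin \o (fun t => G t (w t) * \1_A t)) by exact: integrableM_indic.
rewrite -Rintegral_sum//; apply/eqP; rewrite -subr_eq0 -RintegralB//; last exact: integrable_sumR.
rewrite -normr_le0 (le_trans (le_normr_Rintegral _ _))//.
  by apply: integrableBR => //; exact: integrable_sumR.
apply: (@le_trans _ _ (\int[P]_t (M * `|1 - wrange t|))).
  apply: le_Rintegral => //.
  - by apply: integrable_norm; apply: integrableBR => //; exact: integrable_sumR.
  - apply: integrableZR; apply: integrable_norm; apply: integrableBR; first exact: integrable_cstR.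
    exact: integrable_sumR.
  - move=> t _; have M0 : 0 <= M by apply: le_trans (GM t (w t)).
    have -> : \sum_k (\1_[set t | w t = emb k] t * (G t (emb k) * \1_A t)) =
        wrange t * (G t (w t) * \1_A t).
      rewrite mulr_suml; apply: eq_bigr => k _; rewrite indicE.
      by have [/set_mem/= ->//|_] := boolP (t \in _); rewrite !mul0r.
    rewrite -[X in _ - X]mul1r -mulrBl normrM mulrC distrC.
    rewrite ler_wpM2r// normrM -[leRHS]mulr1 ler_pM// indicE_le1//.
rewrite RintegralZl//; last first.
  apply: integrable_norm; apply: integrableBR; first exact: integrable_cstR.
  exact: integrable_sumR.
by rewrite wrange_int mulr0.
Qed.

End conditional_multinomial.

Lemma measurable_multinomial_mean dT (T : measurableType dT) (R : realType) (I : finType)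
    (p : I -> R) N (G : T -> {ffun I -> nat} -> R) :
  (forall k, measurable_fun setT (fun t => G t k)) ->
  measurable_fun setT (fun t => multinomial_mean p N (G t)).
Proof.
elim: N G => [|N IH] G mG /=; first exact: mG.
apply: measurable_sum => i; apply: measurable_funM; first exact: measurable_cst.
by apply: IH => k; exact: mG.
Qed.

(** * Test functions of the bootstrap error for a fixed sketch *)

Section bootstrap_tests.
Variables (R : realType) (n d : nat) (X : 'M[R]_(n, d)) (y : 'cV[R]_n) (lambda c : R).
Hypotheses (c0 : 0 < c) (cM : coercive c (gramH X + lambda%:M)).
Variables (m : nat) (s : 'I_m -> 'cV[R]_n).
Hypothesis m0 : (0 < m)%N.

Local Notation psi := (influence X y lambda).
Local Notation beta := (ridge X y lambda).
Local Notation Hs := (sketchH X s).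
Local Notation H := (gramH X).
Local Notation S := (influence_sum X y lambda s).
Local Notation betas := (sketched_ridge X y lambda s).
Local Notation rm := (Num.sqrt m%:R : R).
Local Notation mean := (multinomial_mean (fun _ : 'I_m => m%:R^-1 : R) m).
Local Notation b k := (boot_influence_sum X y lambda s k).
Local Notation Kpsi := (2 * c ^- 2 * (1 + sqn beta)).
Local Notation dev k := (rm *: (boot_ridge X y lambda s k - betas)).

(** Empirical row moments produced by averaging over the weights are bounded through this quantity,
    whose expectation over the sketch is bounded. *)
Definition row_dev_avg : R := m%:R^-1 * \sum_i row_dev X y (s i) ^+ 2.

Let mr0 : 0 < m%:R :> R. Proof. by rewrite ltr0n. Qed.
Let Kpsi0 : 0 <= Kpsi.
Proof. by rewrite !mulr_ge0 ?invr_ge0 ?sqr_ge0// addr_ge0// sqn_ge0. Qed.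

Let p1 := uniform_weights_sum R m0.
Let p0 := @uniform_weights_ge0 R m.

Let avg_row_dev : m%:R^-1 * \sum_i row_dev X y (s i) <= 1 + row_dev_avg.
Proof.
have -> : 1 + row_dev_avg = m%:R^-1 * \sum_i (1 + row_dev X y (s i) ^+ 2).
  by rewrite big_split/= mulrDr sumr_const card_ord mulVf ?gt_eqF.
rewrite ler_wpM2l ?invr_ge0//; apply: ler_sum => i _.
by have := sqr_ge0 (row_dev X y (s i) - 1); have := row_dev_ge0 X y (s i); nra.
Qed.

Lemma mean_sqn_boot_influence : mean (fun k => sqn (b k)) <= Kpsi * (1 + row_dev_avg).
Proof.
have E k : sqn (b k) = \sum_a m%:R^-1 * (\sum_i ((k i)%:R - 1) * psi (s i) a 0) ^+ 2.
  rewrite sqnE; apply: eq_bigr => a _; rewrite mxE summxE exprMn exprVn sqr_sqrtr ?ler0n//.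
  by congr (_ * _ ^+ 2); apply: eq_bigr => i _; rewrite mxE.
rewrite (eq_multinomial_mean _ (fun k _ => E k)) multinomial_mean_sum.
apply: (@le_trans _ _ (\sum_a m%:R^-1 * \sum_i psi (s i) a 0 ^+ 2)).
  apply: ler_sum => a _; rewrite multinomial_meanZ ler_wpM2l//.
  exact: (bootstrap_sqr m0 (fun i => psi (s i) a 0)).
rewrite -mulr_sumr exchange_big/=.
apply: (@le_trans _ _ (m%:R^-1 * \sum_i Kpsi * row_dev X y (s i))).
  rewrite ler_wpM2l//; apply: ler_sum => i _; rewrite -sqnE.
  exact: sqn_influence_le.
by rewrite -mulr_sumr mulrCA ler_wpM2l.
Qed.

(** [bootstrap_sqr] entry by entry: m terms against the factor 1 / m^2 leave 1 / m. *)
Lemma mean_sqn_bootH : mean (fun k => sqn (bootH X s k - Hs)) <= (1 + row_dev_avg) / m%:R.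
Proof.
have E (k : {ffun 'I_m -> nat}) : (\sum_i k i = m)%N -> sqn (bootH X s k - Hs) =
    \sum_a \sum_e m%:R ^- 2 * (\sum_i ((k i)%:R - 1) * zz_dev X (s i) a e) ^+ 2.
  move=> km; rewrite bootH_dev//; apply: eq_bigr => a _; apply: eq_bigr => e _.
  rewrite mxE summxE exprMn exprVn.
  by congr (_ * _ ^+ 2); apply: eq_bigr => i _; rewrite mxE.
rewrite (eq_multinomial_mean _ E) multinomial_mean_sum.
apply: (@le_trans _ _ (\sum_a \sum_e m%:R ^- 2 * \sum_i zz_dev X (s i) a e ^+ 2)).
  apply: ler_sum => a _; rewrite multinomial_mean_sum; apply: ler_sum => e _.
  rewrite multinomial_meanZ ler_wpM2l ?invr_ge0 ?sqr_ge0//.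
  exact: (bootstrap_sqr m0 (fun i => zz_dev X (s i) a e)).
apply: (@le_trans _ _ (m%:R ^- 2 * \sum_i row_dev X y (s i))).
  under eq_bigr do rewrite -mulr_sumr exchange_big/=.
  rewrite -mulr_sumr exchange_big/= ler_wpM2l ?invr_ge0 ?sqr_ge0//.
  by apply: ler_sum => i _; rewrite lerDl sqn_ge0.
by rewrite exprS invfM -mulrA mulrC ler_wpM2r// ?invr_ge0// mulrC.
Qed.

(** |Hb - H|^2 <= 4 eta by the triangle inequality, and the normalized sketched error has squared
    norm at most 4 |S|^2, as it differs from S by at most |S|. Both terms of [boot_error_dist] then
    carry the factor 8. *)
Lemma boot_error_le (eta : R) (k : {ffun 'I_m -> nat}) : (\sum_i k i = m)%N -> 4 * eta <= (c / 2) ^+ 2 ->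
  sqn (Hs - H) <= eta -> sqn (bootH X s k - Hs) <= eta ->
  sqn (b k - dev k) <= 8 * (c / 2) ^- 2 * eta * (sqn (b k) + sqn S).
Proof.
move=> km eta4 Hse Hbe.
have eta0 : 0 <= eta by apply: le_trans Hse; exact: sqn_ge0.
have c2 : 0 < (c / 2) ^+ 2 by rewrite exprn_gt0// divr_gt0.
have Hb4 : sqn (bootH X s k - H) <= 4 * eta.
  have := sqnD_le (bootH X s k - Hs) (Hs - H); rewrite addrA subrK; lra.
have Hsc : sqn (Hs - H) <= (c / 2) ^+ 2 by lra.
have := boot_error_dist y c0 cM m0 km Hsc (le_trans Hb4 eta4).
move=> /le_trans; apply.
have S0 := sqn_ge0 S.
have S1 : sqn (S - rm *: (betas - beta)) <= sqn S.
  rewrite (le_trans (sketch_error_dist y c0 cM m0 Hsc))// mulrC ler_pdivrMr// mulrC.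
  by rewrite ler_wpM2l.
have S4 : sqn (rm *: (betas - beta)) <= 4 * sqn S.
  have := sqnD_le S (- (S - rm *: (betas - beta))); rewrite sqnN opprB addrC subrK.
  lra.
rewrite -mulrA -mulrA [leRHS]mulrCA ler_wpM2l ?invr_ge0 ?(ltW c2)//.
have b0 := sqn_ge0 (b k).
have h1 : sqn (bootH X s k - H) * sqn (b k) <= 4 * eta * sqn (b k) by rewrite ler_wpM2r.
have h2 : sqn (bootH X s k - Hs) * sqn (rm *: (betas - beta)) <= eta * (4 * sqn S).
  by rewrite ler_pM ?sqn_ge0.
lra.
Qed.

(** If both deviations of the Gram matrices are at most eta, the quadratic bound on h against q and
    [boot_error_le] apply; otherwise 2 M is at most 2 M / eta times a deviation exceeding eta. The
    sum of these bounds is averaged over the weights. *)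
Lemma boot_quadratic_test (h q : 'cV[R]_d -> R) (M K e eta : R) : 0 <= K -> 0 <= e ->
  (forall x, `|h x| <= M) -> (forall x, `|q x| <= M) ->
  (forall S S', `|h S' - q S| <= e * (1 + sqn S) + K * sqn (S - S')) ->
  0 < eta -> 4 * eta <= (c / 2) ^+ 2 ->
  mean (fun k => `|h (dev k) - q (b k)|) <=
    e * (1 + Kpsi * (1 + row_dev_avg)) +
    8 * K * (c / 2) ^- 2 * eta * (Kpsi * (1 + row_dev_avg) + sqn S) +
    2 * M / eta * ((1 + row_dev_avg) / m%:R + sqn (Hs - H)).
Proof.
move=> K0 e0 hM qM hq eta0 eta4.
have M0 : 0 <= M by apply: le_trans (hM 0).
have Q0 : 0 <= row_dev_avg by rewrite mulr_ge0// sumr_ge0// => i _; exact: sqr_ge0.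
have Me0 : 0 <= 2 * M / eta by rewrite !mulr_ge0// invr_ge0 ltW.
have C0 : 0 <= 8 * K * (c / 2) ^- 2 * eta.
  by rewrite !mulr_ge0 ?invr_ge0 ?sqr_ge0// ltW.
have S0 := sqn_ge0 S; have H0 := sqn_ge0 (Hs - H).
have triv k : `|h (dev k) - q (b k)| <= 2 * M.
  rewrite (le_trans (ler_normB _ _))// (le_trans (lerD (hM _) (qM _)))//; lra.
have big x : eta < x -> 2 * M <= 2 * M / eta * x.
  by move=> ex; rewrite mulrAC ler_pdivlMr// ler_wpM2l ?mulr_ge0// ltW.
have pw (k : {ffun 'I_m -> nat}) : (\sum_i k i = m)%N -> `|h (dev k) - q (b k)| <=
    (e + 8 * K * (c / 2) ^- 2 * eta * sqn S + 2 * M / eta * sqn (Hs - H)) +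
    ((e + 8 * K * (c / 2) ^- 2 * eta) * sqn (b k) + 2 * M / eta * sqn (bootH X s k - Hs)).
  move=> km; have b0 := sqn_ge0 (b k); have Hb0 := sqn_ge0 (bootH X s k - Hs).
  have t1 : 0 <= 8 * K * (c / 2) ^- 2 * eta * sqn S by exact: mulr_ge0.
  have t2 : 0 <= 2 * M / eta * sqn (Hs - H) by exact: mulr_ge0.
  have t3 : 0 <= 2 * M / eta * sqn (bootH X s k - Hs) by exact: mulr_ge0.
  have t4 : 0 <= (e + 8 * K * (c / 2) ^- 2 * eta) * sqn (b k) by rewrite mulr_ge0// addr_ge0.
  have [Hse|/big] := leP (sqn (Hs - H)) eta; last by have := triv k; lra.
  have [Hbe|/big] := leP (sqn (bootH X s k - Hs)) eta; last by have := triv k; lra.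
  rewrite (le_trans (hq _ _))//.
  have : K * sqn (b k - dev k) <= K * (8 * (c / 2) ^- 2 * eta * (sqn (b k) + sqn S)).
    by rewrite ler_wpM2l// boot_error_le.
  lra.
rewrite (le_trans (le_multinomial_mean p0 pw))// multinomial_meanD multinomial_mean_cst//.
rewrite multinomial_meanD !multinomial_meanZ.
have := mean_sqn_boot_influence; have := mean_sqn_bootH.
set A := mean _; set B := mean _ => hA hB.
have : (e + 8 * K * (c / 2) ^- 2 * eta) * B <= (e + 8 * K * (c / 2) ^- 2 * eta) * (Kpsi * (1 + row_dev_avg)).
  by rewrite ler_wpM2l// addr_ge0.
have : 2 * M / eta * A <= 2 * M / eta * ((1 + row_dev_avg) / m%:R) by rewrite ler_wpM2l.
lra.
Qed.

(** [bootstrap_cos] with its empirical moments replaced by quantities whose expectations are known.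
    The empirical mean of the projections is th.S / sqrt m, hence the term with 1 / m. *)
Lemma boot_cos_test (th : 'cV[R]_d) (a v sv : R) : 0 <= v ->
  `|mean (fun k => cos (a + dot th (b k))) - expR (- v / 2) * cos a| <=
  (rm * (m%:R^-1 * \sum_i dot th (psi (s i)) ^+ 2 - sv) ^+ 2 + rm^-1 + `|sv - v|
    + sqn th * sqn S / m%:R) / 2
  + (1 + 20 * ((sqn th * Kpsi) ^+ 2 * row_dev_avg) + v ^+ 2) / rm.
Proof.
move=> v0; have rm0 : 0 < rm by rewrite sqrtr_gt0.
have E k : cos (a + dot th (b k)) =
    cos (a + rm^-1 * \sum_i ((k i)%:R - 1) * dot th (psi (s i))).
  rewrite /boot_influence_sum dotZr; congr (cos (_ + _ * _)).
  rewrite dotC /dot; under eq_bigr do rewrite summxE mulr_suml.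
  rewrite exchange_big; apply: eq_bigr => i _ /=; rewrite mulr_sumr.
  by apply: eq_bigr => l _; rewrite mxE -mulrA (mulrC (psi _ _ _)).
rewrite (eq_multinomial_mean _ (fun k _ => E k)).
have := bootstrap_cos m0 (fun i => dot th (psi (s i))) a v0.
move=> /le_trans; apply; apply: lerD.
  rewrite ler_wpM2r// lerD//.
    set A := _ * _; rewrite (_ : A - v = (A - sv) + (sv - v)); last by ring.
    rewrite (le_trans (ler_normD _ _))// lerD2r -(real_normK (num_real (A - sv))).
    set x := `|_|; have x0 : 0 <= x by exact: normr_ge0.
    (* This gives x <= rm x^2 + 1 / rm: the absolute deviation is traded for its square, whose mean
       is of order 1 / m, at a cost of order 1 / sqrt m. *)
    have : 0 <= rm * (x - rm^-1) ^+ 2 + x by rewrite addr_ge0// mulr_ge0 ?sqr_ge0// ltW.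
    rewrite (_ : rm * (x - rm^-1) ^+ 2 + x = rm * x ^+ 2 + rm^-1 - x); first by lra.
    by field; rewrite gt_eqF.
  rewrite (_ : _ * _ = rm^-1 * dot th S).
    rewrite exprMn exprVn sqr_sqrtr ?ler0n// mulrC ler_wpM2r ?invr_ge0//.
    exact: dot_sqr_le.
  rewrite /influence_sum dotZr mulrA -invfM -expr2 sqr_sqrtr ?ler0n//; congr (_ * _).
  rewrite [RHS]dotC /dot; under [RHS]eq_bigr do rewrite summxE mulr_suml.
  rewrite [RHS]exchange_big; apply: eq_bigr => i _ /=.
  by apply: eq_bigr => l _; rewrite mulrC.
rewrite ler_wpM2r ?invr_ge0 ?(ltW rm0)// lerD2r lerD2l ler_wpM2l//.
rewrite /row_dev_avg mulrCA ler_wpM2l// mulr_sumr; apply: ler_sum => i _.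
rewrite (exprM _ 2 2) -exprMn ler_sqr ?nnegrE ?sqr_ge0//; last first.
  by rewrite mulr_ge0 ?row_dev_ge0// mulr_ge0 ?sqn_ge0.
rewrite (le_trans (dot_sqr_le _ _))// -[leRHS]mulrA ler_wpM2l ?sqn_ge0//.
exact: (sqn_influence_le y c0 cM).
Qed.

End bootstrap_tests.

Lemma Rintegral_linear_le dT (T : measurableType dT) (R : realType) (P : probability T R)
    (f u v w : T -> R) (k0 k1 k2 k3 U V W : R) : measurable_fun setT f ->
  P.-integrable setT (EFin \o u) -> P.-integrable setT (EFin \o v) ->
  P.-integrable setT (EFin \o w) -> 0 <= k1 -> 0 <= k2 -> 0 <= k3 ->
  \int[P]_t u t <= U -> \int[P]_t v t <= V -> \int[P]_t w t <= W ->
  (forall t, 0 <= f t <= k0 + k1 * u t + k2 * v t + k3 * w t) ->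
  \int[P]_t f t <= k0 + k1 * U + k2 * V + k3 * W.
Proof.
move=> mf iu iv iw k10 k20 k30 uU vV wW fle.
have i1 := integrableDR (integrable_cstR P k0) (integrableZR k1 iu).
have i2 := integrableDR i1 (integrableZR k2 iv).
have i3 := integrableDR i2 (integrableZR k3 iw).
have jf : P.-integrable setT (EFin \o f).
  apply: le_integrableR i3 => // t; have /andP[f0 fl] := fle t.
  by rewrite ger0_norm.
apply: (@le_trans _ _ (\int[P]_t (k0 + k1 * u t + k2 * v t + k3 * w t))).
  by apply: le_Rintegral => // t _; have /andP[] := fle t.
rewrite RintegralD//; last exact: integrableZR.
rewrite RintegralD//; last exact: integrableZR.
rewrite RintegralD//; [|exact: integrable_cstR|exact: integrableZR].
by rewrite Rintegral_cstP !RintegralZl// !lerD// ler_wpM2l.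
Qed.

(** * Measurability of the sketch statistics *)

Section sketch_measurability.
Context (R : realType) (n d m : nat) (X : 'M[R]_(n, d)) (y : 'cV[R]_n) (lambda : R).
Context dT (T : measurableType dT) (s : 'I_m -> T -> 'cV[R]_n).
Hypothesis ms : forall i, mx_measurable (s i).

Local Notation sketch t := (fun i => s i t).

Lemma measurable_influence_sum :
  mx_measurable (fun t => influence_sum X y lambda (sketch t)).
Proof.
apply: mx_measurableZ; first exact: measurable_cst.
by apply: mx_measurable_sum => i; exact: measurable_influence.
Qed.

Lemma measurable_sketchH : mx_measurable (fun t => sketchH X (sketch t)).
Proof.
apply: mx_measurableZ; first exact: measurable_cst.
by apply: mx_measurable_sum => i; exact: measurable_zz.
Qed.

Lemma measurable_sketched_ridge :
  mx_measurable (fun t => sketched_ridge X y lambda (sketch t)).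
Proof.
apply: mx_measurableM.
  apply: mx_measurable_inv; apply: mx_measurableD; last exact: mx_measurable_cst.
  exact: measurable_sketchH.
apply: mx_measurableZ; first exact: measurable_cst.
by apply: mx_measurable_sum => i; exact: measurable_zu.
Qed.

Variable k : {ffun 'I_m -> nat}.

Lemma measurable_boot_influence_sum :
  mx_measurable (fun t => boot_influence_sum X y lambda (sketch t) k).
Proof.
apply: mx_measurableZ; first exact: measurable_cst.
apply: mx_measurable_sum => i; apply: mx_measurableZ; first exact: measurable_cst.
exact: measurable_influence.
Qed.

Lemma measurable_boot_ridge : mx_measurable (fun t => boot_ridge X y lambda (sketch t) k).
Proof.
apply: mx_measurableM.
  apply: mx_measurable_inv; apply: mx_measurableD; last exact: mx_measurable_cst.
  apply: mx_measurableZ; first exact: measurable_cst.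
  apply: mx_measurable_sum => i; apply: mx_measurableZ; first exact: measurable_cst.
  exact: measurable_zz.
apply: mx_measurableZ; first exact: measurable_cst.
apply: mx_measurable_sum => i; apply: mx_measurableZ; first exact: measurable_cst.
exact: measurable_zu.
Qed.

Lemma measurable_boot_dev : mx_measurable (fun t => Num.sqrt m%:R *:
  (boot_ridge X y lambda (sketch t) k - sketched_ridge X y lambda (sketch t))).
Proof.
apply: mx_measurableZ; first exact: measurable_cst.
by apply: mx_measurableB; [exact: measurable_boot_ridge|exact: measurable_sketched_ridge].
Qed.

End sketch_measurability.

Lemma lipschitz_continuous (R : realType) d (h : 'cV[R]_d -> R) : lipschitz h -> continuous h.
Proof.
move=> lh.
have [K [K0 hK]] : exists K, 0 < K /\ forall x y, `|h x - h y| <= K * `|x - y|.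
  near (pinfty_nbhs R) => K; exists K; split; first by near: K; exact: nbhs_pinfty_gt.
  move=> x y.
  have : K.-lipschitz h by near: K.
  by move=> /(_ (x, y)); apply.
move=> x; apply/(@cvgrPdist_le _ _ _ _ (nbhs_filter x)) => e e0.
have : \forall z \near x, `|x - z| <= e / K.
  by apply/nbhs_normP; exists (e / K); [exact: divr_gt0|move=> z /ltW].
apply: (filterS (P := fun z => `|x - z| <= e / K)) => z xz.
by rewrite (le_trans (hK _ _))// mulrC -ler_pdivlMr.
Unshelve. all: by end_near.
Qed.

Lemma bounded_fun_le (R : realType) (T : Type) (h : T -> R) : bounded_fun h ->
  exists M, forall x, `|h x| <= M.
Proof.
move=> [M [_ /(_ (M + 1))]]; rewrite ltrDl ltr01 => /(_ isT) hM.
by exists (M + 1) => x; exact: hM.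
Qed.

(** * Limits along the sequence of designs *)

Section ridge_limits.
Context (R : realType) (d : nat) (m : nat -> nat).
Hypotheses (d0 : (0 < d)%N) (m_gt0 : forall n, (0 < m n)%N).
Hypothesis m_infty : m n @[n --> \oo] --> \oo.
Context (dT : nat -> measure_display) (T : forall n, measurableType (dT n)).
Variables (P : forall n, probability (T n) R) (X : forall n, 'M[R]_(n, d)).
Variables (y : forall n, 'cV[R]_n) (lambda : nat -> R).
Variable s : forall n, 'I_(m n) -> {RV (P n) >-> borelV R n}.
Variables (g : 'cV[R]_d) (c C4 : R) (Omega : 'M[R]_d) (N : probability (borelV R d) R).
Hypothesis g_cvg : crossg (X n) (y n) @[n --> \oo] --> g.
Hypothesis c0 : 0 < c.
Hypothesis eigen_lb : \forall n \near \oo, c <= lambda_min (gramH (X n) + (lambda n)%:M).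
Hypothesis s_indep : forall n, (0 < n)%N ->
  mutually_independent (P n) (fun i => s i : T n -> borelV R n).
Hypothesis s_ident : forall n, (0 < n)%N ->
  identically_distributed (P n) (fun i => s i : T n -> borelV R n).
Local Notation first n := (Ordinal (m_gt0 n)).
Hypothesis s_isotropic : forall n, (0 < n)%N ->
  mx_expectation (P n) (fun t => (s (first n) t : 'cV[R]_n) *m (s (first n) t : 'cV[R]_n)^T) = 1%:M.
Hypothesis mom : forall n, (0 < n)%N ->
  (\int[P n]_t (frobenius (zz_dev (X n) (s (first n) t)) ^+ 4 +
  frobenius (zu_dev (X n) (y n) (s (first n) t)) ^+ 4)%:E <= C4%:E)%E.
Hypothesis Omega_cvg : mx_expectation (P n) (fun t =>
    influence (X n) (y n) (lambda n) (s (first n) t : 'cV[R]_n) *m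
    (influence (X n) (y n) (lambda n) (s (first n) t : 'cV[R]_n))^T) @[n --> \oo] --> Omega.
Hypothesis hN : centered_normal Omega N.

Local Notation sketch n t := (fun i => s (n := n) i t : 'cV[R]_n).
Local Notation Hs n t := (sketchH (X n) (sketch n t)).
Local Notation H n := (gramH (X n)).
Local Notation betas n t := (sketched_ridge (X n) (y n) (lambda n) (sketch n t)).
Local Notation beta n := (ridge (X n) (y n) (lambda n)).
Local Notation S n t := (influence_sum (X n) (y n) (lambda n) (sketch n t)).
Local Notation rm n := (Num.sqrt (m n)%:R : R).

(** Eventually |g_n|^2 <= |g|^2 + 1, which through [sqn_ridge_le] makes the constants of the moment
    bounds independent of n. *)
Definition beta_bound := c ^- 2 * (sqn g + 1).
Definition psi_bound := 2 * c ^- 2 * (1 + beta_bound).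

Definition regular n := [/\ (0 < n)%N, coercive c (H n + (lambda n)%:M) & sqn (beta n) <= beta_bound].

Lemma near_regular : \forall n \near \oo, regular n.
Proof.
have cg : sqn (crossg (X n) (y n)) @[n --> \oo] --> sqn g.
  apply: (cvg_comp (fun n => crossg (X n) (y n)) (fun x : 'cV[R]_d => sqn x) g_cvg).
  exact: continuous_sqn.
near=> n.
have n0 : (0 < n)%N by near: n; exact: nbhs_infty_gt.
have gn : sqn (crossg (X n) (y n)) <= sqn g + 1.
  suff : `|sqn g - sqn (crossg (X n) (y n))| <= 1 by rewrite ler_norml => /andP[]; lra.
  by near: n; move/cvgrPdist_le: cg; exact.
have cM : coercive c (H n + (lambda n)%:M).
  apply: rayleigh_coercive => //; last by near: n.
  by rewrite linearD/= tr_scalar_mx /gramH linearZ/= trmx_mul trmxK.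
split => //; rewrite (le_trans (sqn_ridge_le _ c0 cM))// ler_wpM2l// invr_ge0 sqr_ge0.
Unshelve. all: by end_near.
Qed.

Local Notation mean n := (multinomial_mean (fun _ : 'I_(m n) => (m n)%:R^-1 : R) (m n)).
Local Notation b n t := (boot_influence_sum (X n) (y n) (lambda n) (sketch n t)).
Local Notation dev n t k :=
  (rm n *: (boot_ridge (X n) (y n) (lambda n) (sketch n t) k - betas n t)).
Local Notation Q n t := (row_dev_avg (X n) (y n) (sketch n t)).

Let m0 n : 0 < (m n)%:R :> R. Proof. by rewrite ltr0n. Qed.

Lemma cvg_mV (K : R) : K / (m n)%:R @[n --> \oo] --> 0.
Proof.
rewrite -(mulr0 K); apply: cvgMl_tmp.
apply: (cvg_comp m (fun k => k%:R^-1 : R) m_infty); apply/cvgrPdist_le => e e0.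
near=> k; rewrite sub0r normrN ger0_norm ?invr_ge0//.
have k0 : 0 < k%:R :> R by rewrite ltr0n; near: k; exact: nbhs_infty_gt.
rewrite -[leLHS]mul1r ler_pdivrMr// mulrC -ler_pdivrMr//.
by near: k; exact: nbhs_infty_ger.
Unshelve. all: by end_near.
Qed.

Lemma cvg_rmV (K : R) : K / rm n @[n --> \oo] --> 0.
Proof.
have := cvg_mV 1 => h1; rewrite -(mulr0 K); apply: cvgMl_tmp.
rewrite -(@sqrtr0 R) (_ : (fun n => _) = fun n => Num.sqrt (1 / (m n)%:R)).
  by apply: (cvg_comp (fun n => 1 / (m n)%:R) Num.sqrt h1); exact: sqrt_continuous.
by apply/funext => n; rewrite div1r sqrtrV ?ler0n.
Qed.

Let ms n i : mx_measurable (fun t => s i t : 'cV[R]_n).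
Proof. by move=> k l; rewrite ord1; exact: (measurableT_comp (measurable_coord k)). Qed.

Let C40 : 0 <= C4.
Proof.
rewrite -lee_fin (le_trans _ (mom (ltn0Sn 0)))//; apply: integral_ge0 => t _.
by rewrite lee_fin !frobenius4 addr_ge0// sqr_ge0.
Qed.

Lemma psi_bound_le n : regular n -> 2 * c ^- 2 * (1 + sqn (beta n)) <= psi_bound.
Proof. by move=> [_ _ bn]; rewrite ler_wpM2l ?lerD2l// mulr_ge0// invr_ge0 sqr_ge0. Qed.

Local Notation var n th := (direction_var (X n) (y n) (lambda n) (s (n := n)) (first n) th).

Lemma cvg_direction_var (th : 'cV[R]_d) : var n th @[n --> \oo] --> dot th (Omega *m th).
Proof.
have cO : dot th (mx_expectation (P n) (fun t =>
    influence (X n) (y n) (lambda n) (s (first n) t : 'cV[R]_n) *m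
    (influence (X n) (y n) (lambda n) (s (first n) t : 'cV[R]_n))^T) *m th) @[n --> \oo] -->
    dot th (Omega *m th).
  apply: cvg_big => [|a _]; first exact: add_continuous.
  apply: cvgMl_tmp; rewrite mxE; under eq_fun do rewrite mxE.
  apply: cvg_big => [|b _]; first exact: add_continuous.
  apply: cvgMr_tmp; apply: (cvg_comp _ (fun A : 'M[R]_d => A a b) Omega_cvg).
  exact: coord_continuous.
apply: cvg_trans cO; apply: near_eq_cvg; near=> n.
have [n0 cM _] : regular n by near: n; exact: near_regular.
by rewrite (direction_varE c0 cM (s_ident n0) (mom n0)).
Unshelve. all: by end_near.
Qed.

(** Read off from the factorization L L^T provided by [hN]. *)
Lemma Omega_ge0 (th : 'cV[R]_d) : 0 <= dot th (Omega *m th).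
Proof.
have [k [L [nu [_ <- _]]]] := hN.
by rewrite -mulmxA dot_trmx -sqn_dot sqn_ge0.
Qed.

Lemma Hs_dev_cvg : \int[P n]_t sqn (Hs n t - H n) @[n --> \oo] --> 0.
Proof.
apply: (@squeeze_cvgr _ _ _ _ (fun=> 0) (fun n => d%:R ^+ 2 * (1 + 2 * C4) / (m n)%:R)).
- near=> n; have n0 : (0 < n)%N by near: n; exact: nbhs_infty_gt.
  rewrite (sketchH_dev_le (s_indep n0) (s_ident n0) (s_isotropic n0) (mom n0)).2 andbT.
  by apply: Rintegral_ge0 => t _; exact: sqn_ge0.
- exact: cvg_cst.
- exact: cvg_mV.
Unshelve. all: by end_near.
Qed.

Definition var4_bound (th : 'cV[R]_d) := (sqn th * psi_bound) ^+ 2 * (2 * C4).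

Lemma var4_bound_le n (th : 'cV[R]_d) : regular n ->
  (sqn th * (2 * c ^- 2 * (1 + sqn (beta n)))) ^+ 2 * (2 * C4) <= var4_bound th.
Proof.
move=> rn; have K0 : 0 <= 2 * c ^- 2 * (1 + sqn (beta n)).
  by rewrite !mulr_ge0 ?invr_ge0 ?sqr_ge0// addr_ge0// sqn_ge0.
have Kb := psi_bound_le rn; have P0 := le_trans K0 Kb.
have th0 := sqn_ge0 th.
by rewrite ler_wpM2r ?mulr_ge0// ler_sqr ?nnegrE ?(mulr_ge0 th0)// ler_wpM2l.
Qed.

Lemma influence_sum_cos_cvg (a : R) (th : 'cV[R]_d) :
  \int[P n]_t cos (a + dot th (S n t)) @[n --> \oo] -->
  expR (- dot th (Omega *m th) / 2) * cos a.
Proof.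
set v := dot th _; have v0 : 0 <= v by exact: Omega_ge0.
have cb : `|var n th - v| / 2 + (1 + 2 * var4_bound th + v ^+ 2) / rm n @[n --> \oo] --> 0.
  rewrite -[X in _ --> X]addr0; apply: cvgD; last exact: cvg_rmV.
  rewrite -(mul0r 2^-1); apply: cvgMr_tmp; rewrite -(normr0 R).
  apply: cvg_norm; rewrite -(subrr v); apply: cvgB; [exact: cvg_direction_var|exact: cvg_cst].
apply/cvgrPdist_le => e e0; near=> n.
have rn : regular n by near: n; exact: near_regular.
have [n0 cM _] := rn.
rewrite distrC.
have := influence_sum_cos c0 cM (s_indep n0) (s_ident n0) (s_isotropic n0) (mom n0) th a v0.
move=> /le_trans; apply.
apply: (@le_trans _ _ (`|var n th - v| / 2 + (1 + 2 * var4_bound th + v ^+ 2) / rm n)).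
  rewrite lerD2l ler_wpM2r ?invr_ge0 ?sqrtr_ge0// lerD2r lerD2l ler_wpM2l//.
  exact: var4_bound_le.
have : `|0 - (`|var n th - v| / 2 + (1 + 2 * var4_bound th + v ^+ 2) / rm n)| <= e.
  by near: n; move/cvgrPdist_le: cb; exact.
by rewrite sub0r normrN; apply: le_trans; exact: ler_norm.
Unshelve. all: by end_near.
Qed.

Lemma sketched_ridge_test (h : 'cV[R]_d -> R) (M : R) : continuous h ->
  (forall x, `|h x| <= M) ->
  \int[P n]_t h (rm n *: (betas n t - beta n)) @[n --> \oo] --> \int[N]_x h x.
Proof.
move=> ch hM.
apply: (@cvg_continuous_test _ _ _ _ hN d0 _ _ P (fun n t => S n t)
  (fun n t => rm n *: (betas n t - beta n)) (fun n t => sqn (Hs n t - H n))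
  (d%:R * (psi_bound * (1 + 2 * C4))) ((c / 2) ^- 2) ((c / 2) ^+ 2)) ch hM.
- by rewrite exprn_gt0// divr_gt0.
- apply: nearW => n; split; first exact: (measurable_influence_sum _ _ _ (@ms n)).
  apply: mx_measurableZ; first exact: measurable_cst.
  by apply: mx_measurableB; [exact: (measurable_sketched_ridge _ _ _ (@ms n))|exact: mx_measurable_cst].
- near=> n; have rn : regular n by near: n; exact: near_regular.
  have [n0 cM _] := rn.
  have [iS ES] := influence_sum_le c0 cM (s_indep n0) (s_ident n0) (s_isotropic n0) (mom n0).
  split=> //; rewrite (le_trans ES)// ler_wpM2l// ler_wpM2r ?psi_bound_le//.
  by rewrite addr_ge0// mulr_ge0.
- by move=> n t; exact: sqn_ge0.
- near=> n; have n0 : (0 < n)%N by near: n; exact: nbhs_infty_gt.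
  exact: (sketchH_dev_le (s_indep n0) (s_ident n0) (s_isotropic n0) (mom n0)).1.
- exact: Hs_dev_cvg.
- near=> n; move=> t; have [n0 cM _] : regular n by near: n; exact: near_regular.
  by move=> /(sketch_error_dist (y n) c0 cM (m_gt0 n)).
- exact: influence_sum_cos_cvg.
Unshelve. all: by end_near.
Qed.

Definition sum_bound := d%:R * (psi_bound * (1 + 2 * C4)).

Lemma influence_sum_bound n : regular n ->
  (P n).-integrable setT (EFin \o (fun t => sqn (S n t))) /\
  \int[P n]_t sqn (S n t) <= sum_bound.
Proof.
move=> rn; have [n0 cM _] := rn.
have [iS ES] := influence_sum_le c0 cM (s_indep n0) (s_ident n0) (s_isotropic n0) (mom n0).
split=> //; rewrite (le_trans ES)// ler_wpM2l// ler_wpM2r ?psi_bound_le//.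
by rewrite addr_ge0// mulr_ge0.
Qed.

Lemma row_dev_avg_le n : (0 < n)%N ->
  (P n).-integrable setT (EFin \o (fun t => Q n t)) /\ \int[P n]_t Q n t <= 2 * C4.
Proof.
move=> n0; have H i := row_dev_sqr (s_ident n0) (mom n0) i.
have iS : (P n).-integrable setT (EFin \o (fun t => \sum_i row_dev (X n) (y n) (s i t) ^+ 2)).
  by apply: integrable_sumR => i; exact: (H i).1.
split; first exact: integrableZR.
rewrite RintegralZl// Rintegral_sum; last by move=> i; exact: (H i).1.
rewrite mulrC ler_pdivrMr// (le_trans (ler_sum _ (fun i _ => (H i).2)))//.
by rewrite sumr_const card_ord -[leLHS]mulr_natr.
Qed.

Lemma measurable_boot_cos n (a : R) (th : 'cV[R]_d) :
  measurable_fun setT (fun t => mean n (fun k => cos (a + dot th (b n t k)))).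
Proof.
apply: measurable_multinomial_mean => k; apply: measurable_cos_comp.
apply: measurable_funD; first exact: measurable_cst.
by apply: measurable_dot_comp; exact: (measurable_boot_influence_sum _ _ _ (@ms n)).
Qed.

Lemma psi_bound_ge0 : 0 <= psi_bound.
Proof.
have c20 : 0 <= c ^- 2 by rewrite invr_ge0 sqr_ge0.
have g0 := sqn_ge0 g.
by rewrite !mulr_ge0// addr_ge0// mulr_ge0// addr_ge0.
Qed.

Lemma psi_ge0 n : 0 <= 2 * c ^- 2 * (1 + sqn (beta n)).
Proof. by rewrite !mulr_ge0 ?invr_ge0 ?sqr_ge0// addr_ge0// sqn_ge0. Qed.

(** The bound of [boot_cos_test] is affine in [row_dev_avg], |S|^2 and the squared deviation of the
    empirical variance, so it integrates to U. *)
Lemma boot_cos_cvg (a : R) (th : 'cV[R]_d) :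
  \int[P n]_t `|mean n (fun k => cos (a + dot th (b n t k)))
     - expR (- dot th (Omega *m th) / 2) * cos a| @[n --> \oo] --> 0.
Proof.
set v := dot th _; have v0 : 0 <= v by exact: Omega_ge0.
pose Z := (sqn th * psi_bound) ^+ 2.
(* The last term is sqrt m / 2 times a bound of order 1 / m, hence still of order 1 / sqrt m. *)
pose U n := (1 / rm n + `|var n th - v|) / 2 + (1 + v ^+ 2) / rm n
  + 20 * Z / rm n * (2 * C4) + sqn th / (m n)%:R / 2 * sum_bound
  + rm n / 2 * (var4_bound th / (m n)%:R).
have cU : U n @[n --> \oo] --> 0.
  rewrite (_ : U = fun n => (1 / rm n + `|var n th - v|) / 2 + (1 + v ^+ 2) / rm n
      + (20 * Z * (2 * C4)) / rm n + (sqn th / 2 * sum_bound) / (m n)%:R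
      + (var4_bound th / 2) / rm n).
    rewrite -[X in _ --> X]addr0; apply: cvgD; last exact: cvg_rmV.
    rewrite -[X in _ --> X]addr0; apply: cvgD; last exact: cvg_mV.
    rewrite -[X in _ --> X]addr0; apply: cvgD; last exact: cvg_rmV.
    rewrite -[X in _ --> X]addr0; apply: cvgD; last exact: cvg_rmV.
    rewrite -(mul0r 2^-1); apply: cvgMr_tmp.
    rewrite -[X in _ --> X]addr0; apply: cvgD; first exact: cvg_rmV.
    rewrite -(normr0 R); apply: cvg_norm; rewrite -(subrr v).
    by apply: cvgB; [exact: cvg_direction_var|exact: cvg_cst].
  apply/funext => n; rewrite /U.
  have rm0 : rm n != 0 by rewrite gt_eqF// sqrtr_gt0.
  have E : (m n)%:R = rm n ^+ 2 by rewrite sqr_sqrtr ?ler0n.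
  move: (rm n) rm0 E => r r0 ->.
  by field; rewrite r0.
apply: (@squeeze_cvgr _ _ _ _ (fun=> 0) U) => //; last exact: cvg_cst.
near=> n; apply/andP; split; first exact: Rintegral_ge0.
have rn : regular n by near: n; exact: near_regular.
have [n0 cM _] := rn.
have rm0 : 0 < rm n by rewrite sqrtr_gt0.
have [iQ EQ] := row_dev_avg_le n0; have [iS ES] := influence_sum_bound rn.
have [ix Ex] := direction_avg_le c0 cM (s_indep n0) (s_ident n0) (mom n0) th.
have Ex' : \int[P n]_t (((m n)%:R^-1 * \sum_i dot th (influence (X n) (y n) (lambda n) (s i t)) ^+ 2
    - var n th) ^+ 2) <= var4_bound th / (m n)%:R.
  by rewrite (le_trans Ex)// ler_wpM2r ?invr_ge0// var4_bound_le.
have Z0 : 0 <= Z by exact: sqr_ge0.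
apply: (Rintegral_linear_le _ iQ iS ix _ _ _ EQ ES Ex').
- apply: measurableT_comp => //; apply: measurable_funB; first exact: measurable_boot_cos.
  exact: measurable_cst.
- by rewrite divr_ge0 ?(ltW rm0)// mulr_ge0.
- by rewrite !divr_ge0 ?sqn_ge0.
- by rewrite divr_ge0// ltW.
move=> t; rewrite normr_ge0/= (le_trans (boot_cos_test (y n) c0 cM (sketch n t) (m_gt0 n) th a (var n th) v0))//.
have Q0 : 0 <= Q n t by rewrite mulr_ge0 ?invr_ge0// sumr_ge0// => i _; exact: sqr_ge0.
have Kb := psi_bound_le rn; have Kn := psi_ge0 n.
move: Kb Kn; set Kp := 2 * c ^- 2 * _ => Kb Kn.
have ZK : (sqn th * Kp) ^+ 2 <= Z.
  have th0 := sqn_ge0 th.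
  by rewrite ler_sqr ?nnegrE ?(mulr_ge0 th0) ?psi_bound_ge0// ler_wpM2l.
have : 20 * ((Z - (sqn th * Kp) ^+ 2) * Q n t) / rm n >= 0.
  by rewrite divr_ge0 ?(ltW rm0)// mulr_ge0// mulr_ge0// subr_ge0.
lra.
Unshelve. all: by end_near.
Qed.

Lemma boot_trig_cvg (l : seq (R * 'cV[R]_d * R)) :
  \int[P n]_t `|mean n (fun k => trig_eval l (b n t k)) - \int[N]_x trig_eval l x|
    @[n --> \oo] --> 0.
Proof.
pose f n (q : R * 'cV[R]_d * R) t := `|mean n (fun k => cos (q.2 + dot q.1.2 (b n t k)))
  - expR (- dot q.1.2 (Omega *m q.1.2) / 2) * cos q.2|.
have mf n q : measurable_fun setT (f n q).
  by apply: measurableT_comp => //; apply: measurable_funB; [exact: measurable_boot_cos|].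
have jf n q : (P n).-integrable setT (EFin \o f n q).
  apply: (@bounded_integrable _ _ _ _ _ (1 + `|expR (- dot q.1.2 (Omega *m q.1.2) / 2) * cos q.2|)) => // t.
  rewrite /f normr_id (le_trans (ler_normB _ _))// lerD2r.
  apply: norm_multinomial_mean_le; [exact: uniform_weights_sum|exact: uniform_weights_ge0|].
  by move=> k _; exact: norm_cos_le1.
apply: (@squeeze_cvgr _ _ _ _ (fun=> 0) (fun n => \sum_(q <- l) `|q.1.1| * \int[P n]_t f n q t)).
- apply: nearW => n; apply/andP; split; first exact: Rintegral_ge0.
  have jZ q : (P n).-integrable setT (EFin \o (fun t => `|q.1.1| * f n q t)) by exact: integrableZR.
  rewrite [leRHS](_ : _ = \int[P n]_t \sum_(q <- l) `|q.1.1| * f n q t); last first.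
    by rewrite Rintegral_sum//; apply: eq_bigr => q _; rewrite RintegralZl.
  have le t : `|mean n (fun k => trig_eval l (b n t k)) - \int[N]_x trig_eval l x| <=
      \sum_(q <- l) `|q.1.1| * f n q t.
    rewrite (trig_law hN) /trig_eval multinomial_mean_sum -sumrB (le_trans (ler_norm_sum _ _ _))//.
    by apply: ler_sum => q _; rewrite multinomial_meanZ -mulrBr normrM.
  have iR : (P n).-integrable setT (EFin \o (fun t => \sum_(q <- l) `|q.1.1| * f n q t)).
    exact: integrable_sumR.
  apply: le_Rintegral => //.
  apply: le_integrableR iR; last by move=> t; rewrite normr_id.
  apply: measurableT_comp => //; apply: measurable_funB; last exact: measurable_cst.
  apply: measurable_multinomial_mean => k; apply: measurable_trig_comp; first by exists l.
  exact: (measurable_boot_influence_sum _ _ _ (@ms n)).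
- exact: cvg_cst.
- rewrite [X in _ --> X](_ : _ = \sum_(q <- l) `|q.1.1| * 0); last by rewrite big1// => q _; rewrite mulr0.
  apply: cvg_big => [|q _]; first exact: add_continuous.
  by apply: cvgMl_tmp; exact: boot_cos_cvg.
Qed.

Lemma measurable_boot_test n (h : 'cV[R]_d -> R) (M : R) k : continuous h ->
  (forall x, `|h x| <= M) -> measurable_fun setT (fun t => h (dev n t k)).
Proof.
move=> ch hM; apply: (measurable_continuous_comp d0 ch hM).
exact: (measurable_boot_dev _ _ _ (@ms n)).
Qed.

(** Three errors: h against its trigonometric approximant inside the multinomial average ([A]), the
    approximant's average against its Gaussian integral ([B]), and the two Gaussian integrals. *)
Lemma sketched_boot_test (h : 'cV[R]_d -> R) (M : R) : continuous h ->
  (forall x, `|h x| <= M) ->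
  \int[P n]_t `|mean n (fun k => h (dev n t k)) - \int[N]_x h x| @[n --> \oo] --> 0.
Proof.
move=> ch hM.
have M0 : 0 <= M by apply: le_trans (hM 0).
pose V := psi_bound * (1 + 2 * C4).
have V0 : 0 <= V by rewrite mulr_ge0 ?psi_bound_ge0// addr_ge0// mulr_ge0.
have SB0 : 0 <= sum_bound by exact: mulr_ge0.
(* V + 5: the mean of [A] is at most e (1 + V) + 2 e, while [B] and the Gaussian integrals
   contribute e each. *)
have key e : 0 < e -> \forall n \near \oo,
    \int[P n]_t `|mean n (fun k => h (dev n t k)) - \int[N]_x h x| <= e * (V + 5).
  move=> e0; have [q [K K0 [[l ql] qM qN hq]]] := trig_approx_law hM d0 ch N e0.
  have c2 : 0 < (c / 2) ^+ 2 by rewrite exprn_gt0// divr_gt0.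
  pose L := 8 * K * (c / 2) ^- 2.
  have L0 : 0 <= L by rewrite mulr_ge0 ?invr_ge0 ?(ltW c2)// mulr_ge0.
  have LV : 0 < 1 + L * (V + sum_bound) by rewrite ltr_wpDr// mulr_ge0// addr_ge0.
  (* The first entry keeps the perturbed matrices coercive, the second makes the mean of the
     quadratic error at most e. *)
  pose eta := Num.min ((c / 2) ^+ 2 / 4) (e / (1 + L * (V + sum_bound))).
  have eta0 : 0 < eta by rewrite lt_min !divr_gt0.
  have eta4 : 4 * eta <= (c / 2) ^+ 2.
    by rewrite mulrC -ler_pdivlMr// ge_min lexx.
  have etaL : L * eta * (V + sum_bound) <= e.
    apply: (@le_trans _ _ ((1 + L * (V + sum_bound)) * eta)).
      by rewrite mulrAC ler_wpM2r ?(ltW eta0)// lerDr.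
    by rewrite mulrC -ler_pdivlMr// ge_min lexx orbT.
  have cD : 2 * M / eta * ((1 + 2 * C4) / (m n)%:R + \int[P n]_t sqn (Hs n t - H n)) @[n --> \oo] --> 0.
    rewrite -(mulr0 (2 * M / eta)); apply: cvgMl_tmp; rewrite -[X in _ --> X]addr0.
    by apply: cvgD; [exact: cvg_mV|exact: Hs_dev_cvg].
  have cT := boot_trig_cvg l.
  near=> n.
  have rn : regular n by near: n; exact: near_regular.
  have [n0 cM _] := rn.
  have [iQ EQ] := row_dev_avg_le n0; have [iS ES] := influence_sum_bound rn.
  have [iD _] := sketchH_dev_le (s_indep n0) (s_ident n0) (s_isotropic n0) (mom n0).
  have tD : 2 * M / eta * ((1 + 2 * C4) / (m n)%:R + \int[P n]_t sqn (Hs n t - H n)) <= e.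
    have : `|0 - 2 * M / eta * ((1 + 2 * C4) / (m n)%:R + \int[P n]_t sqn (Hs n t - H n))| <= e.
      by near: n; move/cvgrPdist_le: cD; exact.
    by rewrite sub0r normrN; apply: le_trans; exact: ler_norm.
  have tT : \int[P n]_t `|mean n (fun k => trig_eval l (b n t k)) - \int[N]_x trig_eval l x| <= e.
    have : `|0 - \int[P n]_t `|mean n (fun k => trig_eval l (b n t k)) - \int[N]_x trig_eval l x| | <= e.
      by near: n; move/cvgrPdist_le: cT; exact.
    by rewrite sub0r normrN; apply: le_trans; exact: ler_norm.
  have mh k := measurable_boot_test k ch hM.
  have mq k : measurable_fun setT (fun t : T n => trig_eval l (b n t k)).
    apply: measurable_trig_comp; first by exists l.
    exact: (measurable_boot_influence_sum _ _ _ (@ms n)).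
  pose A (t : T n) := mean n (fun k => `|h (dev n t k) - trig_eval l (b n t k)|).
  pose B (t : T n) := `|mean n (fun k => trig_eval l (b n t k)) - \int[N]_x trig_eval l x|.
  have mA : measurable_fun setT A.
    apply: measurable_multinomial_mean => k; apply: measurableT_comp => //.
    exact: measurable_funB.
  have mB : measurable_fun setT B.
    apply: measurableT_comp => //; apply: measurable_funB; last exact: measurable_cst.
    exact: measurable_multinomial_mean.
  have p1 := uniform_weights_sum R (m_gt0 n); have p0 := @uniform_weights_ge0 R (m n).
  have tM x : `|trig_eval l x| <= M by rewrite -ql.
  have AM t : `|A t| <= 2 * M.
    apply: norm_multinomial_mean_le => // k _; rewrite normr_id (le_trans (ler_normB _ _))//.
    by rewrite [leRHS]mulr_natl mulr2n lerD.
  have BM t : `|B t| <= M + `|\int[N]_x trig_eval l x|.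
    rewrite normr_id (le_trans (ler_normB _ _))// lerD2r.
    by apply: norm_multinomial_mean_le.
  have jA := bounded_integrable (P n) mA AM.
  have jB := bounded_integrable (P n) mB BM.
  have EA : \int[P n]_t A t <= e * (1 + V) + L * eta * (V + sum_bound) +
     2 * M / eta * ((1 + 2 * C4) / (m n)%:R + \int[P n]_t sqn (Hs n t - H n)).
    (* The total coefficient of [row_dev_avg], with the constants replaced by [psi_bound]. It recurs
       in the constant term because the average always enters as 1 plus itself. *)
    pose k1 := (e + L * eta) * psi_bound + 2 * M / eta / (m n)%:R.
    have Me0 : 0 <= 2 * M / eta by rewrite divr_ge0 ?(ltW eta0)// mulr_ge0.
    have Le0 : 0 <= L * eta by rewrite mulr_ge0// ltW.
    have k10 : 0 <= k1.
      apply: addr_ge0; last by rewrite divr_ge0.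
      by apply: mulr_ge0 psi_bound_ge0; rewrite addr_ge0 ?(ltW e0).
    apply: (@le_trans _ _ (e + k1 + k1 * (2 * C4) + L * eta * sum_bound +
        2 * M / eta * \int[P n]_t sqn (Hs n t - H n))); last first.
      by rewrite le_eqVlt; apply/orP; left; apply/eqP; rewrite /k1 /V; ring.
    apply: (Rintegral_linear_le mA iQ iS iD _ _ _ EQ ES (lexx _)) => // t.
    apply/andP; split.
      rewrite -(multinomial_mean_cst p1 (m n) 0); apply: le_multinomial_mean => // k _.
    have hq' S S' : `|h S' - trig_eval l S| <= e * (1 + sqn S) + K * sqn (S - S').
      by rewrite -ql.
    rewrite (le_trans (boot_quadratic_test (y n) c0 cM (sketch n t) (m_gt0 n) K0 (ltW e0) hM tM hq' eta0 eta4))//.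
    have Q0 : 0 <= Q n t by rewrite mulr_ge0 ?invr_ge0// sumr_ge0// => i _; exact: sqr_ge0.
    have := psi_bound_le rn; set Kp := 2 * c ^- 2 * _ => Kb.
    rewrite /k1 -/L.
    have : (e + L * eta) * ((psi_bound - Kp) * (1 + Q n t)) >= 0.
      by rewrite mulr_ge0 ?addr_ge0 ?(ltW e0)// mulr_ge0 ?subr_ge0// addr_ge0.
    set SS := sqn _; set DD := sqn _; move: (Q n t) => QQ.
    rewrite -subr_ge0 => hh; rewrite -subr_ge0; apply: le_trans hh _.
    by rewrite le_eqVlt; apply/orP; left; apply/eqP; ring.
  apply: (@le_trans _ _ (\int[P n]_t (A t + B t + e))).
    have jAB := integrableDR (integrableDR jA jB) (integrable_cstR (P n) e).
    have le t : `|mean n (fun k => h (dev n t k)) - \int[N]_x h x| <= A t + B t + e.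
      have -> : mean n (fun k => h (dev n t k)) - \int[N]_x h x =
        mean n (fun k => h (dev n t k) - trig_eval l (b n t k)) +
        (mean n (fun k => trig_eval l (b n t k)) - \int[N]_x trig_eval l x) +
        (\int[N]_x trig_eval l x - \int[N]_x h x).
        by rewrite multinomial_meanB; ring.
      rewrite (le_trans (ler_normD _ _))// lerD//; last first.
        rewrite (_ : \int[N]_x trig_eval l x = \int[N]_x q x)//.
        by apply: eq_Rintegral => x _; rewrite ql.
      rewrite (le_trans (ler_normD _ _))// lerD2r.
      have := multinomial_mean_dist p1 p0 (m n) (fun k => h (dev n t k) - trig_eval l (b n t k)) 0.
      rewrite subr0 => /le_trans; apply; rewrite /A.
      by apply: le_multinomial_mean => // k _; rewrite subr0.
    apply: le_Rintegral => //.
    apply: le_integrableR jAB; last by move=> t; rewrite normr_id.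
    apply: measurableT_comp => //; apply: measurable_funB; last exact: measurable_cst.
    exact: measurable_multinomial_mean.
  rewrite RintegralD//; [|exact: integrableDR|exact: integrable_cstR].
  rewrite RintegralD// Rintegral_cstP.
  rewrite (le_trans (lerD (lerD EA tT) (lexx e)))//.
  by rewrite [leRHS](_ : _ = e * (1 + V) + e + e + e + e); [rewrite !lerD|ring].
apply/cvgrPdist_le => e e0.
have V5 : 0 < V + 5 by lra.
have /key : 0 < e / (V + 5) by rewrite divr_gt0.
rewrite divfK ?gt_eqF//; apply: filterS => n.
by rewrite sub0r normrN ger0_norm// Rintegral_ge0.
Unshelve. all: by end_near.
Qed.

Lemma sketched_ridge_weak :
  cvg_weakly P (fun n t => rm n *: (betas n t - beta n)) N.
Proof.
move=> h ch /bounded_fun_le[M hM].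
have mh n : measurable_fun setT (fun t => h (rm n *: (betas n t - beta n))).
  apply: (measurable_continuous_comp d0 ch hM).
  apply: mx_measurableZ; first exact: measurable_cst.
  apply: mx_measurableB; last exact: mx_measurable_cst.
  exact: (measurable_sketched_ridge _ _ _ (@ms n)).
have jh n := bounded_integrable (P n) (mh n) (fun t => hM _).
have jN : N.-integrable setT (EFin \o h).
  exact: (bounded_integrable N (measurable_borelV_continuous ch) hM).
rewrite -(fineK (integrable_fin_num measurableT jN)).
apply: cvg_EFin; first by apply: nearW => n; rewrite unlock; exact: integrable_fin_num.
by rewrite unlock; exact: sketched_ridge_test.
Qed.

Variable w : forall n, T n -> {ffun 'I_(m n) -> nat}.
Local Notation F n := (g_sigma_preimage (fun i => s (n := n) i : T n -> borelV R n)).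
Hypothesis hw : forall n, (0 < n)%N ->
  cond_multinomial (P n) (F n) (m n) (fun=> (m n)%:R^-1) (w (n := n)).

Lemma sketch_sigma_measurable n A : F n A -> measurable A.
Proof.
apply: smallest_sub; first exact: sigma_algebra_measurable.
apply: (big_ind (fun Y : set (set (T n)) => Y `<=` measurable)) => //.
  by move=> Y Z hY hZ B [/hY|/hZ].
move=> i _ _ [B mB <-]; rewrite setTI.
exact: (measurable_preim (measurable_funP (s i))).
Qed.

Lemma boot_cond_weak :
  cvg_cond_weakly P (fun n => F n) (fun n t => dev n t (w t)) N.
Proof.
move=> h lh /bounded_fun_le[M hM].
have ch : continuous h by exact: lipschitz_continuous.
move=> eps eps0.
have Zb := sketched_boot_test ch hM.
apply: (@squeeze_cvge _ _ _ _ (fun=> 0%E) _ (fun n =>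
    (2 / eps * \int[P n]_t `|mean n (fun k => h (dev n t k)) - \int[N]_x h x|)%:E)).
- near=> n; rewrite measure_ge0/=; have n0 : (0 < n)%N by near: n; exact: nbhs_infty_gt.
  apply: (@cond_expectation_prob _ _ _ (P n) (F n) (@sketch_sigma_measurable n)) => //.
  apply: (cond_multinomial_expectation (@sketch_sigma_measurable n) (m_gt0 n) (hw n0)
    (G := fun t k => h (dev n t k)) (fun t k => hM _)) => k.
  apply: (measurable_continuous_comp d0 ch hM); apply: measurable_boot_dev => i a l.
  (* The explicit version must be measurable for the sketch sigma-algebra: a preimage under a
     coordinate of the i-th row is one of its generators. *)
  rewrite ord1 => _ B mB; rewrite setTI; apply: sub_sigma_algebra.
  rewrite (bigD1 i)//=; left; exists ((fun x : 'cV[R]_n => x a 0) @^-1` B).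
    exact: (measurable_preim (measurable_coord a)).
  by rewrite setTI.
- exact: cvg_cst.
- apply: cvg_EFin; first exact: nearW.
  rewrite -(mulr0 (2 / eps)); apply: cvgMl_tmp; exact: Zb.
Unshelve. all: by end_near.
Qed.

End ridge_limits.

Theorem theorem1 (R : realType) (d : nat) (hd : (1 <= d)%N)
  (m : nat -> nat) (m_gt0 : forall n, (0 < m n)%N)
  (m_infty : m n @[n --> \oo] --> \oo)
  (dT : nat -> measure_display) (T : forall n, measurableType (dT n))
  (P : forall n, probability (T n) R)
  (X : forall n, 'M[R]_(n, d)) (y : forall n, 'cV[R]_n)
  (lambda : nat -> R) (lambda_gt0 : forall n, (0 < n)%N -> 0 < lambda n)
  (s : forall n, 'I_(m n) -> {RV (P n) >-> borelV R n})
  (w : forall n, T n -> {ffun 'I_(m n) -> nat})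
  (hw : forall n, (0 < n)%N ->
     cond_multinomial (P n) (g_sigma_preimage (fun i => s n i : T n -> borelV R n))
       (m n) (fun=> (m n)%:R^-1) (w n))
  (* (i) *)
  (lambda_inf : R) (H : 'M[R]_d) (g : 'cV[R]_d) (c0 : R)
  (lambda_inf_ge0 : 0 <= lambda_inf)
  (lambda_cvg : lambda n @[n --> \oo] --> lambda_inf)
  (H_cvg : gramH (X n) @[n --> \oo] --> H)
  (g_cvg : crossg (X n) (y n) @[n --> \oo] --> g)
  (c0_gt0 : 0 < c0)
  (eigen_lb : \forall n \near \oo, c0 <= lambda_min (gramH (X n) + (lambda n)%:M))
  (* (ii) *)
  (s_indep : forall n, (0 < n)%N ->
     mutually_independent (P n) (fun i => s n i : T n -> borelV R n))
  (s_ident : forall n, (0 < n)%N ->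
     identically_distributed (P n) (fun i => s n i : T n -> borelV R n))
  (s_isotropic : forall n, (0 < n)%N ->
     let s1 t : 'cV[R]_n := s n (Ordinal (m_gt0 n)) t in
     mx_expectation (P n) (fun t => s1 t *m (s1 t)^T) = 1%:M)
  (moment4 :
     (ereal_sup [set 'E_(P n)[fun t =>
        let s1 : 'cV[R]_n := s n (Ordinal (m_gt0 n)) t in
        let z := zrow (X n) s1 in
        let u := urow (y n) s1 in
        (frobenius (z *m z^T - gramH (X n)) ^+ 4
         + frobenius (u *: z - crossg (X n) (y n)) ^+ 4)%R]
      | n in [set n | (0 < n)%N]] < +oo)%E)
  (Omega : 'M[R]_d)
  (Omega_cvg :
     mx_expectation (P n) (fun t =>
       let psi := influence (X n) (y n) (lambda n)
                    (s n (Ordinal (m_gt0 n)) t : 'cV[R]_n) in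
       psi *m psi^T) @[n --> \oo] --> Omega)
  (* (iii) *)
  (Omega_rank : (1 <= \rank Omega)%N)
  (N : probability (borelV R d) R) (hN : centered_normal Omega N) :
  let betahat n t :=
    sketched_ridge (X n) (y n) (lambda n) (fun i => s n i t : 'cV[R]_n) in
  let betastar n t :=
    boot_ridge (X n) (y n) (lambda n) (fun i => s n i t : 'cV[R]_n) (w n t) in
  cvg_weakly P
    (fun n t => Num.sqrt (m n)%:R *:
       (betahat n t - ridge (X n) (y n) (lambda n))) N
  /\ cvg_cond_weakly P
       (fun n => g_sigma_preimage (fun i => s n i : T n -> borelV R n))
       (fun n t => Num.sqrt (m n)%:R *: (betastar n t - betahat n t)) N.
Proof.
pose i0 n := Ordinal (m_gt0 n).
pose f n t := frobenius (zz_dev (X n) (s n (i0 n) t)) ^+ 4 +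
  frobenius (zu_dev (X n) (y n) (s n (i0 n) t)) ^+ 4.
have f0 n t : 0 <= f n t.
  by rewrite /f !frobenius4 addr_ge0// sqr_ge0.
set A := [set _ | _ in _] in moment4.
have fA n : (0 < n)%N -> A (\int[P n]_t (f n t)%:E)%E.
  by move=> n0; exists n => //; rewrite unlock.
have fle n : (0 < n)%N -> (\int[P n]_t (f n t)%:E <= (fine (ereal_sup A))%:E)%E.
  (* The supremum is below +oo by assumption and nonnegative because of its member at n = 1, so
     [fine] keeps its value. *)
  move=> n0; rewrite fineK; first by apply: ereal_sup_ubound; exact: fA.
  rewrite ge0_fin_numE//; apply: le_trans (ereal_sup_ubound (fA 1%N isT)).
  by apply: integral_ge0 => t _; rewrite lee_fin.
move=> betahat betastar; split.
  exact: (sketched_ridge_weak hd m_infty g_cvg c0_gt0 eigen_lb s_indep s_ident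
    s_isotropic fle Omega_cvg hN).
exact: (boot_cond_weak hd m_infty g_cvg c0_gt0 eigen_lb s_indep s_ident
  s_isotropic fle Omega_cvg hN hw).
Qed.
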